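(* Let $K$ be a field of characteristic $\neq 2$ and let $f:C\to\mathbb P^1_K$ be a double cover of $\mathbb P^1_K$. (1) If $C$ is smooth, then an $\mathcal O_C$-module is traceable if and only if it is a line bundle on $C$. (2) If $C$ is reduced, then an $\mathcal O_C$-module is traceable if and only if it is a (coherent) rank $1$ torsion-free sheaf on $C$. (3) If $C$ is non-reduced, then: every (coherent) rank $1$ torsion-free sheaf on $C$ is a traceable module; every traceable module is torsion-free; and every traceable module that is not of rank $1$ is annihilated by the nilradical of $\mathcal O_C$.
   Context: A double cover $f:X\to T$ is a finite flat morphism of degree $2$. Given a double cover $f:X\to T$, a (quasi-coherent) $\mathcal O_X$-module $M$ is traceable if (i) $f_*M$ is a locally free $\mathcal O_T$-module of rank $2$, and (ii) the composite $f_*\mathcal O_X\to \mathrm{End}_{\mathcal O_T}(f_*M)\to\mathcal O_T$ (multiplication followed by trace) equals the composite $f_*\mathcal O_X\to \mathrm{End}_{\mathcal O_T}(f_*\mathcal O_X)\to\mathcal O_T$. For a ring $R$ with total quotient ring $K(R)$, an $R$-module $M$ is torsion-free if for every nonzero $m\in M$ the annihilator $\mathrm{ann}(m)$ consists of zero divisors of $R$ (with $0$ counted as a zero divisor); $M$ has rank $1$ if $M\otimes_RK(R)\cong K(R)$ as $K(R)$-modules. A coherent sheaf on $C$ is torsion-free (resp. rank $1$) if for every $w\in\mathbb P^1_K$ its restriction to the semilocal ring $R=\mathcal O_{C,f^{-1}(w)}=(f_*\mathcal O_C)_w$ is torsion-free (resp. rank $1$). *)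

(* Defs.v *)
From HB Require Import structures.
From mathcomp Require Import all_boot all_order all_algebra.
From mathcomp Require Import generic_quotient.
From mathcomp Require Import boolp classical_sets functions topology.

Set Implicit Arguments.
Unset Strict Implicit.
Unset Printing Implicit Defensive.

Import GRing.Theory.
Local Open Scope quotient_scope.
Local Open Scope classical_set_scope.
Local Open Scope ring_scope.

(* Rings of sections may be zero (for instance on the empty set), hence the
   use of comPzRingType throughout. *)

Definition invertible (R : comPzRingType) (r : R) := exists t, t * r = 1.

Definition zero_divisor (R : comPzRingType) (r : R) :=
  exists2 t : R, t != 0 & t * r = 0.

Definition powers (R : comPzRingType) (s : R) : set R := [set s ^+ n | n in setT].

Definition prime_ideal (R : comPzRingType) (p : set R) :=
  [/\ p 0, forall a b, p a -> p b -> p (a + b), forall a b, p b -> p (a * b),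
      ~ p 1 & forall a b, p (a * b) -> p a \/ p b].

(* iota : R -> Q exhibits Q as the localization of R at S. *)
Definition is_localization (R Q : comPzRingType) (S : set R)
    (iota : {rmorphism R -> Q}) :=
  [/\ forall s, S s -> invertible (iota s),
      forall q, exists a s, S s /\ iota s * q = iota a
    & forall a, iota a = 0 -> exists s, S s /\ s * a = 0].

Definition total_quotient_ring (R Q : comPzRingType) (iota : {rmorphism R -> Q}) :=
  is_localization [set s | ~ zero_divisor s] iota.

Definition fg_module (R : comPzRingType) (M : lmodType R) :=
  exists n (e : 'I_n -> M), forall m, exists a : 'I_n -> R, m = \sum_i a i *: e i.

(* Universal property of Q (x)_R M: h is semilinear along iota, and every
   semilinear map from M to a Q-module factors uniquely through h. *)
Definition is_base_change (R Q : comPzRingType) (iota : {rmorphism R -> Q})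
    (M : lmodType R) (N : lmodType Q) (h : M -> N) :=
  let semilin (P : lmodType Q) (g : M -> P) :=
    forall a x y, g (a *: x + y) = iota a *: g x + g y in
  semilin N h /\
  forall (P : lmodType Q) (g : M -> P), semilin P g ->
    exists! k : N -> P, linear k /\ forall m, k (h m) = g m.

(* M (x)_R K(R) is isomorphic to K(R). *)
Definition module_rank1 (R : comPzRingType) (M : lmodType R) :=
  exists (Q : comPzRingType) (iota : {rmorphism R -> Q}),
    total_quotient_ring iota /\
    exists (N : lmodType Q) (h : M -> N), is_base_change iota h /\
    exists i : {linear N -> Q^o}, bijective i.

Definition module_torsion_free (R : comPzRingType) (M : lmodType R) :=
  forall m : M, m != 0 -> forall r : R, r *: m = 0 -> r = 0 \/ zero_divisor r.

(* Infinitesimal lifting property of the K-algebra alpha : K -> A. *)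
Definition formally_smooth (K A : comPzRingType) (alpha : K -> A) :=
  forall (B B' : comPzRingType) (beta : {rmorphism K -> B})
         (pi : {rmorphism B -> B'}) (g : {rmorphism A -> B'}),
    (forall b', exists b, pi b = b') ->
    (forall b c, pi b = 0 -> pi c = 0 -> b * c = 0) ->
    (forall c, g (alpha c) = pi (beta c)) ->
    exists h : {rmorphism A -> B},
      (forall a, pi (h a) = g a) /\ (forall c, h (alpha c) = beta c).

Definition finite_type_algebra (K A : comPzRingType) (alpha : K -> A) :=
  exists n (x : 'I_n -> A), forall S : set A,
    (forall c, S (alpha c)) -> (forall i, S (x i)) ->
    (forall a b, S a -> S b -> S (a - b)) ->
    (forall a b, S a -> S b -> S (a * b)) -> S = setT.

(* Over a field, finite type and finite presentation coincide. *)
Definition smooth_algebra (K : fieldType) (A : comPzRingType) (alpha : K -> A) :=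
  finite_type_algebra alpha /\ formally_smooth alpha.

Section RestrictionOfScalars.
Variables (R S : pzRingType) (phi : {rmorphism R -> S}).

Definition restrict_scalars of {rmorphism R -> S} := fun M : lmodType S => M : Type.

Variable M : lmodType S.
Local Notation N := (restrict_scalars phi M).
HB.instance Definition _ := GRing.Zmodule.on N.

Let scale (a : R) (m : N) : N := phi a *: (m : M).
Fact restrict_scalarsA a b m : scale a (scale b m) = scale (a * b) m.
Proof. by rewrite /scale rmorphM scalerA. Qed.
Fact restrict_scalars1 : left_id 1 scale.
Proof. by move=> m; rewrite /scale rmorph1 scale1r. Qed.
Fact restrict_scalarsDr : right_distributive scale +%R.
Proof. by move=> a m n; rewrite /scale scalerDr. Qed.
Fact restrict_scalarsDl m : {morph scale^~ m : a b / a + b}.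
Proof. by move=> a b; rewrite /scale rmorphD scalerDl. Qed.
HB.instance Definition _ := GRing.Zmodule_isLmodule.Build R N
  restrict_scalarsA restrict_scalars1 restrict_scalarsDr restrict_scalarsDl.

End RestrictionOfScalars.

Record opens (X : topologicalType) := Opens { oset :> set X; osetP : open oset }.

Definition openT (X : topologicalType) : opens X := Opens (@openT X).
Definition openI (X : topologicalType) (U V : opens X) : opens X :=
  Opens (openI (osetP U) (osetP V)).

Lemma openTS (X : topologicalType) (U : opens X) : U `<=` openT X.
Proof. by []. Qed.
Lemma openIl (X : topologicalType) (U V : opens X) : openI U V `<=` U.
Proof. by move=> x []. Qed.
Lemma openIr (X : topologicalType) (U V : opens X) : openI U V `<=` V.
Proof. by move=> x []. Qed.

Section Preimage.
Variables (X Y : topologicalType) (f : X -> Y) (fc : continuous f).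

Definition opre (U : opens Y) : opens X :=
  Opens ((continuousP f).1 fc U (osetP U)).

Lemma opreS (U V : opens Y) : V `<=` U -> opre V `<=` opre U.
Proof. by move=> h x; exact: h. Qed.

End Preimage.

Record ringPresheaf (X : topologicalType) := RingPresheaf {
  rsec :> opens X -> comPzRingType;
  rres : forall U V : opens X, V `<=` U -> {rmorphism rsec U -> rsec V};
  rres_id : forall (U : opens X) (h : U `<=` U) s, rres h s = s;
  rres_comp : forall (U V W : opens X) (h : V `<=` U) (k : W `<=` V) (l : W `<=` U) s,
    rres k (rres h s) = rres l s }.
Arguments rres {X} O {U V} h : rename.

Record modPresheaf (X : topologicalType) (O : ringPresheaf X) := ModPresheaf {
  msec :> forall U : opens X, lmodType (O U);
  mres : forall U V : opens X, V `<=` U -> msec U -> msec V;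
  mresP : forall (U V : opens X) (h : V `<=` U) a m n,
    mres h (a *: m + n) = rres O h a *: mres h m + mres h n;
  mres_id : forall (U : opens X) (h : U `<=` U) m, mres h m = m;
  mres_comp : forall (U V W : opens X) (h : V `<=` U) (k : W `<=` V) (l : W `<=` U) m,
    mres k (mres h m) = mres l m }.
Arguments mres {X O} M {U V} h m : rename.

Definition is_sheaf (X : topologicalType) (F : opens X -> Type)
    (res : forall U V : opens X, V `<=` U -> F U -> F V) :=
  forall (I : Type) (U : opens X) (V : I -> opens X) (hV : forall i, V i `<=` U),
    (forall x, oset U x -> exists i, oset (V i) x) ->
    forall s : forall i, F (V i),
      (forall i j (W : opens X) (hi : W `<=` V i) (hj : W `<=` V j),
         res _ _ hi (s i) = res _ _ hj (s j)) ->
      exists! t : F U, forall i, res _ _ (hV i) t = s i.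

Definition regular_presheaf (X : topologicalType) (O : ringPresheaf X) :
  modPresheaf O.
Proof.
exists (fun U => (O U)^o) (fun U V h => rres O h).
- by move=> U V h a m n; rewrite rmorphD rmorphM.
- exact: rres_id.
- exact: rres_comp.
Defined.

Record ringPresheafMorphism (X : topologicalType) (O O' : ringPresheaf X) :=
  RingPresheafMorphism {
  rmap :> forall U, {rmorphism O U -> O' U};
  rmapP : forall (U V : opens X) (h : V `<=` U) s, rmap V (rres O h s) = rres O' h (rmap U s) }.

Definition restrict_presheaf (X : topologicalType) (O O' : ringPresheaf X)
    (phi : ringPresheafMorphism O O') (M : modPresheaf O') : modPresheaf O.
Proof.
exists (fun U => restrict_scalars (phi U) (M U)) (fun U V h => mres M h).
- by move=> U V h a m n; move: (mresP h (phi U a) m n); rewrite -rmapP.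
- by move=> U h m; exact: mres_id.
- by move=> U V W h k l m; exact: mres_comp.
Defined.

Section Pushforward.
Variables (X Y : topologicalType) (f : X -> Y) (fc : continuous f).

Definition push_ring (O : ringPresheaf X) : ringPresheaf Y.
Proof.
exists (fun U => O (opre fc U)) (fun U V h => rres O (opreS (fc := fc) h)).
- by move=> U h s; exact: rres_id.
- by move=> U V W h k l s; exact: rres_comp.
Defined.

Definition push_mod (O : ringPresheaf X) (M : modPresheaf O) :
  modPresheaf (push_ring O).
Proof.
exists (fun U => M (opre fc U)) (fun U V h => mres M (opreS (fc := fc) h)).
- by move=> U V h a m n; exact: mresP.
- by move=> U h m; exact: mres_id.
- by move=> U V W h k l m; exact: mres_comp.
Defined.

End Pushforward.

Record setPresheaf (X : topologicalType) := SetPresheaf {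
  ssec :> opens X -> Type;
  sres : forall U V : opens X, V `<=` U -> ssec U -> ssec V;
  sres_id : forall (U : opens X) (h : U `<=` U) s, sres h s = s;
  sres_comp : forall (U V W : opens X) (h : V `<=` U) (k : W `<=` V) (l : W `<=` U) s,
    sres k (sres h s) = sres l s }.
Arguments sres {X} F {U V} h s : rename.

Definition set_of_ring (X : topologicalType) (O : ringPresheaf X) :=
  SetPresheaf (@rres_id X O) (@rres_comp X O).
Definition set_of_mod (X : topologicalType) (O : ringPresheaf X)
  (M : modPresheaf O) := SetPresheaf (@mres_id X O M) (@mres_comp X O M).

Section Stalk.
Variables (X : topologicalType) (x : X).

Section OnePresheaf.
Variable F : setPresheaf X.

Record pregerm := Pregerm { gdom : opens X; gdomP : oset gdom x; gval : F gdom }.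
HB.instance Definition _ := gen_eqMixin pregerm.
HB.instance Definition _ := gen_choiceMixin pregerm.

Definition same_germ (g g' : pregerm) : bool :=
  `[< exists (W : opens X) (h : W `<=` gdom g) (h' : W `<=` gdom g'),
        oset W x /\ sres F h (gval g) = sres F h' (gval g') >].

Fact same_germ_refl : reflexive same_germ.
Proof.
move=> g; apply/asboolP; exists (gdom g), (fun y => id), (fun y => id).
by split=> //; exact: gdomP.
Qed.

Fact same_germ_sym : symmetric same_germ.
Proof.
by move=> g g'; apply/asboolP/asboolP => -[W [h [h' [Wx e]]]]; exists W, h', h.
Qed.

Fact same_germ_trans : transitive same_germ.
Proof.
move=> g2 g1 g3 /asboolP[W [h [h' [Wx e]]]] /asboolP[V [k [k' [Vx e']]]].
have lW : openI W V `<=` W by move=> y [].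
have lV : openI W V `<=` V by move=> y [].
apply/asboolP; exists (openI W V), (subset_trans lW h), (subset_trans lV k').
split; first by split.
rewrite -(sres_comp h lW) e -(sres_comp k' lV) -e'.
by rewrite !(sres_comp _ _ (subset_trans lW h')).
Qed.

Canonical same_germ_equiv :=
  EquivRel same_germ same_germ_refl same_germ_sym same_germ_trans.

Definition stalk := {eq_quot same_germ_equiv}.
HB.instance Definition _ := Choice.on stalk.

Definition germ (U : opens X) (Ux : oset U x) (s : F U) : stalk :=
  \pi_stalk (Pregerm Ux s).

Lemma germ_eqP (U V : opens X) (Ux : oset U x) (Vx : oset V x) (s : F U) (t : F V) :
  germ Ux s = germ Vx t <->
  exists (W : opens X) (h : W `<=` U) (k : W `<=` V),
    oset W x /\ sres F h s = sres F k t.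
Proof.
split=> [/eqmodP/asboolP //|H]; apply/eqmodP; exact/asboolP.
Qed.

Lemma germ_res (U V : opens X) (h : V `<=` U) (Ux : oset U x) (Vx : oset V x) (s : F U) :
  germ Vx (sres F h s) = germ Ux s.
Proof.
apply/germ_eqP; exists V, (fun y => id), h; split=> //.
by rewrite sres_id.
Qed.

Lemma stalkP (p : stalk) : exists (U : opens X) (Ux : oset U x) s, p = germ Ux s.
Proof.
exists (gdom (repr p)), (gdomP (repr p)), (gval (repr p)).
by rewrite -[LHS]reprK; congr (\pi _); case: (repr p).
Qed.

End OnePresheaf.

Lemma stalk2P (F G : setPresheaf X) (p : stalk F) (q : stalk G) :
  exists (U : opens X) (Ux : oset U x) s t, p = germ Ux s /\ q = germ Ux t.
Proof.
have [U [Ux [s ->]]] := stalkP p; have [V [Vx [t ->]]] := stalkP q.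
have lU := @openIl _ U V.
have lV := @openIr _ U V.
exists (openI U V), (conj Ux Vx), (sres F lU s), (sres G lV t).
by rewrite !germ_res.
Qed.

Lemma stalk3P (F G H : setPresheaf X) (p : stalk F) (q : stalk G) (r : stalk H) :
  exists (U : opens X) (Ux : oset U x) s t u,
    [/\ p = germ Ux s, q = germ Ux t & r = germ Ux u].
Proof.
have [U [Ux [s [t [-> ->]]]]] := stalk2P p q; have [V [Vx [u ->]]] := stalkP r.
have lU := @openIl _ U V.
have lV := @openIr _ U V.
exists (openI U V), (conj Ux Vx), (sres F lU s), (sres G lU t), (sres H lV u).
by split; rewrite germ_res.
Qed.

Section Maps.
Variables F G H : setPresheaf X.

Definition stalk_map (f : forall U, F U -> G U) (p : stalk F) : stalk G :=
  germ (gdomP (repr p)) (f _ (gval (repr p))).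

Lemma stalk_mapE (f : forall U, F U -> G U) :
  (forall (U V : opens X) (h : V `<=` U) s, sres G h (f U s) = f V (sres F h s)) ->
  forall (U : opens X) (Ux : oset U x) s, stalk_map f (germ Ux s) = germ Ux (f U s).
Proof.
move=> fres U Ux s; rewrite /stalk_map; set g := repr _.
have : germ (gdomP g) (gval g) = germ Ux s.
  by rewrite -[RHS]reprK -/g; congr (\pi _); case: (g).
move=> /germ_eqP[W [h [k [Wx e]]]]; apply/germ_eqP; exists W, h, k; split=> //.
by rewrite !fres e.
Qed.

Definition stalk_map2 (f : forall U, F U -> G U -> H U) (p : stalk F) (q : stalk G) :
    stalk H :=
  let g := repr p in let g' := repr q in
  @germ H (openI (gdom g) (gdom g')) (conj (gdomP g) (gdomP g'))
    (f _ (sres F (@openIl _ _ _) (gval g)) (sres G (@openIr _ _ _) (gval g'))).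

Lemma stalk_map2E (f : forall U, F U -> G U -> H U) :
  (forall (U V : opens X) (h : V `<=` U) s t,
     sres H h (f U s t) = f V (sres F h s) (sres G h t)) ->
  forall (U : opens X) (Ux : oset U x) s t,
    stalk_map2 f (germ Ux s) (germ Ux t) = germ Ux (f U s t).
Proof.
move=> fres U Ux s t; rewrite /stalk_map2 /=.
set g := repr _; set g' := repr _.
have : germ (gdomP g) (gval g) = germ Ux s.
  by rewrite -[RHS]reprK -/g; congr (\pi _); case: (g).
have : germ (gdomP g') (gval g') = germ Ux t.
  by rewrite -[RHS]reprK -/g'; congr (\pi _); case: (g').
move=> /germ_eqP[W' [h' [k' [Wx' e']]]] /germ_eqP[W [h [k [Wx e]]]].
have l : openI W W' `<=` W by move=> y [].
have l' : openI W W' `<=` W' by move=> y [].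
have m : openI W W' `<=` openI (gdom g) (gdom g').
  by move=> y [Wy W'y]; split; [exact: (h y) | exact: (h' y)].
apply/germ_eqP; exists (openI W W'), m, (subset_trans l k); split=> //.
rewrite !fres; congr (f _ _ _).
- rewrite (sres_comp _ m (subset_trans l h)) -(sres_comp h l (subset_trans l h)) e.
  exact: sres_comp.
- rewrite (sres_comp _ m (subset_trans l' h')).
  by rewrite -(sres_comp h' l' (subset_trans l' h')) e' (sres_comp k' l' (subset_trans l k)).
Qed.

End Maps.
End Stalk.

Section StalkRing.
Variables (X : topologicalType) (O : ringPresheaf X) (x : X).

Definition ring_stalk := stalk x (set_of_ring O).
HB.instance Definition _ := Choice.on ring_stalk.

Definition rgerm (U : opens X) (Ux : oset U x) (s : O U) : ring_stalk :=
  @germ X x (set_of_ring O) U Ux s.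

Definition stalk_add : ring_stalk -> ring_stalk -> ring_stalk :=
  stalk_map2 (F := set_of_ring O) (G := set_of_ring O) (H := set_of_ring O) (fun U (s t : O U) => s + t).
Definition stalk_mul : ring_stalk -> ring_stalk -> ring_stalk :=
  stalk_map2 (F := set_of_ring O) (G := set_of_ring O) (H := set_of_ring O) (fun U (s t : O U) => s * t).
Definition stalk_opp : ring_stalk -> ring_stalk :=
  stalk_map (F := set_of_ring O) (G := set_of_ring O) (fun U (s : O U) => - s).
Definition stalk0 : ring_stalk := @rgerm (openT X) I 0.
Definition stalk1 : ring_stalk := @rgerm (openT X) I 1.

Lemma rgerm_res (U V : opens X) (h : V `<=` U) Ux Vx (s : O U) :
  @rgerm V Vx (rres O h s) = @rgerm U Ux s.
Proof. exact: (@germ_res _ _ (set_of_ring O)). Qed.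

Lemma rgermD (U : opens X) (Ux : oset U x) (s t : O U) :
  stalk_add (rgerm Ux s) (rgerm Ux t) = rgerm Ux (s + t).
Proof. by apply: stalk_map2E => V W h a b; exact: rmorphD. Qed.

Lemma rgermM (U : opens X) (Ux : oset U x) (s t : O U) :
  stalk_mul (rgerm Ux s) (rgerm Ux t) = rgerm Ux (s * t).
Proof. by apply: stalk_map2E => V W h a b; exact: rmorphM. Qed.

Lemma rgermN (U : opens X) (Ux : oset U x) (s : O U) :
  stalk_opp (rgerm Ux s) = rgerm Ux (- s).
Proof. by apply: stalk_mapE => V W h a; exact: rmorphN. Qed.

Lemma rgerm0 (U : opens X) (Ux : oset U x) : stalk0 = rgerm Ux 0.
Proof. by rewrite /stalk0 -(rgerm_res (@openTS _ U) I Ux 0) rmorph0. Qed.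

Lemma rgerm1 (U : opens X) (Ux : oset U x) : stalk1 = rgerm Ux 1.
Proof. by rewrite /stalk1 -(rgerm_res (@openTS _ U) I Ux 1) rmorph1. Qed.

Fact stalk_addA : associative stalk_add.
Proof.
move=> p q r; have [U [Ux [s [t [u [-> -> ->]]]]]] := stalk3P p q r.
by rewrite !rgermD addrA.
Qed.

Fact stalk_addC : commutative stalk_add.
Proof.
move=> p q; have [U [Ux [s [t [-> ->]]]]] := stalk2P p q.
by rewrite !rgermD addrC.
Qed.

Fact stalk_add0 : left_id stalk0 stalk_add.
Proof. by move=> p; have [U [Ux [s ->]]] := stalkP p; rewrite (rgerm0 Ux) rgermD add0r. Qed.

Fact stalk_addN : left_inverse stalk0 stalk_opp stalk_add.
Proof.
move=> p; have [U [Ux [s ->]]] := stalkP p.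
by rewrite (rgerm0 Ux) rgermN rgermD addNr.
Qed.

Fact stalk_mulA : associative stalk_mul.
Proof.
move=> p q r; have [U [Ux [s [t [u [-> -> ->]]]]]] := stalk3P p q r.
by rewrite !rgermM mulrA.
Qed.

Fact stalk_mulC : commutative stalk_mul.
Proof.
move=> p q; have [U [Ux [s [t [-> ->]]]]] := stalk2P p q.
by rewrite !rgermM mulrC.
Qed.

Fact stalk_mul1 : left_id stalk1 stalk_mul.
Proof. by move=> p; have [U [Ux [s ->]]] := stalkP p; rewrite (rgerm1 Ux) rgermM mul1r. Qed.

Fact stalk_mulD : left_distributive stalk_mul stalk_add.
Proof.
move=> p q r; have [U [Ux [s [t [u [-> -> ->]]]]]] := stalk3P p q r.
by rewrite !(rgermD, rgermM) mulrDl.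
Qed.

HB.instance Definition _ := GRing.isZmodule.Build ring_stalk
  stalk_addA stalk_addC stalk_add0 stalk_addN.
HB.instance Definition _ := GRing.Zmodule_isComPzRing.Build ring_stalk
  stalk_mulA stalk_mulC stalk_mul1 stalk_mulD.

Variable M : modPresheaf O.

Definition mod_stalk := stalk x (set_of_mod M).
HB.instance Definition _ := Choice.on mod_stalk.

Definition mgerm (U : opens X) (Ux : oset U x) (m : M U) : mod_stalk :=
  @germ X x (set_of_mod M) U Ux m.

Fact mresD (U V : opens X) (h : V `<=` U) (m n : M U) :
  mres M h (m + n) = mres M h m + mres M h n.
Proof. by rewrite -[m]scale1r mresP rmorph1 !scale1r. Qed.

Fact mres0 (U V : opens X) (h : V `<=` U) : mres M h 0 = 0.
Proof. by apply: (addIr (mres M h 0)); rewrite -mresD !add0r. Qed.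

Fact mresN (U V : opens X) (h : V `<=` U) (m : M U) : mres M h (- m) = - mres M h m.
Proof. by apply: (addIr (mres M h m)); rewrite -mresD !addNr mres0. Qed.

Fact mresZ (U V : opens X) (h : V `<=` U) a (m : M U) :
  mres M h (a *: m) = rres O h a *: mres M h m.
Proof. by rewrite -[a *: m]addr0 mresP mres0 addr0. Qed.

Definition mod_stalk_add : mod_stalk -> mod_stalk -> mod_stalk :=
  stalk_map2 (F := set_of_mod M) (G := set_of_mod M) (H := set_of_mod M) (fun U (m n : M U) => m + n).
Definition mod_stalk_opp : mod_stalk -> mod_stalk :=
  stalk_map (F := set_of_mod M) (G := set_of_mod M) (fun U (m : M U) => - m).
Definition mod_stalk_scale : ring_stalk -> mod_stalk -> mod_stalk :=
  stalk_map2 (F := set_of_ring O) (G := set_of_mod M) (H := set_of_mod M) (fun U (a : O U) (m : M U) => a *: m).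
Definition mod_stalk0 : mod_stalk := @mgerm (openT X) I 0.

Lemma mgerm_res (U V : opens X) (h : V `<=` U) Ux Vx (m : M U) :
  @mgerm V Vx (mres M h m) = @mgerm U Ux m.
Proof. exact: (@germ_res _ _ (set_of_mod M)). Qed.

Lemma mgermD (U : opens X) (Ux : oset U x) (m n : M U) :
  mod_stalk_add (mgerm Ux m) (mgerm Ux n) = mgerm Ux (m + n).
Proof. by apply: stalk_map2E => V W h a b; exact: mresD. Qed.

Lemma mgermN (U : opens X) (Ux : oset U x) (m : M U) :
  mod_stalk_opp (mgerm Ux m) = mgerm Ux (- m).
Proof. by apply: stalk_mapE => V W h a; exact: mresN. Qed.

Lemma mgermZ (U : opens X) (Ux : oset U x) (a : O U) (m : M U) :
  mod_stalk_scale (rgerm Ux a) (mgerm Ux m) = mgerm Ux (a *: m).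
Proof. by apply: stalk_map2E => V W h b n; exact: mresZ. Qed.

Lemma mgerm0 (U : opens X) (Ux : oset U x) : mod_stalk0 = mgerm Ux 0.
Proof. by rewrite /mod_stalk0 -(mgerm_res (@openTS _ U) I Ux 0) mres0. Qed.

Fact mod_stalk_addA : associative mod_stalk_add.
Proof.
move=> p q r; have [U [Ux [s [t [u [-> -> ->]]]]]] := stalk3P p q r.
by rewrite !mgermD addrA.
Qed.

Fact mod_stalk_addC : commutative mod_stalk_add.
Proof.
move=> p q; have [U [Ux [s [t [-> ->]]]]] := stalk2P p q.
by rewrite !mgermD addrC.
Qed.

Fact mod_stalk_add0 : left_id mod_stalk0 mod_stalk_add.
Proof. by move=> p; have [U [Ux [s ->]]] := stalkP p; rewrite (mgerm0 Ux) mgermD add0r. Qed.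

Fact mod_stalk_addN : left_inverse mod_stalk0 mod_stalk_opp mod_stalk_add.
Proof.
move=> p; have [U [Ux [s ->]]] := stalkP p.
by rewrite (mgerm0 Ux) mgermN mgermD addNr.
Qed.

HB.instance Definition _ := GRing.isZmodule.Build mod_stalk
  mod_stalk_addA mod_stalk_addC mod_stalk_add0 mod_stalk_addN.

Fact mod_stalk_scaleA a b m :
  mod_stalk_scale a (mod_stalk_scale b m) = mod_stalk_scale (a * b) m.
Proof.
have [U [Ux [s [t [u [-> -> ->]]]]]] := stalk3P a b m.
by rewrite !mgermZ [_ * _]rgermM mgermZ scalerA.
Qed.

Fact mod_stalk_scale1 : left_id 1 mod_stalk_scale.
Proof.
move=> m; have [U [Ux [s ->]]] := stalkP m.
by rewrite [1](rgerm1 Ux) mgermZ scale1r.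
Qed.

Fact mod_stalk_scaleDr : right_distributive mod_stalk_scale +%R.
Proof.
move=> a m n; have [U [Ux [s [t [u [-> -> ->]]]]]] := stalk3P a m n.
by rewrite [_ + _]mgermD !mgermZ [RHS]mgermD scalerDr.
Qed.

Fact mod_stalk_scaleDl m : {morph mod_stalk_scale^~ m : a b / a + b}.
Proof.
move=> a b; have [U [Ux [s [t [u [-> -> ->]]]]]] := stalk3P a b m.
by rewrite [_ + _]rgermD !mgermZ [RHS]mgermD scalerDl.
Qed.

HB.instance Definition _ := GRing.Zmodule_isLmodule.Build ring_stalk mod_stalk
  mod_stalk_scaleA mod_stalk_scale1 mod_stalk_scaleDr mod_stalk_scaleDl.

End StalkRing.

Section Affine.
Variables (X : topologicalType) (O : ringPresheaf X).

(* The germ of s at x is a unit of the stalk. *)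
Definition unit_at (U : opens X) (s : O U) (x : X) :=
  exists (V : opens X) (h : V `<=` U), oset V x /\ invertible (rres O h s).

Fact basic_open_subproof (U : opens X) (s : O U) : open [set x | unit_at s x].
Proof.
rewrite openE => x [V [h [Vx Vs]]]; apply: (@filterS _ _ _ (oset V)).
  by move=> y Vy; exists V, h.
by apply: open_nbhs_nbhs; split; [exact: osetP|].
Qed.

Definition basic_open (U : opens X) (s : O U) : opens X :=
  Opens (basic_open_subproof s).

Lemma basic_openS (U : opens X) (s : O U) : basic_open s `<=` U.
Proof. by move=> x [V [h [Vx _]]]; exact: h. Qed.

Definition vanishing (U : opens X) (x : X) : set (O U) := [set s | ~ unit_at s x].
Arguments vanishing : clear implicits.

(* The canonical map x |-> vanishing U x from (U, O|U) to Spec (O U) is an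
   isomorphism: it is a bijection onto the prime ideals (first two clauses), a
   homeomorphism for the Zariski topology (third clause; it is continuous since
   basic opens are open), and it identifies the structure sheaves, since that of
   Spec A takes the value A_s on the basic open D(s) (last clause). *)
Definition affine (U : opens X) :=
  [/\ forall x, oset U x -> prime_ideal (vanishing U x),
      forall p : set (O U), prime_ideal p ->
        exists! x, oset U x /\ vanishing U x = p,
      forall (V : opens X) x, V `<=` U -> oset V x ->
        exists s : O U, oset (basic_open s) x /\ basic_open s `<=` V
    & forall s : O U, is_localization (powers s) (rres O (@basic_openS U s))].

End Affine.

Record ringedSpace := RingedSpace {
  space :> topologicalType;
  Osh : ringPresheaf space;
  OshP : is_sheaf (fun U V h => rres Osh (U := U) (V := V) h) }.

Record scheme := Scheme {
  scheme_space :> ringedSpace;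
  schemeP : forall x : scheme_space, exists U, oset U x /\ affine (Osh scheme_space) U }.

(* The last field says that the maps induced on stalks are local. *)
Record schemeMorphism (X Y : scheme) := SchemeMorphism {
  mfun :> X -> Y;
  mcont : continuous mfun;
  comor : ringPresheafMorphism (Osh Y) (push_ring mcont (Osh X));
  mlocal : forall (U : opens Y) (s : Osh Y U) (x : X), oset U (mfun x) ->
    @unit_at X (Osh X) (opre mcont U) (comor U s) x -> unit_at s (mfun x) }.
Arguments mcont {X Y} f : rename.

Record sheafOfModules (X : ringedSpace) := SheafOfModules {
  smod :> modPresheaf (Osh X);
  smodP : is_sheaf (fun U V h => mres smod (U := U) (V := V) h) }.

Section ModuleProperties.
Variables (X : topologicalType) (O : ringPresheaf X) (M : modPresheaf O).

(* e is a basis of M over U: it defines an isomorphism (O|U)^n -> M|U. *)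
Definition is_basis (U : opens X) n (e : 'I_n -> M U) :=
  forall (V : opens X) (h : V `<=` U),
    bijective (fun a : 'rV[O V]_n => \sum_i a ord0 i *: mres M h (e i)).

Definition locally_free (n : nat) :=
  forall x, exists U : opens X, oset U x /\ exists e : 'I_n -> M U, is_basis e.

(* On an affine open U, M is the sheaf associated with the module M U: its
   sections on the basic open of s are the localization of M U at s (where s
   acts invertibly, being a unit of O (basic_open s)). *)
Definition quasi_coherent :=
  forall U : opens X, affine O U -> forall s : O U,
    (forall n : M (basic_open s), exists m k,
       rres O (@basic_openS X O U s) (s ^+ k) *: n = mres M (@basic_openS X O U s) m) /\
    (forall m : M U, mres M (@basic_openS X O U s) m = 0 -> exists k, s ^+ k *: m = 0).

(* The usual notion on a locally noetherian scheme (such as a double cover of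
   the projective line), where finitely generated modules over affine opens are
   finitely presented. *)
Definition coherent :=
  quasi_coherent /\ forall U : opens X, affine O U -> fg_module (M U).

Definition line_bundle := locally_free 1.

(* Local sections of the sheaf End(M). *)
Record endo (U : opens X) := Endo {
  eapp : forall V : opens X, V `<=` U -> M V -> M V;
  eapp_linear : forall (V : opens X) (h : V `<=` U), linear (eapp h);
  eapp_res : forall (V W : opens X) (h : V `<=` U) (k : W `<=` V) (l : W `<=` U) m,
    mres M k (eapp h m) = eapp l (mres M k m) }.

(* Row i of A holds the coordinates of E (e i). *)
Definition is_trace (U : opens X) (E : endo U) (t : O U) :=
  forall (V : opens X) (h : V `<=` U) n (e : 'I_n -> M V) (A : 'M[O V]_n),
    is_basis e -> (forall i, eapp E h (e i) = \sum_j A i j *: e j) ->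
    rres O h t = \tr A.

(* When O is a sheaf and M is locally free of finite rank, is_trace E holds for
   exactly one section. *)
Definition trace (U : opens X) (E : endo U) : O U := xget 0 [set t | is_trace E t].

Definition in_nilradical (U : opens X) (s : O U) :=
  forall x, oset U x -> exists (V : opens X) (h : V `<=` U) n,
    oset V x /\ rres O h s ^+ n = 0.

Definition killed_by_nilradical :=
  forall (U : opens X) (s : O U) (m : M U), in_nilradical s -> s *: m = 0.

End ModuleProperties.

Section MultiplicationEndomorphism.
Variables (X : topologicalType) (O O' : ringPresheaf X).
Variables (phi : ringPresheafMorphism O O') (M : modPresheaf O').

Definition mul_endo (U : opens X) (a : O' U) : endo (restrict_presheaf phi M) U.
Proof.
refine (@Endo _ _ (restrict_presheaf phi M) U
  (fun V h m => rres O' h a *: (m : M V)) _ _).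
- move=> V h c m n.
  have key (b d : O' V) (u v : M V) : b *: (d *: u + v) = d *: (b *: u) + b *: v.
    by rewrite scalerDr !scalerA mulrC.
  exact: key.
- move=> V W h k l m.
  have key : mres M k (rres O' h a *: (m : M V)) = rres O' l a *: mres M k m.
    by rewrite mresZ (rres_comp h k l).
  exact: key.
Defined.

End MultiplicationEndomorphism.

Definition reduced (X : scheme) :=
  forall (U : opens X) (s : Osh X U) n, s ^+ n = 0 -> s = 0.

(* alpha is the K-algebra structure on the sections of X. *)
Definition smooth (K : fieldType) (X : scheme)
    (alpha : forall U : opens X, K -> Osh X U) :=
  forall U : opens X, affine (Osh X) U -> smooth_algebra (alpha U).

Section Cover.
Variables (X Y : scheme) (f : schemeMorphism X Y).

(* f_* M as a module over f_* O_X. *)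
Definition push (M : modPresheaf (Osh X)) :
  modPresheaf (push_ring (mcont f) (Osh X)) := push_mod (mcont f) M.

(* f_* M as a module over O_Y. *)
Definition direct_image (M : modPresheaf (Osh X)) : modPresheaf (Osh Y) :=
  restrict_presheaf (comor f) (push M).

Definition finite_morphism :=
  forall V : opens Y, affine (Osh Y) V -> affine (Osh X) (opre (mcont f) V) /\
    fg_module (direct_image (regular_presheaf (Osh X)) V).

(* The degree of a finite flat morphism is the rank of the locally free sheaf
   f_* O_X; conversely local freeness of f_* O_X contains flatness. *)
Definition double_cover :=
  finite_morphism /\ locally_free (direct_image (regular_presheaf (Osh X))) 2.

Definition traceable (M : sheafOfModules X) :=
  [/\ quasi_coherent M, locally_free (direct_image M) 2
    & forall (U : opens Y) (a : push_ring (mcont f) (Osh X) U),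
        trace (mul_endo (comor f) (push M) a) =
        trace (mul_endo (comor f) (push (regular_presheaf (Osh X))) a)].

Definition torsion_free (M : sheafOfModules X) :=
  forall w : Y, module_torsion_free (mod_stalk w (push M)).

Definition rank1 (M : sheafOfModules X) :=
  forall w : Y, module_rank1 (mod_stalk w (push M)).

End Cover.

(* A K-scheme glued from two affine lines U0 = Spec K[t] and U1 = Spec K[u]
   along D(t) = D(u), by t u = 1; structK is the structure morphism to Spec K. *)
Record projectiveLine (K : fieldType) := ProjectiveLine {
  P1 :> scheme;
  structK : {rmorphism K -> Osh P1 (openT P1)};
  U0 : opens P1;
  U1 : opens P1;
  U0_affine : affine (Osh P1) U0;
  U1_affine : affine (Osh P1) U1;
  P1_cover : forall x : P1, oset U0 x \/ oset U1 x;
  chart0 : {rmorphism {poly K} -> Osh P1 U0};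
  chart1 : {rmorphism {poly K} -> Osh P1 U1};
  chart0_bij : bijective chart0;
  chart1_bij : bijective chart1;
  chart0C : forall c, chart0 c%:P = rres (Osh P1) (@openTS _ U0) (structK c);
  chart1C : forall c, chart1 c%:P = rres (Osh P1) (@openTS _ U1) (structK c);
  overlap0 : (basic_open (chart0 'X) : set P1) = U0 `&` U1;
  overlap1 : (basic_open (chart1 'X) : set P1) = U0 `&` U1;
  gluing : rres (Osh P1) (@openIl _ U0 U1) (chart0 'X) *
           rres (Osh P1) (@openIr _ U0 U1) (chart1 'X) = 1 }.

(* The K-algebra structure on the sections of a scheme over the projective line. *)
Definition over_P1 (K : fieldType) (P : projectiveLine K) (C : scheme)
    (f : schemeMorphism C P) (U : opens C) (c : K) : Osh C U :=
  rres (Osh C) ((fun _ _ => I) : U `<=` opre (mcont f) (openT P))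
    (comor f (openT P) (structK P c)).

(* Main.v *)
(* Locally on the projective line, O(V) is a principal ideal domain D in which 2 is
   invertible, and completing the square gives f_* O = D + D y with y^2 = F. A
   module M with f_* M free of rank 2 over D is traceable exactly when y acts on it
   by a traceless matrix ((a, b), (c, -a)), and then F = a^2 + b c.

   Norms of elements of D + D y lie in D, whence torsion-freeness. If (a, b, c) is
   nonzero, one of e1, e2, e1 + e2 is a generic generator v, since det (v, y v) is
   a nonzero quadratic form in v; so M has rank 1. If a = b = c = 0, then F = 0 and
   y, which generates the nilradical, kills M. If C is smooth, lifting the identity
   of D + D y to D[Y] / (Y^2 - F)^2 yields a derivation delta of D such that
   delta F = 1 modulo F, so a, b, c have no common zero and v may be chosen to
   generate M locally.

   Conversely, a coherent torsion-free module of rank 1 is a lattice between v A and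
   v A / d for a generic generator v and some d in D; its Hermite normal form is a
   basis over D, and y is traceless on it because it is so on A = D + D y. A line
   bundle is trivial near each fibre of f: a fibre consists of a point and its
   conjugate, so prime avoidance gives a section generating at both. *)

Require Import Defs.
From HB Require Import structures.
From mathcomp Require Import all_boot all_order all_algebra.
From mathcomp Require Import ring.
From mathcomp Require Import boolp classical_sets functions topology.

Set Implicit Arguments.
Unset Strict Implicit.
Unset Printing Implicit Defensive.

Import GRing.Theory.
Local Open Scope classical_set_scope.
Local Open Scope ring_scope.

(** * Gluing and local bases *)

(** The notions quantify over all opens and over stalks of direct images, while the argument is
    linear algebra over [O(V)] for a single principal [V]; the bridge is clearing denominators.
    Bases over an affine open spread to all smaller opens by quasi-coherence and gluing. Germs at
    [w] become fractions whose denominators lie in [O(V)] itself, where freeness of [f_* O] makes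
    them nonzerodivisors. Only the trace of [y] has to be tested: every section is [p + q y] with
    [p], [q] from the base, and [1] has trace 2 on any module of rank 2. The total quotient ring of
    every stalk is realised as the stalk of [f_* O] at the generic point [eta] of the line,
    nilpotents included, and the base change of a module by its stalk at [eta]. The same point
    spreads a failure of rank 1: at one [w] it forces a = b = c = 0 on a chart, and any two charts
    meet at [eta]. The thickening by [(Y^2 - F)^2] is chosen because a lift of the identity to it
    sees [Y^2 - F] to first order: this is the Jacobian criterion without a module of
    differentials. *)

Lemma opens_eq (X : topologicalType) (U V : opens X) : oset U = oset V -> U = V.
Proof.
case: U V => [u uP] [v vP] /= e; subst v.
by congr Opens; exact: Prop_irrelevance.
Qed.

Section SheafGluing.
Variables (X : topologicalType) (F : setPresheaf X).
Hypothesis hF : is_sheaf (fun U V h => sres F (U := U) (V := V) h).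

(** The cover consists of all opens on which [s] and [t] agree, so no neighbourhood has to be chosen
    point by point. *)
Lemma sheaf_sep (U : opens X) (s t : F U) :
  (forall x, oset U x -> exists (V : opens X) (h : V `<=` U),
      oset V x /\ sres F h s = sres F h t) -> s = t.
Proof.
move=> loc; pose I := {V : opens X | exists h : V `<=` U, sres F h s = sres F h t}.
have hV (i : I) : sval i `<=` U by case: (svalP i).
have cov x : oset U x -> exists i : I, oset (sval i) x.
  by move=> /loc[V [h [Vx e]]]; exists (exist _ V (ex_intro _ h e)).
have comp (i j : I) (W : opens X) (hi : W `<=` sval i) (hj : W `<=` sval j) :
    sres F hi (sres F (hV i) s) = sres F hj (sres F (hV j) s).
  have l : W `<=` U by move=> y /hi; exact: hV.
  by rewrite !(sres_comp _ _ l).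
have [r [_ ur]] := hF hV cov comp.
rewrite -(ur s) // -(ur t) // => i; case: (svalP i) => h e.
by rewrite (Prop_irrelevance (hV i) h) e.
Qed.

(** Gluing of sections known only through a property: [Q] determines its section and passes to
    smaller opens, so arbitrary local choices are compatible. Being a presheaf condition, [Q] is
    recovered only near each point. *)
Lemma sheaf_glue (U : opens X) (Q : forall V : opens X, V `<=` U -> F V -> Prop) :
  (forall V h s t, Q V h s -> Q V h t -> s = t) ->
  (forall (V W : opens X) (h : V `<=` U) (k : W `<=` V) (l : W `<=` U) s,
     Q V h s -> Q W l (sres F k s)) ->
  (forall x, oset U x -> exists (V : opens X) (h : V `<=` U),
     oset V x /\ exists s, Q V h s) ->
  exists t, forall x, oset U x -> exists (V : opens X) (h : V `<=` U),
     oset V x /\ Q V h (sres F h t).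
Proof.
move=> Qu Qr loc; pose I := {V : opens X | exists h : V `<=` U, exists s, Q V h s}.
have hV (i : I) : sval i `<=` U by case: (svalP i).
have ex (i : I) : exists s, Q (sval i) (hV i) s.
  by case: (svalP i) => h [s Qs]; exists s; rewrite (Prop_irrelevance (hV i) h).
pose s (i : I) := sval (cid (ex i)).
have sP i : Q _ (hV i) (s i) by exact: (svalP (cid (ex i))).
have cov x : oset U x -> exists i : I, oset (sval i) x.
  by move=> /loc[V [h [Vx e]]]; exists (exist _ V (ex_intro _ h e)).
have comp (i j : I) (W : opens X) (hi : W `<=` sval i) (hj : W `<=` sval j) :
    sres F hi (s i) = sres F hj (s j).
  have l : W `<=` U by move=> y /hi; exact: hV.
  by apply: (Qu W l); apply: Qr (sP _).
have [t [tP _]] := hF hV cov comp.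
exists t => x /cov[i ix]; exists (sval i), (hV i); split=> //.
by rewrite tP; exact: sP.
Qed.

End SheafGluing.

Section Restriction.
Variables (X : topologicalType) (O : ringPresheaf X) (M : modPresheaf O).

Lemma rresE (U V : opens X) (h k : V `<=` U) (s : O U) : rres O h s = rres O k s.
Proof. by rewrite (Prop_irrelevance h k). Qed.

Lemma mresE (U V : opens X) (h k : V `<=` U) (s : M U) : mres M h s = mres M k s.
Proof. by rewrite (Prop_irrelevance h k). Qed.

Lemma mres_sum (U V : opens X) (h : V `<=` U) I (r : seq I) (F : I -> M U) :
  mres M h (\sum_(i <- r) F i) = \sum_(i <- r) mres M h (F i).
Proof.
elim: r => [|i r IH]; first by rewrite !big_nil mres0.
by rewrite !big_cons mresD IH.
Qed.

Lemma mresB (U V : opens X) (h : V `<=` U) (m n : M U) :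
  mres M h (m - n) = mres M h m - mres M h n.
Proof. by rewrite mresD mresN. Qed.

Hypothesis hO : is_sheaf (fun U V h => rres O (U := U) (V := V) h).
Hypothesis hM : is_sheaf (fun U V h => mres M (U := U) (V := V) h).

Lemma rres_sep (U : opens X) (s t : O U) :
  (forall x, oset U x -> exists (V : opens X) (h : V `<=` U),
      oset V x /\ rres O h s = rres O h t) -> s = t.
Proof. exact: (@sheaf_sep X (set_of_ring O) hO). Qed.

Lemma mres_sep (U : opens X) (s t : M U) :
  (forall x, oset U x -> exists (V : opens X) (h : V `<=` U),
      oset V x /\ mres M h s = mres M h t) -> s = t.
Proof. exact: (@sheaf_sep X (set_of_mod M) hM). Qed.

Lemma rres_glue (U : opens X) (Q : forall V : opens X, V `<=` U -> O V -> Prop) :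
  (forall V h s t, Q V h s -> Q V h t -> s = t) ->
  (forall (V W : opens X) (h : V `<=` U) (k : W `<=` V) (l : W `<=` U) s,
     Q V h s -> Q W l (rres O k s)) ->
  (forall x, oset U x -> exists (V : opens X) (h : V `<=` U),
     oset V x /\ exists s, Q V h s) ->
  exists t, forall x, oset U x -> exists (V : opens X) (h : V `<=` U),
     oset V x /\ Q V h (rres O h t).
Proof. exact: (@sheaf_glue X (set_of_ring O) hO). Qed.

Lemma mres_glue (U : opens X) (Q : forall V : opens X, V `<=` U -> M V -> Prop) :
  (forall V h s t, Q V h s -> Q V h t -> s = t) ->
  (forall (V W : opens X) (h : V `<=` U) (k : W `<=` V) (l : W `<=` U) s,
     Q V h s -> Q W l (mres M k s)) ->
  (forall x, oset U x -> exists (V : opens X) (h : V `<=` U),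
     oset V x /\ exists s, Q V h s) ->
  exists t, forall x, oset U x -> exists (V : opens X) (h : V `<=` U),
     oset V x /\ Q V h (mres M h t).
Proof. exact: (@sheaf_glue X (set_of_mod M) hM). Qed.

Lemma rres_eq0 (U : opens X) (a b : O U) : ~ (exists x, oset U x) -> a = b.
Proof. by move=> h; apply: rres_sep => x Ux; case: h; exists x. Qed.

Definition lincomb (U : opens X) n (e : 'I_n -> M U) (V : opens X) (h : V `<=` U)
    (a : 'rV[O V]_n) : M V := \sum_i a ord0 i *: mres M h (e i).

Lemma lincomb_res (U : opens X) n (e : 'I_n -> M U) (V W : opens X) (h : V `<=` U)
    (k : W `<=` V) (l : W `<=` U) (a : 'rV[O V]_n) :
  mres M k (lincomb e h a) = lincomb e l (map_mx (rres O k) a).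
Proof.
rewrite /lincomb mres_sum; apply: eq_bigr => i _.
by rewrite mresZ (mres_comp _ k l) mxE.
Qed.

Lemma lincombB (U : opens X) n (e : 'I_n -> M U) (V : opens X) (h : V `<=` U)
    (a b : 'rV[O V]_n) : lincomb e h (a - b) = lincomb e h a - lincomb e h b.
Proof.
rewrite /lincomb -sumrB; apply: eq_bigr => i _.
by rewrite !mxE scalerBl.
Qed.

Lemma lincombZ (U : opens X) n (e : 'I_n -> M U) (V : opens X) (h : V `<=` U) c
    (a : 'rV[O V]_n) : lincomb e h (c *: a) = c *: lincomb e h a.
Proof.
by rewrite /lincomb scaler_sumr; apply: eq_bigr => i _; rewrite mxE scalerA.
Qed.

Definition basis_at (U : opens X) n (e : 'I_n -> M U) (V : opens X) (h : V `<=` U) :=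
  (forall m, exists a, m = lincomb e h a) /\ (forall a, lincomb e h a = 0 -> a = 0).

Lemma is_basisE (U : opens X) n (e : 'I_n -> M U) :
  is_basis e <-> forall (V : opens X) (h : V `<=` U), basis_at e h.
Proof.
split=> H V h.
  have [g gK Kg] := H V h; split=> [m|a a0]; first by exists (g m); rewrite -[LHS]Kg.
  apply: (can_inj gK); rewrite -/(lincomb e h a) a0.
  by apply/esym/big1 => i _; rewrite mxE scale0r.
have [sur inj] := H V h; pose g m := sval (cid (sur m)).
have gK m : m = lincomb e h (g m) by exact: (svalP (cid (sur m))).
exists g => [a|m]; last by rewrite [RHS]gK.
by apply/eqP; rewrite -subr_eq0; apply/eqP/inj; rewrite lincombB -gK subrr.
Qed.

(** Where a basis exists the coordinates of a section are unique, so locally found coordinates glue.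
    Hence injectivity over arbitrary opens comes before surjectivity. *)
Lemma is_basis_local (U : opens X) n (e : 'I_n -> M U) :
  (forall (W : opens X) x, W `<=` U -> oset W x ->
     exists (V : opens X) (h : V `<=` U), [/\ V `<=` W, oset V x & basis_at e h]) ->
  is_basis e.
Proof.
move=> loc; apply/is_basisE.
have inj (W : opens X) (h : W `<=` U) a : lincomb e h a = 0 -> a = 0.
  move=> a0; apply/rowP => i; rewrite mxE; apply: rres_sep => x Wx.
  have [V [hV [VW Vx [_ injV]]]] := loc W x h Wx.
  exists V, VW; split=> //; rewrite rmorph0.
  have : map_mx (rres O VW) a = 0.
    by apply: (injV); rewrite -(lincomb_res e h VW) a0 mres0.
  by move/rowP/(_ i); rewrite !mxE.
move=> W h; split=> [m|a]; last exact: inj.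
(* [c] is the [i]-th coordinate of [m] on [V]; coordinates are glued one at a time in the sheaf
   [O]. *)
pose Q i (V : opens X) (k : V `<=` W) (c : O V) :=
  exists (l : V `<=` U) a, mres M k m = lincomb e l a /\ a ord0 i = c.
have uniq (V : opens X) (l l' : V `<=` U) a b : lincomb e l a = lincomb e l' b -> a = b.
  rewrite (Prop_irrelevance l' l) => eab; apply/eqP; rewrite -subr_eq0; apply/eqP.
  by apply: (inj V l); rewrite lincombB eab subrr.
have ex i : exists t : O W, forall x, oset W x -> exists (V : opens X) (k : V `<=` W),
     oset V x /\ Q i V k (rres O k t).
  apply: rres_glue.
  - move=> V k s t [l [a [am <-]]] [l' [b [bm <-]]].
    by move: am; rewrite bm => /uniq->.
  - move=> V V' k k' k'' s [l [a [am <-]]].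
    exists (subset_trans k' l), (map_mx (rres O k') a); rewrite mxE; split=> //.
    by rewrite -(mres_comp k k') am (lincomb_res _ _ _ (subset_trans k' l)).
  - move=> x Wx; have [V [hV [VW Vx [sur _]]]] := loc W x h Wx.
    exists V, VW; split=> //; have [a am] := sur (mres M VW m).
    by exists (a ord0 i), hV, a.
pose t i := sval (cid (ex i)).
have tP i : forall x, oset W x -> exists (V : opens X) (k : V `<=` W),
     oset V x /\ Q i V k (rres O k (t i)) by exact: (svalP (cid (ex i))).
exists (\row_i t i); apply: mres_sep => x Wx.
have [V [hV [VW Vx [sur _]]]] := loc W x h Wx.
exists V, VW; split=> //; have [a am] := sur (mres M VW m).
rewrite (lincomb_res _ _ _ hV) am; congr (lincomb _ _ _); apply/rowP => i.
rewrite !mxE; apply: rres_sep => y Vy.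
have [V' [k' [V'y [l [b [bm bt]]]]]] := tP i y (VW y Vy).
have kV := @openIr _ V' V; have kV' := @openIl _ V' V.
exists (Defs.openI V' V), kV; split=> //.
rewrite (rres_comp VW kV (subset_trans kV VW)).
rewrite -(rres_comp k' kV' (subset_trans kV VW)) -bt.
have := congr1 (mres M kV) am; rewrite (lincomb_res _ _ _ (subset_trans kV' l)).
rewrite (mres_comp _ _ (subset_trans kV VW)) -(mres_comp k' kV') bm.
rewrite (lincomb_res _ _ _ (subset_trans kV' l)) => /uniq /rowP/(_ i).
by rewrite !mxE => ->.
Qed.

Lemma is_basis_res (U V : opens X) (h : V `<=` U) n (e : 'I_n -> M U) :
  is_basis e -> is_basis (fun i => mres M h (e i)).
Proof.
move=> /is_basisE be; apply/is_basisE => W k; have l := subset_trans k h.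
have E a : lincomb (fun i => mres M h (e i)) k a = lincomb e l a.
  by apply: eq_bigr => i _; rewrite (mres_comp _ _ l).
by have [sur inj] := be W l; split=> [m|a]; rewrite ?E; [have [a ->] := sur m; exists a|exact: inj].
Qed.

End Restriction.

(** * Prime ideals and affine opens *)

Section Ideals.
Variable R : comPzRingType.

Definition is_ideal (I : set R) :=
  [/\ I 0, forall a b, I a -> I b -> I (a + b) & forall a b, I b -> I (a * b)].

(** An ideal maximal among those that contain [I] and miss [S] is prime. A general [S] is allowed
    for the sake of lying over in [fibre_point]. *)
Lemma prime_ideal_avoiding (I S : set R) :
  is_ideal I -> S 1 -> (forall a b, S a -> S b -> S (a * b)) ->
  (forall a, I a -> ~ S a) ->
  exists p : set R, [/\ prime_ideal p, I `<=` p & forall a, p a -> ~ S a].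
Proof.
move=> [I0 ID IM] S1 SM IS.
(* Zorn's lemma is applied to [A] with [I] added: the empty chain then yields [I], whereas the empty
   set alone is not an ideal. *)
pose P (A : set R) := is_ideal (I `|` A) /\ forall a, (I `|` A) a -> ~ S a.
have [F FP tot|A [[[A0 AD AM] AS] Amax]] := @Zorn_bigcup R P.
  split; last first.
    move=> a [/IS //|[B FB Ba]]; have [_] := FP _ FB; apply; by right.
  split; first by left.
  - move=> a b [Ia|[B FB Ba]] [Ib|[B' FB' Bb]]; first by left; exact: ID.
    + have [[_ BD _] _] := FP _ FB'.
      by case: (BD a b (or_introl Ia) (or_intror Bb)); [left|right; exists B'].
    + have [[_ BD _] _] := FP _ FB.
      by case: (BD a b (or_intror Ba) (or_introl Ib)); [left|right; exists B].
    + have [sub|sub] := tot _ _ FB FB'.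
        have [[_ BD _] _] := FP _ FB'.
        by case: (BD a b (or_intror (sub _ Ba)) (or_intror Bb)); [left|right; exists B'].
      have [[_ BD _] _] := FP _ FB.
      by case: (BD a b (or_intror Ba) (or_intror (sub _ Bb))); [left|right; exists B].
  - move=> a b [Ib|[B FB Bb]]; first by left; exact: IM.
    have [[_ _ BM] _] := FP _ FB.
    by case: (BM a b (or_intror Bb)); [left|right; exists B].
pose p := I `|` A.
have pD a b : p a -> p b -> p (a + b) by exact: AD.
have pM a b : p b -> p (a * b) by exact: AM.
have pAI : p `<=` A.
  move=> a pa; case: (pselect (p `<=` A)) => [|nsub]; first exact.
  exfalso; apply: (Amax p); first by split=> // b; right.
  have -> : P p = P A by rewrite /P /p setUA setUid.
  by [].
exists p; split=> //; last by left.
split=> //; first by move/AS; exact.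
move=> a b pab; apply: contrapT => /not_orP[na nb].
(* By maximality the ideal [p + (c)] meets [S] as soon as [c] is outside [p]. *)
have ext c : ~ p c -> exists s q r, [/\ S s, p q & s = q + r * c].
  move=> npc; apply: contrapT => nex.
  pose B := [set x | exists q r, p q /\ x = q + r * c].
  have pB : p `<=` B by move=> x px; exists x, 0; rewrite mul0r addr0.
  have IB : I `|` B = B by apply/setUidr => x Ix; apply: pB; left.
  apply: (Amax B); last first.
    rewrite /P IB; split; last first.
      by move=> x [q [r [pq ->]]] Sx; apply: nex; exists (q + r * c), q, r.
    split; first exact: pB.
      move=> x y [q [r [pq ->]]] [q' [r' [pq' ->]]].
      exists (q + q'), (r + r'); split; first exact: pD.
      by rewrite mulrDl addrACA.
    move=> x y [q [r [pq ->]]]; exists (x * q), (x * r); split; first exact: pM.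
    by rewrite mulrDr mulrA.
  split; first by move=> x Ax; apply: pB; right.
  move=> BA; apply: npc; right; apply: BA; exists 0, 1; split=> //.
  by rewrite add0r mul1r.
have [s [q [r [Ss pq es]]]] := ext _ na.
have [s' [q' [r' [Ss' pq' es']]]] := ext _ nb.
apply: (AS (s * s')); last exact: SM.
have -> : s * s' = (q' + r' * b) * q + (r * a) * q' + (r * r') * (a * b).
  by rewrite es es'; ring.
by apply: (pD); [apply: (pD)|]; exact: pM.
Qed.

End Ideals.

Section Units.
Variables (X : topologicalType) (O : ringPresheaf X).

Lemma invertible_morph (R S : comPzRingType) (phi : {rmorphism R -> S}) r :
  invertible r -> invertible (phi r).
Proof. by move=> [t e]; exists (phi t); rewrite -rmorphM e rmorph1. Qed.

Lemma invertibleM (R : comPzRingType) (r s : R) :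
  invertible r -> invertible s -> invertible (r * s).
Proof. by move=> [t e] [u e']; exists (t * u); rewrite mulrACA e e' mulr1. Qed.

Lemma invertible_mull (R : comPzRingType) (r s : R) : invertible (r * s) -> invertible r.
Proof. by move=> [t e]; exists (t * s); rewrite -mulrA [s * r]mulrC. Qed.

Lemma invertibleX (R : comPzRingType) (r : R) n : invertible r -> invertible (r ^+ n).
Proof. by move=> [t e]; exists (t ^+ n); rewrite -exprMn e expr1n. Qed.

Lemma invertible_scaleI (R : comPzRingType) (M : lmodType R) (r : R) :
  invertible r -> injective (fun m : M => r *: m).
Proof. by move=> [t e] m n /(congr1 ( *:%R t)); rewrite !scalerA e !scale1r. Qed.

Lemma invertible_mulI (R : comPzRingType) (r : R) : invertible r -> injective ( *%R r).
Proof. by move=> [t e] m n /(congr1 ( *%R t)); rewrite !mulrA e !mul1r. Qed.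

Lemma unit_at_res (U V : opens X) (h : V `<=` U) (s : O U) x :
  oset V x -> unit_at (rres O h s) x <-> unit_at s x.
Proof.
move=> Vx; split=> [[W [k [Wx inv]]]|[W [k [Wx inv]]]].
  exists W, (subset_trans k h); split=> //.
  by rewrite -(rres_comp h k).
exists (Defs.openI W V), (@openIr _ W V); split=> //.
have l := @openIl _ W V.
rewrite (rres_comp _ _ (subset_trans l k)) -(rres_comp k l).
exact: invertible_morph.
Qed.

Lemma unit_at_in (U : opens X) (s : O U) x : unit_at s x -> oset U x.
Proof. by move=> [V [h [Vx _]]]; exact: h. Qed.

Lemma unit_atM (U : opens X) (s t : O U) x :
  unit_at (s * t) x <-> unit_at s x /\ unit_at t x.
Proof.
split=> [[V [h [Vx]]]|[[V [h [Vx iv]]] [W [k [Wx iw]]]]].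
  rewrite rmorphM => inv; split; exists V, h; split=> //.
    exact: invertible_mull inv.
  by rewrite mulrC in inv; exact: invertible_mull inv.
have lV := @openIl _ V W; have lW := @openIr _ V W.
have l := subset_trans lV h.
exists (Defs.openI V W), l; split=> //; rewrite rmorphM.
apply: invertibleM.
  by rewrite -(rres_comp h lV); exact: invertible_morph.
by rewrite -(rres_comp k lW); exact: invertible_morph.
Qed.

Lemma invertible_unit_at (U : opens X) (s : O U) x :
  oset U x -> invertible s -> unit_at s x.
Proof. by move=> Ux si; exists U, (fun y => id); rewrite rres_id. Qed.

Lemma unit_at1 (U : opens X) x : oset U x -> unit_at (1 : O U) x.
Proof. by move=> Ux; apply: invertible_unit_at => //; exists 1; rewrite mulr1. Qed.

Lemma unit_atX (U : opens X) (s : O U) n x : unit_at s x -> unit_at (s ^+ n) x.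
Proof.
move=> us; elim: n => [|n IH]; first by rewrite expr0; exact: unit_at1 (unit_at_in us).
by rewrite exprS unit_atM.
Qed.

(** The open [W] is a parameter because restrictions and preimages of basic opens are equal to basic
    opens only as sets. *)
Definition is_loc (M : modPresheaf O) (U : opens X) (s : O U) (W : opens X) (h : W `<=` U) :=
  (forall n : M W, exists m k, rres O h (s ^+ k) *: n = mres M h m) /\
  (forall m : M U, mres M h m = 0 -> exists k, s ^+ k *: m = 0).

Variable U : opens X.
Hypothesis affU : affine O U.

Lemma affine_loc (s : O U) (W : opens X) (h : W `<=` U) :
  oset W = basic_open s ->
  [/\ invertible (rres O h s),
      forall n : O W, exists m k, rres O h s ^+ k * n = rres O h m
    & forall m : O U, rres O h m = 0 -> exists k, s ^+ k * m = 0].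
Proof.
move/opens_eq=> e; subst W; rewrite (Prop_irrelevance h (@basic_openS X O U s)).
have [_ _ _ /(_ s)[inv sur inj]] := affU; split.
- by apply: inv; exists 1.
- by move=> n; have [a [_ [[k _ <-] e]]] := sur n; exists a, k; rewrite -e rmorphXn.
- by move=> m /inj[_ [[k _ <-] e]]; exists k.
Qed.

Lemma affine_is_loc (s : O U) (W : opens X) (h : W `<=` U) :
  oset W = basic_open s -> is_loc (regular_presheaf O) s h.
Proof.
move=> /(affine_loc h)[_ sur inj]; split=> // n; have [m [k e]] := sur n.
by exists m, k; rewrite rmorphXn.
Qed.

Lemma affine_base (W : opens X) x : oset U x -> oset W x ->
  exists s : O U, unit_at s x /\ basic_open s `<=` W.
Proof.
move=> Ux Wx; have [_ _ base _] := affU.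
have [//|s [us sW]] := base (Defs.openI U W) x (@openIl _ _ _).
by exists s; split=> //; apply: subset_trans sW (@openIr _ _ _).
Qed.

Lemma affine_prime x : oset U x -> prime_ideal (@vanishing X O U x).
Proof. by case: affU => h _ _ _; exact: h. Qed.

Lemma affine_point (p : set (O U)) : prime_ideal p ->
  exists2 x, oset U x & @vanishing X O U x = p.
Proof. by case: affU => _ h _ _ /h[x [[Ux vx] _]]; exists x. Qed.

Lemma affine_point_inj x y : oset U x -> oset U y ->
  @vanishing X O U x = @vanishing X O U y -> x = y.
Proof.
move=> Ux Uy e; case: affU => _ h _ _; have [z [_ zu]] := h _ (affine_prime Ux).
by rewrite -(zu x) // -(zu y).
Qed.

Lemma unit_at0 x : ~ unit_at (0 : O U) x.
Proof.
move=> u; have Ux := unit_at_in u; have [v0 _ _ _ _] := affine_prime Ux.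
exact: (v0 u).
Qed.

Lemma unit_atD (s t : O U) x : unit_at (s + t) x -> unit_at s x \/ unit_at t x.
Proof.
move=> u; have Ux := unit_at_in u; have [_ vD _ _ _] := affine_prime Ux.
by apply: contrapT => /not_orP[ns nt]; exact: vD ns nt u.
Qed.

(** If [1] were missing, some prime would contain [I]; primes are points, and at that point no
    element of [I] would be a unit. *)
Lemma affine_ideal_one (I : set (O U)) : is_ideal I ->
  (forall x, oset U x -> exists2 s, I s & unit_at s x) -> I 1.
Proof.
move=> Iid H; apply: contrapT => I1.
have [//|a b -> ->|a Ia a1|p [pp Ip _]] := @prime_ideal_avoiding _ I [set 1] Iid.
- by rewrite /= mulr1.
- by apply: I1; rewrite -a1.
have [x Ux vx] := affine_point pp; have [s Is us] := H x Ux.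
by have := Ip _ Is; rewrite -vx => /(_ us).
Qed.

(** Quasi-compactness: the functions whose nonvanishing locus is covered by finitely many members of
    [G] form an ideal, which has no common zero. *)
Lemma affine_cover (G : set (O U)) :
  (forall x, oset U x -> exists2 s, G s & unit_at s x) ->
  exists l : seq (O U), (forall s, s \in l -> G s) /\
    forall x, oset U x -> exists2 s, s \in l & unit_at s x.
Proof.
move=> H.
pose I : set (O U) := [set a : O U | exists l : seq (O U), (forall s, s \in l -> G s) /\
    forall x, unit_at a x -> exists2 s, s \in l & unit_at s x].
have [] : I 1; last first.
  by move=> l [lG lU]; exists l; split=> // x Ux; apply: lU; exact: unit_at1.
apply: affine_ideal_one; last first.
  move=> x /H[s Gs us]; exists s => //; exists [:: s]; split.
    by move=> t; rewrite inE => /eqP->.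
  by move=> y uy; exists s => //; rewrite inE.
split.
- by exists [::]; split=> // x /unit_at0.
- move=> a b [l [lG lU]] [l' [lG' lU']]; exists (l ++ l'); split.
    by move=> s; rewrite mem_cat => /orP[/lG|/lG'].
  move=> x /unit_atD[/lU|/lU'] [s sl us]; exists s => //; rewrite mem_cat sl //.
  by rewrite orbT.
- move=> a b [l [lG lU]]; exists l; split=> // x /unit_atM[_]; exact: lU.
Qed.

(** Primes of [O W] contract to the primes of [O U] that avoid [s]. For the structure sheaf,
    [c = m / s ^ n] on [W] has the same basic open as [s * m] on [U], where the localization
    property is known. *)
Lemma affine_basic_open (s : O U) : affine O (basic_open s).
Proof.
set W := basic_open s; have h : W `<=` U := @basic_openS X O U s.
have [inv sur inj] := affine_loc h (erefl (oset W)).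
split.
- move=> x Wx; have [v0 vD vM v1 vP] := affine_prime (h x Wx); split.
  + by rewrite /vanishing /= -(rmorph0 (rres O h)) unit_at_res.
  + move=> a b ua ub /=; rewrite /vanishing /=.
    have [m [k e]] := sur a; have [m' [k' e']] := sur b.
    move=> uab; have us : unit_at (rres O h (s ^+ k * s ^+ k')) x.
      by apply/unit_at_res => //; rewrite unit_atM; split; exact: unit_atX Wx.
    have : unit_at (rres O h (s ^+ k * s ^+ k') * (a + b)) x by rewrite unit_atM.
    have -> : rres O h (s ^+ k * s ^+ k') * (a + b) = rres O h (s ^+ k' * m + s ^+ k * m').
      by rewrite rmorphD !rmorphM !rmorphXn /= -e -e'; ring.
    rewrite unit_at_res //; apply: vD => [] /unit_atM[_] /(unit_at_res h _ Wx).
      by rewrite -e => /unit_atM[_ /ua].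
    by rewrite -e' => /unit_atM[_ /ub].
  + by move=> a b ub /= /unit_atM[_ /ub].
  + by move=> n1; apply: n1; exact: unit_at1.
  + move=> a b; rewrite /vanishing /= unit_atM => nab.
    by apply: contrapT => /not_orP[/contrapT ? /contrapT ?]; exact: nab.
- move=> p [p0 pD pM p1 pP].
  pose q := [set a | p (rres O h a)].
  have qp : prime_ideal q.
    split; rewrite /q /=.
    - by rewrite rmorph0.
    - by move=> a b pa pb; rewrite rmorphD; exact: pD.
    - by move=> a b pb; rewrite rmorphM; exact: pM.
    - by rewrite rmorph1.
    - by move=> a b; rewrite rmorphM; exact: pP.
  have [x Ux vx] := affine_point qp.
  have Wx : oset W x.
    apply: contrapT => nu; have : q s by rewrite -vx.
    rewrite /q /= => ps; apply: p1; have [t <-] := inv; exact: pM.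
  have vq y : oset W y -> @vanishing X O W y = p -> @vanishing X O U y = q.
    move=> Wy vy; apply/seteqP; split=> a; rewrite /q /= -vy /vanishing /=.
      by rewrite unit_at_res.
    by rewrite unit_at_res.
  exists x; split; last first.
    move=> y [Wy /(vq _ Wy) vy]; apply: affine_point_inj => //; first exact: (h _ Wy).
    by rewrite vx vy.
  split=> //; apply/seteqP; split=> c; have [m [k e]] := sur c.
    move=> nc; have : p (rres O h s ^+ k * c).
      rewrite e; change (q m); rewrite -vx => /(unit_at_res h _ Wx).
      by rewrite -e => /unit_atM[_]; exact: nc.
    move/pP => [|//] psk; exfalso; apply: p1.
    have [t et] := invertibleX k inv; rewrite -et; exact: pM.
  move=> pc uc; have : q m by rewrite /q /= -e; exact: pM.
  rewrite -vx; apply; apply/(unit_at_res h _ Wx); rewrite -e unit_atM; split=> //.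
  by apply: unit_atX; exact/unit_at_res.
- move=> V x VW Vx; have [t [ut tV]] := affine_base (h x (VW x Vx)) Vx.
  exists (rres O h t); split; first by apply/unit_at_res => //; exact: VW.
  move=> y uy; apply: tV; apply/(unit_at_res h) => //; exact: unit_at_in uy.
- move=> c; set D := basic_open c; have k : D `<=` W := @basic_openS X O W c.
  have [m [n e]] := sur c; have kh := subset_trans k h.
  have De : oset D = basic_open (s * m).
    apply/seteqP; split=> y.
      move=> uc; have Wy := unit_at_in uc; rewrite /= unit_atM; split=> //.
      rewrite -(unit_at_res h m Wy) -e unit_atM; split=> //.
      by apply: unit_atX; exact/unit_at_res.
    rewrite /= unit_atM => -[us /(unit_at_res h m us)]; rewrite -e unit_atM.
    by case.
  have [inv' sur' inj'] := affine_loc kh De.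
  have invc : invertible (rres O k c).
    apply: (@invertible_mull _ _ (rres O k (rres O h s ^+ n))).
    rewrite -rmorphM mulrC e (rres_comp h k kh).
    by move: inv'; rewrite rmorphM mulrC => /invertible_mull.
  rewrite (Prop_irrelevance (@basic_openS X O W c) k); split.
  + by move=> _ [j _ <-]; rewrite rmorphXn; exact: invertibleX.
  + move=> q; have [b [j eb]] := sur' q.
    have [u eu] := inv.
    (* From [(s m) ^ j q = b] and [m = s ^ n c] follows [s ^ (j + n j) c ^ j q = b], and [u] is the
       inverse of [s]. *)
    exists (u ^+ (j + n * j) * rres O h b), (c ^+ j); split; first by exists j.
    rewrite rmorphM (rres_comp h k kh) -eb rmorphM -!(rres_comp h k kh) -e.
    rewrite !rmorphXn rmorphM exprMn rmorphXn /=.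
    have {}eu : rres O k u * rres O k (rres O h s) = 1 by rewrite -rmorphM eu rmorph1.
    set A := rres O k u in eu *; set B := rres O k _ in eu *.
    set Cc := rres O k c.
    transitivity ((A * B) ^+ (j + n * j) * (Cc ^+ j * q)); first by rewrite eu expr1n mul1r.
    rewrite !exprMn -exprM !exprD; ring.
  + move=> a; have [b [j eb]] := sur a => a0.
    have b0 : rres O kh b = 0 by rewrite -(rres_comp h k kh) -eb rmorphM a0 mulr0.
    have [i ei] := inj' _ b0.
    exists (c ^+ i); split; first by exists i.
    have [u eu] := invertibleX (i + j + n * i) inv.
    have : rres O h (s ^+ (n * i) * ((s * m) ^+ i * b)) = 0 by rewrite ei mulr0 rmorph0.
    rewrite !rmorphM !rmorphXn rmorphM -e -eb => E.
    apply: (invertible_mulI (invertibleX (i + j + n * i + n * i) inv)).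
    rewrite mulr0 -E !exprMn !exprD -!exprM; ring.
Qed.

End Units.

(** * Quasi-coherence and finite generation *)

Lemma common_exponent (T : eqType) (l : seq T) (P : T -> nat -> Prop) :
  (forall x j k, (j <= k)%N -> P x j -> P x k) ->
  (forall x, x \in l -> exists k, P x k) -> exists k, forall x, x \in l -> P x k.
Proof.
move=> Pm; elim: l => [|x l IH] H; first by exists 0%N.
have [k kP] := H x (mem_head x l).
have [|j jP] := IH; first by move=> y yl; apply: H; rewrite inE yl orbT.
exists (maxn j k) => y; rewrite inE => /orP[/eqP->|/jP].
  by apply: Pm kP; exact: leq_maxr.
by apply: Pm; exact: leq_maxl.
Qed.

Section Spans.
Variables (R : comPzRingType) (M : lmodType R).

Definition is_submodule (S : set M) :=
  [/\ S 0, forall x y, S x -> S y -> S (x + y) & forall a x, S x -> S (a *: x)].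

(** Defined by an intersection rather than by coefficients, so that membership is eliminated
    directly into any submodule. *)
Definition span (l : seq M) : set M :=
  [set m | forall S, is_submodule S -> (forall x, x \in l -> S x) -> S m].

Lemma span_submodule l : is_submodule (span l).
Proof.
split=> [S [] //|x y xs ys S Ss Sl|a x xs S Ss Sl]; have [S0 SD SZ] := Ss.
  by apply: SD; [exact: xs|exact: ys].
by apply: SZ; exact: xs.
Qed.

Lemma mem_span l x : x \in l -> span l x.
Proof. by move=> xl S _; exact. Qed.

Lemma fg_moduleP : fg_module M <-> exists l, forall m, span l m.
Proof.
split=> [[n [e eP]]|[l lP]].
  exists [seq e i | i <- enum 'I_n] => m S [S0 SD SZ] Sl; have [a ->] := eP m.
  apply: (big_ind S) => // i _; apply: SZ; apply: Sl.
  by apply: map_f; rewrite mem_enum.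
exists (size l), (fun i => nth 0 l i) => m.
apply: (lP m [set m | exists a : 'I_(size l) -> R, m = \sum_i a i *: nth 0 l i]);
  last first.
  move=> x xl; have ix : (index x l < size l)%N by rewrite index_mem.
  exists (fun i => (i == Ordinal ix)%:R); rewrite (bigD1 (Ordinal ix)) //= eqxx scale1r.
  rewrite nth_index // big1 ?addr0 // => i /negPf->; exact: scale0r.
split.
- by exists (fun _ => 0); rewrite big1 // => i _; rewrite scale0r.
- move=> x y [a ->] [b ->]; exists (fun i => a i + b i).
  by rewrite -big_split; apply: eq_bigr => i _; rewrite scalerDl.
- move=> b x [a ->]; exists (fun i => b * a i).
  by rewrite scaler_sumr; apply: eq_bigr => i _; rewrite scalerA.
Qed.

End Spans.

Section QuasiCoherence.
Variables (X : topologicalType) (O : ringPresheaf X) (M : modPresheaf O).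
Hypothesis hO : is_sheaf (fun U V h => rres O (U := U) (V := V) h).
Hypothesis hM : is_sheaf (fun U V h => mres M (U := U) (V := V) h).

Lemma lincomb_id (U : opens X) n (e : 'I_n -> M U) (h : U `<=` U) a :
  lincomb e h a = \sum_i a ord0 i *: e i.
Proof. by apply: eq_bigr => i _; rewrite mres_id. Qed.

Definition basic_loc (U : opens X) := forall (s : O U) (W : opens X) (h : W `<=` U),
  oset W = basic_open s -> is_loc M s h.

Lemma quasi_coherentP : quasi_coherent M <-> forall U, affine O U -> basic_loc U.
Proof.
split=> [qc U affU s W h /opens_eq e|H U affU s].
  by subst W; rewrite (Prop_irrelevance h (@basic_openS X O U s)); exact: qc.
by apply: H.
Qed.

Lemma affine_row (U W : opens X) (h : W `<=` U) (s : O U) n (a : 'rV[O W]_n) :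
  affine O U -> oset W = basic_open s ->
  exists k (b : 'rV[O U]_n), rres O h (s ^+ k) *: a = map_mx (rres O h) b.
Proof.
move=> affU /(affine_loc affU h)[_ sur _].
have [|i _|k kP] := @common_exponent _ (enum 'I_n)
    (fun i k => exists b, rres O h s ^+ k * a ord0 i = rres O h b).
- move=> i j k jk [b e]; exists (s ^+ (k - j) * b).
  by rewrite rmorphM -e rmorphXn mulrA -exprD subnK.
- by have [b [k e]] := sur (a ord0 i); exists k, b.
pose b i := sval (cid (kP i (mem_enum _ i))).
exists k, (\row_i b i); apply/rowP => i; rewrite !mxE rmorphXn.
exact: (svalP (cid (kP i (mem_enum _ i)))).
Qed.

Lemma affine_row0 (U W : opens X) (h : W `<=` U) (s : O U) n (a : 'rV[O U]_n) :
  affine O U -> oset W = basic_open s -> map_mx (rres O h) a = 0 ->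
  exists k, s ^+ k *: a = 0.
Proof.
move=> affU /(affine_loc affU h)[_ _ inj] a0.
have [|i _|k kP] := @common_exponent _ (enum 'I_n) (fun i k => s ^+ k * a ord0 i = 0).
- by move=> i j k jk e; rewrite -(subnK jk) exprD -mulrA e mulr0.
- by apply: inj; move/rowP/(_ i): a0; rewrite !mxE.
by exists k; apply/rowP => i; rewrite !mxE; apply: kP; rewrite mem_enum.
Qed.

(** Basic opens form a base and sections over them are fractions of sections over [U], so the basis
    property over [U] alone passes to them by clearing denominators; [is_basis_local] gives all
    other opens. *)
Lemma basis_affine (U : opens X) n (e : 'I_n -> M U) (id_U : U `<=` U) :
  affine O U -> basic_loc U -> basis_at e id_U -> is_basis e.
Proof.
move=> affU loc [sur inj]; apply: (is_basis_local hO hM) => W x WU Wx.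
have [s [us sW]] := affine_base affU (WU x Wx) Wx.
pose V := basic_open s; have h : V `<=` U := @basic_openS X O U s.
have [inv _ _] := affine_loc affU h (erefl (oset V)).
have [surM injM] := loc s V h (erefl _).
exists V, h; split=> //; split=> [m|a a0].
  have [m' [k em]] := surM m; have [a ea] := sur m'.
  have [t et] := invertibleX k inv.
  exists (t *: map_mx (rres O h) a); rewrite lincombZ -(lincomb_res e id_U h) -ea -em.
  by rewrite scalerA rmorphXn et scale1r.
have [k [b eb]] := affine_row h a affU (erefl (oset V)).
have : lincomb e h (rres O h (s ^+ k) *: a) = 0 by rewrite lincombZ a0 scaler0.
rewrite eb -(lincomb_res e id_U h) => /injM[j]; rewrite -lincombZ => /inj b0.
have [t et] := invertibleX (j + k) inv.
rewrite -[a]scale1r -et exprD -scalerA -scalerA -!rmorphXn eb.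
have := congr1 (map_mx (rres O h)) b0; rewrite map_mxZ map_mx0 => ->.
by rewrite scaler0.
Qed.

Lemma basis_basic_loc (U : opens X) n (e : 'I_n -> M U) :
  affine O U -> is_basis e -> basic_loc U.
Proof.
move=> affU /is_basisE be s W h eW; have idU : U `<=` U by [].
have [surU injU] := be U idU; have [surW injW] := be W h; split=> [m|m m0].
  have [a ->] := surW m; have [k [b eb]] := affine_row h a affU eW.
  exists (lincomb e idU b), k; rewrite (lincomb_res e idU h h) -eb.
  by rewrite lincombZ.
have [a ea] := surU m; rewrite ea in m0 *.
rewrite (lincomb_res e idU h h) in m0; move/injW: m0 => a0.
have [k k0] := affine_row0 affU eW a0; exists k; rewrite -lincombZ k0.
by rewrite /lincomb big1 // => i _; rewrite mxE scale0r.
Qed.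

Lemma basic_open_res (U V : opens X) (h : V `<=` U) (s : O U) :
  oset (basic_open (rres O h s)) = oset V `&` basic_open s.
Proof.
apply/seteqP; split=> x /=; last by move=> [Vx us]; apply/unit_at_res.
by move=> us; have Vx := unit_at_in us; split=> //; apply/(unit_at_res h).
Qed.

(** Quasi-coherence is local. On a finite cover by opens [D a], a section [n] over [W] has
    numerators [ma a] with one exponent [K]; on overlaps they differ by elements that [s ^ L] kills,
    so the [s ^ L *: ma a] glue to a numerator of [n]. *)
Lemma basic_loc_local (U : opens X) :
  affine O U ->
  (forall x, oset U x -> exists2 a : O U, unit_at a x &
     forall V : opens X, affine O V -> V `<=` basic_open a -> basic_loc V) ->
  basic_loc U.
Proof.
move=> affU H s W h eW.
have [|l [lG lU]] := @affine_cover X O U affU (fun a =>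
     forall V : opens X, affine O V -> V `<=` basic_open a -> basic_loc V).
  by move=> x /H[a ua aP]; exists a.
pose D (a : O U) := basic_open a; have hD (a : O U) : D a `<=` U := @basic_openS X O U a.
have hDW (a : O U) := @openIl _ (D a) W; have hWD (a : O U) := @openIr _ (D a) W.
have hDU (a : O U) : Defs.openI (D a) W `<=` U := subset_trans (hDW a) (hD a).
have loc (V : opens X) (hV : V `<=` U) (a : O U) (k : Defs.openI V W `<=` V) :
    a \in l -> affine O V -> V `<=` D a -> is_loc M (rres O hV s) k.
  move=> al affV VD; apply: (lG a) => //.
  by rewrite basic_open_res -eW.
have locD a : a \in l -> is_loc M (rres O (hD a) s) (hDW a).
  by move=> al; apply: (loc _ _ a) => //; exact: affine_basic_open.
split=> [n|m m0].
- have [|a al|K KP] := @common_exponent _ l (fun a k => exists ma : M (D a),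
     rres O (hDU a) s ^+ k *: mres M (hWD a) n = mres M (hDW a) ma).
  + move=> a i j ij [ma e]; exists (rres O (hD a) s ^+ (j - i) *: ma).
    by rewrite mresZ -e rmorphXn (rres_comp _ _ (hDU a)) scalerA -exprD subnK.
  + have [sur _] := locD a al; have [ma [k e]] := sur (mres M (hWD a) n).
    by exists k, ma; rewrite -e rmorphXn (rres_comp _ _ (hDU a)).
  have [ma maP] : exists ma : forall a : O U, M (D a), forall a, a \in l ->
      rres O (hDU a) s ^+ K *: mres M (hWD a) n = mres M (hDW a) (ma a).
    have ex (a : O U) : exists ma : M (D a), a \in l ->
        rres O (hDU a) s ^+ K *: mres M (hWD a) n = mres M (hDW a) ma.
      by case al: (a \in l); [have [m e] := KP a al; exists m|exists 0].
    by exists (fun a => sval (cid (ex a))) => a; exact: (svalP (cid (ex a))).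
  pose DD (p : O U * O U) := Defs.openI (D p.1) (D p.2).
  have h1 p : DD p `<=` D p.1 := @openIl _ _ _.
  have h2 p : DD p `<=` D p.2 := @openIr _ _ _.
  have hDD p : DD p `<=` U := subset_trans (h1 p) (hD p.1).
  have [|p|L LP] := @common_exponent _ (allpairs pair l l) (fun p k =>
     rres O (hDD p) s ^+ k *: (mres M (h1 p) (ma p.1) - mres M (h2 p) (ma p.2)) = 0).
  + by move=> p j k jk e; rewrite -(subnK jk) exprD -scalerA e scaler0.
  + move=> /allpairsP[[a b] [/= al bl ->{p}]]; set p := (a, b).
    (* The overlap is again affine and contained in [D a], so the local hypothesis applies to it. *)
    have affp : affine O (DD p).
      have -> : DD p = D (a * b); last exact: affine_basic_open.
      apply: opens_eq; apply/seteqP; split=> x; rewrite /= unit_atM; by [].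
    have k := @openIl _ (DD p) W.
    have [_ inj] := loc (DD p) (hDD p) a k al affp (h1 p).
    have k1 : Defs.openI (DD p) W `<=` Defs.openI (D a) W by move=> x [[]].
    have k2 : Defs.openI (DD p) W `<=` Defs.openI (D b) W by move=> x [[]].
    have kW : Defs.openI (DD p) W `<=` W := @openIr _ _ _.
    apply: inj; rewrite mresB; have kU := subset_trans k (hDD p).
    rewrite (mres_comp _ _ (subset_trans k1 (hDW a))).
    rewrite -(mres_comp (hDW a) k1 (subset_trans k1 (hDW a))) -maP //.
    rewrite (mres_comp _ _ (subset_trans k2 (hDW b))).
    rewrite -(mres_comp (hDW b) k2 (subset_trans k2 (hDW b))) -maP //.
    by rewrite !mresZ !rmorphXn !(rres_comp _ _ kU) !(mres_comp _ _ kW) subrr.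
  have [|||t tP] := @mres_glue X O M hM U (fun V hV t => exists a (k : V `<=` D a),
      a \in l /\ t = rres O hV s ^+ L *: mres M k (ma a)).
  + move=> V hV t t' [a [k [al ->]]] [b [k' [bl ->]]].
    have kD : V `<=` DD (a, b) by move=> x Vx; split; [exact: k|exact: k'].
    have := congr1 (mres M kD) (LP (a, b) _); rewrite mresZ rmorphXn (rres_comp _ _ hV).
    rewrite mresB (mres_comp _ _ k) (mres_comp _ _ k') mres0 scalerBr.
    move=> /(_ (allpairs_f pair al bl)) /eqP.
    by rewrite subr_eq0 => /eqP.
  + move=> V V' hV k hV' t [a [kD [al ->]]]; exists a, (subset_trans k kD); split=> //.
    by rewrite mresZ rmorphXn (rres_comp _ _ hV') (mres_comp _ _ (subset_trans k kD)).
  + move=> x /lU[a al ua]; exists (D a), (hD a); split=> //.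
    exists (rres O (hD a) s ^+ L *: ma a), a, (fun y => id); split=> //.
    by rewrite mres_id.
  exists t, (L + K)%N; apply: (mres_sep hM) => x Wx.
  have [V [hV [Vx [a [k [al e]]]]]] := tP x (h x Wx).
  have iV := @openIl _ V W; have iW := @openIr _ V W.
  have iU : Defs.openI V W `<=` U := subset_trans iV hV.
  have iDW : Defs.openI V W `<=` Defs.openI (D a) W.
    by move=> y [Vy Wy]; split=> //; exact: (k y Vy).
  exists (Defs.openI V W), iW; split=> //.
  rewrite (mres_comp _ _ iU) -(mres_comp hV iV iU) e !mresZ !rmorphXn !(rres_comp _ _ iU).
  rewrite (mres_comp _ _ (subset_trans iV k)).
  rewrite (mresE _ (subset_trans iDW (hDW a))) -(mres_comp (hDW a) iDW) -maP //.
  rewrite mresZ rmorphXn (rres_comp _ _ iU) (mres_comp _ _ iW).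
  by rewrite exprD scalerA.
- have [|a al|K KP] := @common_exponent _ l (fun a k =>
     rres O (hD a) s ^+ k *: mres M (hD a) m = 0).
  + by move=> p j k jk e; rewrite -(subnK jk) exprD -scalerA e scaler0.
  + have [_ inj] := locD a al; apply: inj; rewrite (mres_comp _ _ (hDU a)).
    by rewrite -(mres_comp h (hWD a)) m0 mres0.
  exists K; apply: (mres_sep hM) => x /lU[a al ua]; exists (D a), (hD a); split=> //.
  by rewrite mresZ rmorphXn KP // mres0.
Qed.

Lemma locally_free_quasi_coherent n : locally_free M n -> quasi_coherent M.
Proof.
move=> lf; apply/quasi_coherentP => U affU; apply: basic_loc_local => // x Ux.
have [V [Vx [e be]]] := lf x; have [a [ua aV]] := affine_base affU Ux Vx.
exists a => // W affW Wa; exact: basis_basic_loc affW (is_basis_res (subset_trans Wa aV) be).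
Qed.

(** Surjectivity of [O^n -> M] as a map of sheaves: coordinates exist only after shrinking around
    each point. *)
Definition locally_generates (V : opens X) n (e : 'I_n -> M V) :=
  forall (W : opens X), W `<=` V -> forall (m : M W) x, oset W x ->
    exists (W' : opens X) (k : W' `<=` W) (h : W' `<=` V) a,
      oset W' x /\ mres M k m = lincomb e h a.

(** By quasi-compactness finitely many sections over [U] generate near every point, up to a factor
    that is a unit there. For fixed [m], the [a] with [a *: m] in their span form an ideal without
    common zero, which therefore contains [1]. *)
Lemma fg_of_local_generators (U : opens X) : affine O U -> basic_loc U ->
  (forall x, oset U x -> exists (V : opens X) n (e : 'I_n -> M V),
      oset V x /\ locally_generates e) -> fg_module (M U).
Proof.
move=> affU loc H.
pose G (s : O U) := exists l : seq (M U), forall (m : M U) y, unit_at s y ->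
    exists s', unit_at s' y /\ span l (s' *: m).
have [x Ux|l [lG lU]] := affine_cover affU (G := G).
  have [V [n [e [Vx gen]]]] := H x Ux.
  have [s [us sV]] := affine_base affU Ux Vx; exists s => //.
  pose D := basic_open s; have h : D `<=` U := @basic_openS X O U s.
  have [sur _] := loc s D h (erefl _); have [inv _ _] := affine_loc affU h (erefl (oset D)).
  have ex i : exists mk : M U * nat, rres O h (s ^+ mk.2) *: mres M sV (e i) = mres M h mk.1.
    by have [m [k E]] := sur (mres M sV (e i)); exists (m, k).
  pose mk i := sval (cid (ex i)).
  have mkP i : rres O h (s ^+ (mk i).2) *: mres M sV (e i) = mres M h (mk i).1.
    exact: (svalP (cid (ex i))).
  exists [seq (mk i).1 | i <- enum 'I_n] => m y uy.
  have [W' [kD [kV [a [W'y ea]]]]] := gen D sV (mres M h m) y uy.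
  have [t [ut tW']] := affine_base affU (h y uy) W'y.
  have hT : basic_open t `<=` U := @basic_openS X O U t.
  have [invt _ _] := affine_loc affU hT (erefl (oset (basic_open t))).
  have [_ injT] := loc t _ hT (erefl _).
  have TD := subset_trans tW' kD.
  pose c i := sval (cid (invertibleX (mk i).2 inv)).
  have cP i : c i * rres O h s ^+ (mk i).2 = 1 by exact: (svalP (cid (invertibleX (mk i).2 inv))).
  (* Coordinates of [m] with respect to the numerators [(mk i).1], where [c i] inverts the
     denominator of [e i]. A power of [t] then clears the denominators of these coordinates. *)
  pose b : 'rV[O (basic_open t)]_n := \row_i (rres O tW' (a ord0 i) * rres O TD (c i)).
  have [k [b' eb]] := affine_row hT b affU (erefl (oset (basic_open t))).
  pose z := \sum_i b' ord0 i *: (mk i).1.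
  have zE : mres M hT (t ^+ k *: m) = mres M hT z.
    rewrite mresZ -(mres_comp h TD) -(mres_comp kD tW') ea.
    rewrite (lincomb_res _ _ _ (subset_trans tW' kV)) mres_sum /lincomb scaler_sumr.
    apply: eq_bigr => i _; rewrite mresZ -(mres_comp h TD) -mkP mresZ scalerA.
    rewrite rmorphXn (mres_comp _ _ (subset_trans tW' kV)) scalerA; congr (_ *: _).
    move/rowP/(_ i): eb; rewrite !mxE => <-.
    rewrite [rres O hT (t ^+ k)]rmorphXn [rres O h (s ^+ _)]rmorphXn -!mulrA.
    by rewrite -rmorphM cP rmorph1 mulr1.
  have [|j ej] := injT (t ^+ k *: m - z); first by rewrite mresB zE subrr.
  exists (t ^+ (j + k)); split; first exact: unit_atX.
  rewrite exprD -scalerA; move: ej; rewrite scalerBr => /eqP; rewrite subr_eq0 => /eqP->.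
  have [S0 SD SZ] := span_submodule [seq (mk i).1 | i <- enum 'I_n].
  apply: (SZ); apply: (big_ind (span _)) => // i _; apply: SZ; apply: mem_span.
  by apply: map_f; rewrite mem_enum.
apply/fg_moduleP.
have [L LP] : exists L : seq (M U), forall s, s \in l -> forall (m : M U) y, unit_at s y ->
    exists s', unit_at s' y /\ span L (s' *: m).
  have sub (L L' : seq (M U)) : {subset L <= L'} -> span L `<=` span L'.
    by move=> sL m mL S Ss SL; apply: mL => // x /sL; exact: SL.
  elim: l lG {lU} => [|s l IH] lG; first by exists [::].
  have [|L LP] := IH; first by move=> t tl; apply: lG; rewrite inE tl orbT.
  have [L' LP'] := lG s (mem_head s l); exists (L' ++ L) => t.
  rewrite inE => /orP[/eqP->|tl] m y /= ut.
    have [s' [us' sp]] := LP' m y ut; exists s'; split=> //; apply: sub sp.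
    by move=> z zL; rewrite mem_cat zL.
  have [s' [us' sp]] := LP t tl m y ut; exists s'; split=> //; apply: sub sp.
  by move=> z zL; rewrite mem_cat zL orbT.
exists L => m; rewrite -[m]scale1r; have [S0 SD SZ] := span_submodule L.
apply: (affine_ideal_one affU (I := [set a | span L (a *: m)])).
  split; first by rewrite /= scale0r.
    by move=> a b; rewrite /= scalerDl; exact: SD.
  by move=> a b; rewrite /= -scalerA; exact: SZ.
by move=> x /lU[s sl us]; have [s' [us' sp]] := LP s sl m x us; exists s'.
Qed.

End QuasiCoherence.

(** * Traces *)

Section TraceOfMap.
Variables (R : comPzRingType) (M : lmodType R).

Definition free_basis n (e : 'I_n -> M) :=
  (forall m, exists a : 'rV[R]_n, m = \sum_i a ord0 i *: e i) /\
  (forall a : 'rV[R]_n, \sum_i a ord0 i *: e i = 0 -> a = 0).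

Lemma free_basis_inj n (e : 'I_n -> M) (a b : 'I_n -> R) : free_basis e ->
  \sum_i a i *: e i = \sum_i b i *: e i -> forall i, a i = b i.
Proof.
move=> [_ inj] /eqP; rewrite -subr_eq0 -sumrB => /eqP E i; apply/eqP; rewrite -subr_eq0.
have /rowP/(_ i) : \row_i (a i - b i) = 0.
  by apply: inj; rewrite -[RHS]E; apply: eq_bigr => j _; rewrite mxE scalerBl.
by rewrite !mxE => ->.
Qed.

Lemma linear_lincomb (phi : M -> M) n (a : 'I_n -> R) (e : 'I_n -> M) : linear phi ->
  phi (\sum_i a i *: e i) = \sum_i a i *: phi (e i).
Proof.
move=> phiL; have phi0 : phi 0 = 0.
  by have := phiL (-1) 0 0; rewrite scaler0 addr0 scaleN1r addNr.
elim/big_rec2: _ => [//|i x y _ <-]; exact: phiL.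
Qed.

(** The sizes may differ, as they can over the zero ring: the rectangular transition matrices
    satisfy [P Q = 1] and [Q P = 1], whence [tr A = tr (P A' Q) = tr A']. *)
Lemma trace_basis_change (phi : M -> M) n n' (e : 'I_n -> M) (e' : 'I_n' -> M)
    (A : 'M[R]_n) (A' : 'M[R]_n') : linear phi ->
  free_basis e -> free_basis e' ->
  (forall i, phi (e i) = \sum_j A i j *: e j) ->
  (forall i, phi (e' i) = \sum_j A' i j *: e' j) -> \tr A = \tr A'.
Proof.
have coords k l (u : 'I_k -> M) (v : 'I_l -> M) : free_basis v ->
    exists P : 'M[R]_(k, l), forall i, u i = \sum_j P i j *: v j.
  move=> [sur _]; exists (\matrix_(i, j) (sval (cid (sur (u i)))) ord0 j) => i.
  rewrite {1}(svalP (cid (sur (u i)))); apply: eq_bigr => j _; by rewrite mxE.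
have comp k l m (P : 'M[R]_(k, l)) (Q : 'M[R]_(l, m)) (u : 'I_m -> M) i :
    \sum_j P i j *: (\sum_h Q j h *: u h) = \sum_h (P *m Q) i h *: u h.
  under eq_bigr do rewrite scaler_sumr.
  rewrite exchange_big; apply: eq_bigr => h _; rewrite mxE scaler_suml.
  by apply: eq_bigr => j _; rewrite scalerA.
have inv k l (u : 'I_k -> M) (v : 'I_l -> M) (P : 'M[R]_(k, l)) (Q : 'M[R]_(l, k)) :
    free_basis u -> (forall i, u i = \sum_j P i j *: v j) ->
    (forall i, v i = \sum_j Q i j *: u j) -> P *m Q = 1%:M.
  move=> bu uP vQ; apply/matrixP => i j; apply: (free_basis_inj bu (b := (1%:M) i)).
  rewrite -comp; under eq_bigr do rewrite -vQ.
  rewrite -uP (bigD1 i) //= mxE eqxx scale1r big1 ?addr0 // => h hi.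
  by rewrite mxE eq_sym (negPf hi) scale0r.
move=> phiL be be' eA e'A'.
have [P eP] := coords _ _ e e' be'; have [Q e'Q] := coords _ _ e' e be.
have PQ := inv _ _ _ _ _ _ be eP e'Q; have QP := inv _ _ _ _ _ _ be' e'Q eP.
have AP : A *m P = P *m A'.
  apply/matrixP => i; apply: (free_basis_inj be').
  rewrite -!comp; under eq_bigr do rewrite -eP.
  by under [RHS]eq_bigr do rewrite -e'A'; rewrite -linear_lincomb // -eP.
by rewrite -[A]mulmx1 -PQ mulmxA AP mxtrace_mulC mulmxA QP mul1mx.
Qed.

End TraceOfMap.

Section Trace.
Variables (X : topologicalType) (O : ringPresheaf X).

Lemma basis_at_free (M : modPresheaf O) (U : opens X) n (e : 'I_n -> M U)
    (h : U `<=` U) : basis_at e h <-> free_basis e.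
Proof.
have E : lincomb e h = fun a => \sum_i a ord0 i *: e i.
  by apply/funext => a; exact: lincomb_id.
by rewrite /basis_at E.
Qed.

Lemma is_basis_free (M : modPresheaf O) (U V : opens X) (h : V `<=` U) n (e : 'I_n -> M U) :
  is_basis e -> free_basis (fun i => mres M h (e i)).
Proof.
move=> /(is_basis_res h)/is_basisE/(_ V (fun y => id)); exact: (basis_at_free _ _).1.
Qed.

Definition matrix_of (M : modPresheaf O) (U : opens X) (E : endo M U) (V : opens X)
    (h : V `<=` U) n (e : 'I_n -> M V) (A : 'M[O V]_n) :=
  forall i, eapp E h (e i) = \sum_j A i j *: e j.

Lemma matrix_of_res (M : modPresheaf O) (U : opens X) (E : endo M U) (V W : opens X)
    (h : V `<=` U) (k : W `<=` V) (l : W `<=` U) n (e : 'I_n -> M V) (A : 'M[O V]_n) :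
  matrix_of E h e A -> matrix_of E l (fun i => mres M k (e i)) (map_mx (rres O k) A).
Proof.
move=> eA i; rewrite -(eapp_res E h k l) eA mres_sum.
by apply: eq_bigr => j _; rewrite mresZ mxE.
Qed.

Lemma matrix_of_trace (M : modPresheaf O) (U : opens X) (E : endo M U) (V : opens X)
    (h : V `<=` U) n n' (e : 'I_n -> M V) (e' : 'I_n' -> M V) A A' :
  is_basis e -> is_basis e' -> matrix_of E h e A -> matrix_of E h e' A' -> \tr A = \tr A'.
Proof.
move=> be be'; apply: trace_basis_change; first exact: eapp_linear.
  have := is_basis_free (fun y => id) be; congr free_basis.
  by apply/funext => i; rewrite mres_id.
have := is_basis_free (fun y => id) be'; congr free_basis.
by apply/funext => i; rewrite mres_id.
Qed.

Lemma traceE (M : modPresheaf O) (U : opens X) (E : endo M U) (h : U `<=` U) n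
    (e : 'I_n -> M U) (A : 'M[O U]_n) :
  is_basis e -> matrix_of E h e A -> trace E = \tr A.
Proof.
move=> be eA.
have tA : is_trace E (\tr A).
  move=> V k n' e' A' be' eA'; rewrite -trace_map_mx.
  exact: matrix_of_trace (is_basis_res k be) be' (matrix_of_res k k eA) eA'.
rewrite /trace; case: xgetP => [t _ tE|/(_ _ tA)//].
by rewrite -(tE U h n e A be eA) rres_id.
Qed.

Hypothesis hO : is_sheaf (fun U V h => rres O (U := U) (V := V) h).

(* No trace has to be glued: E and E' have the same set of traces, so [xget]
   returns the same section even where this set is empty. *)
Lemma trace_eq_local (M M' : modPresheaf O) (U : opens X) (E : endo M U) (E' : endo M' U) :
  (forall x, oset U x -> exists (V : opens X) (h : V `<=` U) n (e : 'I_n -> M V) A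
      n' (e' : 'I_n' -> M' V) A', oset V x /\
      [/\ is_basis e, is_basis e', matrix_of E h e A, matrix_of E' h e' A' & \tr A = \tr A']) ->
  trace E = trace E'.
Proof.
have key (N N' : modPresheaf O) (F : endo N U) (F' : endo N' U) :
    (forall x, oset U x -> exists (V : opens X) (h : V `<=` U) n (e : 'I_n -> N V) A
      n' (e' : 'I_n' -> N' V) A', oset V x /\
      [/\ is_basis e, is_basis e', matrix_of F h e A, matrix_of F' h e' A' & \tr A = \tr A']) ->
    forall t, is_trace F t -> is_trace F' t.
  move=> loc t tF V h n e A be eA; apply: (rres_sep hO) => x Vx.
  have [W [k [n1 [e1 [A1 [n2 [e2 [A2 [Wx [b1 b2 m1 m2 tr]]]]]]]]]] := loc x (h x Vx).
  have iV := @openIl _ V W; have iW := @openIr _ V W; have iU := subset_trans iV h.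
  exists (Defs.openI V W), iV; split=> //.
  rewrite (rres_comp _ _ iU) -(rres_comp k iW iU) (tF W k n1 e1 A1 b1 m1) tr.
  rewrite -!trace_map_mx.
  by apply: matrix_of_trace (is_basis_res iW b2) (is_basis_res iV be)
    (matrix_of_res iW iU m2) (matrix_of_res iV iU eA).
move=> loc; rewrite /trace; congr xget; apply/seteqP; split=> t; apply: key => //.
move=> x /loc[V [h [n [e [A [n' [e' [A' [Vx [be be' m m' tr]]]]]]]]]].
by exists V, h, n', e', A', n, e, A; split.
Qed.

End Trace.

(** * Principal opens of the projective line *)

Section PrincipalDomains.

Definition integral_ring (R : comPzRingType) :=
  (1 : R) <> 0 /\ forall a b : R, a * b = 0 -> a = 0 \/ b = 0.

Definition principal_ring (R : comPzRingType) := forall I : set R, is_ideal I ->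
  exists2 d, I d & forall a, I a -> exists b, a = b * d.

Lemma principal_poly (K : fieldType) : principal_ring {poly K}.
Proof.
move=> I [I0 ID IM].
case: (pselect (exists p, I p /\ p != 0)) => [[p [Ip p0]]|I00]; last first.
  exists 0 => // a Ia; exists 0; rewrite mul0r; apply: contrapT => a0.
  by apply: I00; exists a; split=> //; apply/eqP.
have ex : exists n, `[< exists q : {poly K}, [/\ I q, q != 0 & size q = n] >].
  by exists (size p); apply/asboolP; exists p.
case: (ex_minnP ex) => n /asboolP[d [Id d0 <-]] dmin; exists d => // a Ia.
exists (a %/ d); rewrite [LHS](divp_eq a d); suff -> : a %% d = 0 by rewrite addr0.
apply/eqP; apply: contrapT => /negP r0.
have := dmin (size (a %% d)); rewrite leqNgt ltn_modp d0 => /(_ _)/negP[] //.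
apply/asboolP; exists (a %% d); split=> //.
have -> : a %% d = a + (- (a %/ d)) * d by rewrite {2}(divp_eq a d); ring.
by apply: ID => //; exact: IM.
Qed.

Variables (R Q : comPzRingType) (iota : {rmorphism R -> Q}).
Hypothesis frac : forall q, exists a s, invertible (iota s) /\ iota s * q = iota a.

(** Fractions whose denominators become invertible in [Q] cover both uses: the chart isomorphisms,
    with denominator [1], and restriction to a basic open. *)
Lemma principal_localization : principal_ring R -> principal_ring Q.
Proof.
move=> pR I [I0 ID IM].
have [|d Id dP] := pR [set a | I (iota a)].
  split=> [|a b|a b]; rewrite /= ?rmorph0 ?rmorphD ?rmorphM //; [exact: ID|exact: IM].
exists (iota d) => // q Iq; have [a [s [[t ts] e]]] := frac q.
have [|b eb] := dP a; first by rewrite /= -e; exact: IM.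
by exists (t * iota b); rewrite -mulrA -rmorphM -eb -e mulrA ts mul1r.
Qed.

Hypothesis ker : forall a, iota a = 0 -> exists s, invertible (iota s) /\ s * a = 0.

Lemma integral_localization : (1 : Q) <> 0 -> integral_ring R -> integral_ring Q.
Proof.
move=> Q10 [_ R0]; split=> // x y xy0.
have [a [s [is1 ea]]] := frac x; have [b [t [it eb]]] := frac y.
have /ker[u [iu]] : iota (a * b) = 0.
  by rewrite rmorphM -ea -eb mulrACA xy0 mulr0.
move/R0 => [u0|/R0[a0|b0]].
- case: Q10; have [v <-] := iu; by rewrite u0 rmorph0 mulr0.
- by left; apply: (invertible_mulI is1); rewrite ea a0 rmorph0 mulr0.
- by right; apply: (invertible_mulI it); rewrite eb b0 rmorph0 mulr0.
Qed.

End PrincipalDomains.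

Section IntegralOpens.
Variables (X : topologicalType) (O : ringPresheaf X).

Definition pid_open (V : opens X) :=
  [/\ affine O V, integral_ring (O V) & principal_ring (O V)].

Lemma affine_neq0 (V : opens X) x : affine O V -> oset V x -> (1 : O V) <> 0.
Proof.
move=> affV Vx e; have [v0 _ _ v1 _] := affine_prime affV Vx.
by apply: v1; rewrite e.
Qed.

Lemma pid_basic_open (V : opens X) (s : O V) x :
  pid_open V -> unit_at s x -> pid_open (basic_open s).
Proof.
move=> [affV iV pV] us; have aD := affine_basic_open affV s; split=> //.
  apply: (integral_localization (iota := rres O (@basic_openS X O V s))) => //.
  - move=> q; have [inv sur _] := affine_loc affV (@basic_openS X O V s) (erefl _).
    have [m [k e]] := sur q; exists m, (s ^+ k).
    by rewrite rmorphXn; split=> //; exact: invertibleX.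
  - move=> a a0; have [inv _ inj] := affine_loc affV (@basic_openS X O V s) (erefl _).
    have [k e] := inj a a0; exists (s ^+ k).
    by rewrite rmorphXn; split=> //; exact: invertibleX.
  - exact: (affine_neq0 aD us).
apply: (principal_localization (iota := rres O (@basic_openS X O V s))) => // q.
have [inv sur _] := affine_loc affV (@basic_openS X O V s) (erefl _).
have [m [k e]] := sur q; exists m, (s ^+ k).
by rewrite rmorphXn; split=> //; exact: invertibleX.
Qed.

(** The zero ideal is prime, hence it is the vanishing ideal of a point [eta]; a nonempty open
    contains a nonempty basic open, which is defined by a nonzero function. *)
Lemma generic_point_affine (V : opens X) : affine O V -> integral_ring (O V) ->
  exists2 eta, oset V eta & (forall a : O V, a <> 0 -> unit_at a eta) /\
    forall (W : opens X) x, W `<=` V -> oset W x -> oset W eta.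
Proof.
move=> affV [V10 V0].
have p0 : prime_ideal [set 0 : O V].
  split=> /=; [by []|by move=> a b -> ->; rewrite addr0|
      by move=> a b ->; rewrite mulr0|by []|exact: V0].
have [eta Ve ve] := affine_point affV p0; exists eta => //.
have ueta (a : O V) : a <> 0 -> unit_at a eta.
  by move=> a0; apply: contrapT => nu; apply: a0; have : [set 0] a by rewrite -ve.
split=> // W x WV Wx; have [s [us sW]] := affine_base affV (WV x Wx) Wx.
apply: sW; apply: ueta => s0; rewrite s0 in us; exact: (@unit_at0 _ _ _ affV _ us).
Qed.

(** A nonzero section is a unit at the generic point, which lies in every nonempty [W]. *)
Lemma integral_res_inj (V W : opens X) (h : W `<=` V) x : affine O V ->
  integral_ring (O V) -> oset W x -> injective (rres O h).
Proof.
move=> affV iV Wx a b /eqP; rewrite -subr_eq0 -rmorphB => /eqP ab0.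
apply/eqP; rewrite -subr_eq0; apply/eqP; apply: contrapT => c0.
have [eta Ve [ueta etaW]] := generic_point_affine affV iV.
have We := etaW W x h Wx.
have : unit_at (rres O h (a - b)) eta by apply/unit_at_res => //; exact: ueta.
rewrite ab0 => -[V' [k [V'e inv]]].
have : unit_at (0 : O V) eta.
  by exists V', (subset_trans k h); rewrite rmorph0 -(rmorph0 (rres O k)).
exact: unit_at0.
Qed.

End IntegralOpens.

Section ProjectiveLine.
Variables (K : fieldType) (P : projectiveLine K).
Local Notation OP := (Osh P).

Lemma P1_pid_U0 w : oset (U0 P) w -> pid_open OP (U0 P).
Proof.
move=> Uw; have [g gK Kg] := chart0_bij P.
have frac q : exists a s, invertible (chart0 P s) /\ chart0 P s * q = chart0 P a.
  exists (g q), 1; split; first by exists 1; rewrite rmorph1 mulr1.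
  by rewrite rmorph1 mul1r Kg.
split; first exact: U0_affine.
  apply: integral_localization frac _ _ _.
  - move=> a a0; exists 1; split; first by exists 1; rewrite rmorph1 mulr1.
    rewrite mul1r; apply: (can_inj gK).
    by rewrite a0 rmorph0.
  - exact: affine_neq0 (U0_affine P) Uw.
  - split; first by apply/eqP; exact: oner_neq0.
    by move=> a b /eqP; rewrite mulf_eq0 => /orP[/eqP|/eqP]; [left|right].
by apply: principal_localization frac _; exact: principal_poly.
Qed.

Lemma P1_pid_U1 w : oset (U1 P) w -> pid_open OP (U1 P).
Proof.
move=> Uw; have [g gK Kg] := chart1_bij P.
have frac q : exists a s, invertible (chart1 P s) /\ chart1 P s * q = chart1 P a.
  exists (g q), 1; split; first by exists 1; rewrite rmorph1 mulr1.
  by rewrite rmorph1 mul1r Kg.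
split; first exact: U1_affine.
  apply: integral_localization frac _ _ _.
  - move=> a a0; exists 1; split; first by exists 1; rewrite rmorph1 mulr1.
    rewrite mul1r; apply: (can_inj gK).
    by rewrite a0 rmorph0.
  - exact: affine_neq0 (U1_affine P) Uw.
  - split; first by apply/eqP; exact: oner_neq0.
    by move=> a b /eqP; rewrite mulf_eq0 => /orP[/eqP|/eqP]; [left|right].
by apply: principal_localization frac _; exact: principal_poly.
Qed.

Lemma P1_pid_base (W : opens P) w : oset W w ->
  exists V, [/\ pid_open OP V, oset V w & V `<=` W].
Proof.
move=> Ww; have [U [pU Uw]] : exists U, pid_open OP U /\ oset U w.
  have [Uw|Uw] := P1_cover w; first by exists (U0 P); split=> //; exact: P1_pid_U0 Uw.
  by exists (U1 P); split=> //; exact: P1_pid_U1 Uw.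
have [affU _ _] := pU; have [s [us sW]] := affine_base affU Uw Ww.
by exists (basic_open s); split=> //; exact: pid_basic_open us.
Qed.

(** The generic point [eta] of [U0] lies in [U1] because [t] is nonzero, so the generic point of
    [U1] lies in [U0]. A nonempty open of [U1] thus meets [U0] and contains [eta]. *)
Lemma P1_generic_point : exists eta : P, forall (W : opens P) w, oset W w -> oset W eta.
Proof.
have U0ne : exists w, oset (U0 P) w.
  have [g gK _] := chart0_bij P.
  apply: contrapT => ne; have : (chart0 P 1) = chart0 P 0.
    by apply: rres_eq0 ne; exact: OshP.
  by move/(can_inj gK)/eqP; rewrite oner_eq0.
have [w0 U0w] := U0ne; have [aff0 i0 _] := P1_pid_U0 U0w.
have [eta Ue [ueta etaW]] := generic_point_affine aff0 i0.
exists eta.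
have U1e : oset (U1 P) eta.
  suff : (U0 P `&` U1 P) eta by case.
  rewrite -overlap0; apply: ueta => X0; have [g gK _] := chart0_bij P.
  have : 'X = 0 :> {poly K} by apply: (can_inj gK); rewrite X0 rmorph0.
  by move/eqP; rewrite polyX_eq0.
have [aff1 i1 _] := P1_pid_U1 U1e.
have [eta' Ue' [_ etaW']] := generic_point_affine aff1 i1.
have U0e' : oset (U0 P) eta'.
  by have [] := etaW' (Defs.openI (U0 P) (U1 P)) eta (@openIr _ _ _) (conj Ue U1e).
move=> W w Ww; have [U0x|U1x] := P1_cover w.
  by have [] := etaW (Defs.openI W (U0 P)) w (@openIr _ _ _) (conj Ww U0x).
have [We' _] := etaW' (Defs.openI W (U1 P)) w (@openIr _ _ _) (conj Ww U1x).
by have [] := etaW (Defs.openI W (U0 P)) eta' (@openIr _ _ _) (conj We' U0e').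
Qed.

End ProjectiveLine.

(** * Direct images and charts of a double cover *)

Definition pair2 (T : Type) (a b : T) (i : 'I_2) : T := if i == ord0 then a else b.

Lemma pair2_eta (T : Type) (e : 'I_2 -> T) : e = pair2 (e ord0) (e ord_max).
Proof.
apply/funext => i; rewrite /pair2; case: eqP => [-> //|/eqP i0].
by congr e; apply: val_inj; case: i i0 => -[|[|]].
Qed.

Lemma sum_pair2 (R : pzRingType) (M : lmodType R) (a : 'I_2 -> R) (e1 e2 : M) :
  \sum_i a i *: pair2 e1 e2 i = a ord0 *: e1 + a ord_max *: e2.
Proof. by rewrite big_ord_recl big_ord1 /pair2 /=; congr (_ + a _ *: _); exact: val_inj. Qed.

Section DirectImage.
Variables (X Y : scheme) (f : schemeMorphism X Y).
Local Notation OX := (Osh X).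
Local Notation OY := (Osh Y).
Local Notation fi V := (opre (mcont f) V).

Definition fsh (V : opens Y) : {rmorphism OY V -> OX (fi V)} := comor f V.

Definition fiS (U V : opens Y) (h : V `<=` U) : fi V `<=` fi U := @opreS _ _ _ (mcont f) U V h.

Lemma fsh_res (U V : opens Y) (h : V `<=` U) (k : fi V `<=` fi U) s :
  fsh V (rres OY h s) = rres OX k (fsh U s).
Proof. by rewrite /fsh rmapP (Prop_irrelevance k (fiS h)). Qed.

(** One inclusion pulls back an inverse; the other is the locality of [f] on stalks. *)
Lemma opre_basic_open (V : opens Y) (s : OY V) :
  oset (fi (basic_open s)) = basic_open (fsh V s).
Proof.
apply/seteqP; split=> x /=.
  move=> [W [h [Wx inv]]]; exists (fi W), (fiS h); split=> //.
  by rewrite -(fsh_res h); exact: invertible_morph.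
by move=> us; apply: mlocal => //; exact: unit_at_in us.
Qed.

Variable M : modPresheaf OX.
Local Notation N := (direct_image f M).

Lemma dscaleE (V : opens Y) a (m : N V) : a *: m = fsh V a *: (m : M (fi V)) :> M (fi V).
Proof. by []. Qed.

Lemma direct_image_sheaf : is_sheaf (fun U V h => mres M (U := U) (V := V) h) ->
  is_sheaf (fun U V h => mres N (U := U) (V := V) h).
Proof.
move=> hM I U V hV cov s comp.
have [|i j W hi hj|t [tP tu]] := hM I (fi U) (fun i => fi (V i)) (fun i => fiS (hV i)) _ s.
- by move=> x /cov.
- have l : W `<=` fi (Defs.openI (V i) (V j)) by move=> x Wx; split; [exact: hi|exact: hj].
  have := comp i j (Defs.openI (V i) (V j)) (@openIl _ _ _) (@openIr _ _ _).
  by move/(congr1 (mres M l)); rewrite !(mres_comp _ _ hi) !(mres_comp _ _ hj).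
exists t; split; first exact: tP.
by move=> t'; exact: tu.
Qed.

Lemma direct_image_loc (V : opens Y) : basic_loc M (fi V) -> basic_loc N V.
Proof.
move=> loc s W h eW.
have e : oset (fi W) = basic_open (fsh V s).
  by rewrite -opre_basic_open (opens_eq eW).
have [sur inj] := loc (fsh V s) (fi W) (fiS h) e; split=> [n|m m0].
  have [m [k E]] := sur n; exists m, k; rewrite dscaleE (fsh_res h (fiS h)) rmorphXn.
  exact: E.
by have [k E] := inj m m0; exists k; rewrite dscaleE rmorphXn.
Qed.

(** Bases of [f_* M] are handled through sections of [M] itself: the coefficients come from [Y],
    while sections of [O_X] must be able to act on the same vectors. *)
Definition dcomb (V W : opens Y) (h : W `<=` V) (e1 e2 : M (fi V)) (a b : OY W) : M (fi W) :=
  fsh W a *: mres M (fiS h) e1 + fsh W b *: mres M (fiS h) e2.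

Definition dbasis_at (V W : opens Y) (h : W `<=` V) (e1 e2 : M (fi V)) :=
  (forall m, exists a b, m = dcomb h e1 e2 a b) /\
  (forall a b, dcomb h e1 e2 a b = 0 -> a = 0 /\ b = 0).

Definition dbasis (V : opens Y) (e1 e2 : M (fi V)) :=
  forall (W : opens Y) (h : W `<=` V), dbasis_at h e1 e2.

Lemma dbasis_atP (V W : opens Y) (h : W `<=` V) (e1 e2 : M (fi V)) :
  dbasis_at h e1 e2 <-> basis_at (M := N) (pair2 (e1 : N V) e2) h.
Proof.
have E (a : 'rV[OY W]_2) : lincomb (pair2 (e1 : N V) e2) h a =
    dcomb h e1 e2 (a ord0 ord0) (a ord0 ord_max).
  rewrite /lincomb (eq_bigr (fun i => a ord0 i *:
     pair2 (mres N h (e1 : N V)) (mres N h (e2 : N V)) i)).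
    exact: (@sum_pair2 _ (N W) (fun i => a ord0 i)).
  by move=> i _; rewrite /pair2; case: ifP.
split=> -[sur inj]; split.
- move=> m; have [a [b ->]] := sur m; exists (\row_i pair2 a b i).
  by rewrite E !mxE.
- move=> a; rewrite E => /inj[a0 b0]; apply/rowP => i; rewrite mxE.
  by rewrite (pair2_eta (a ord0)) a0 b0 /pair2; case: ifP.
- by move=> m; have [a ->] := sur m; rewrite E; exists (a ord0 ord0), (a ord0 ord_max).
- move=> a b ab0; have := inj (\row_i pair2 a b i); rewrite E !mxE => /(_ ab0)/rowP E0.
  by have := E0 ord0; have := E0 ord_max; rewrite !mxE.
Qed.

Lemma dbasisP (V : opens Y) (e1 e2 : M (fi V)) :
  dbasis e1 e2 <-> is_basis (M := N) (pair2 (e1 : N V) e2).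
Proof.
split=> [be|/is_basisE be W h]; last by apply/dbasis_atP; exact: be.
by apply/is_basisE => W h; apply/dbasis_atP; exact: be.
Qed.

Lemma dbasis_res (V W : opens Y) (h : W `<=` V) (e1 e2 : M (fi V)) :
  dbasis e1 e2 -> dbasis (mres M (fiS h) e1) (mres M (fiS h) e2).
Proof.
move=> be W' k; have l := subset_trans k h; have := be W' l.
have E a b : dcomb k (mres M (fiS h) e1) (mres M (fiS h) e2) a b = dcomb l e1 e2 a b.
  by rewrite /dcomb !(mres_comp _ _ (fiS l)).
move=> [sur inj]; split=> [m|a b]; last by rewrite E; exact: inj.
by have [a [b ->]] := sur m; exists a, b; rewrite E.
Qed.

Lemma dbasis_affine (V : opens Y) (e1 e2 : M (fi V)) :
  is_sheaf (fun U V h => mres M (U := U) (V := V) h) ->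
  affine OY V -> basic_loc M (fi V) ->
  (forall m, exists a b, m = fsh V a *: e1 + fsh V b *: e2) ->
  (forall a b, fsh V a *: e1 + fsh V b *: e2 = 0 -> a = 0 /\ b = 0) ->
  dbasis e1 e2.
Proof.
move=> hM affV loc sur inj; apply/dbasisP.
have idV : V `<=` V by [].
apply: (basis_affine (@OshP Y) (direct_image_sheaf hM) (id_U := idV) affV).
  exact: direct_image_loc.
have E a b : dcomb idV e1 e2 a b = fsh V a *: e1 + fsh V b *: e2.
  by rewrite /dcomb !mres_id.
apply/dbasis_atP; split=> [m|a b]; last by rewrite E; exact: inj.
by have [a [b ->]] := sur m; exists a, b; rewrite E.
Qed.

Lemma dbasis_top (V : opens Y) (e1 e2 : M (fi V)) : dbasis e1 e2 ->
  (forall m, exists a b, m = fsh V a *: e1 + fsh V b *: e2) /\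
  (forall a b, fsh V a *: e1 + fsh V b *: e2 = 0 -> a = 0 /\ b = 0).
Proof.
have idV : V `<=` V by [].
move=> /(_ V idV) [sur inj].
have E a b : dcomb idV e1 e2 a b = fsh V a *: e1 + fsh V b *: e2.
  by rewrite /dcomb !mres_id.
split=> [m|a b]; last by rewrite -E; exact: inj.
by have [a [b ->]] := sur m; exists a, b; rewrite E.
Qed.

End DirectImage.

Section DoubleCover.
Variables (K : fieldType) (P : projectiveLine K) (C : scheme) (f : schemeMorphism C P).
Hypothesis hK : 2%N \notin [pchar K].
Hypothesis hf : double_cover f.
Local Notation OC := (Osh C).
Local Notation OP := (Osh P).
Local Notation fi V := (opre (mcont f) V).

Lemma half_exists (V : opens P) : exists h : OP V, 2%:R * h = 1.
Proof.
have K2 : (2%:R : K) != 0 by apply: contra hK => k0; rewrite inE /= k0.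
exists (rres OP (@openTS _ V) (structK P (2%:R)^-1)).
by rewrite -(rmorph_nat (rres OP (@openTS _ V))) -(rmorph_nat (structK P)) -!rmorphM
  divff // !rmorph1.
Qed.

Lemma fi_affine (V : opens P) : affine OP V -> affine OC (fi V).
Proof. by case: hf => fin _ /fin[]. Qed.

Lemma regular_dbasis_affine (V : opens P) (y : OC (fi V)) :
  affine OP V ->
  (forall r, exists a b, r = fsh f V a + fsh f V b * y) ->
  (forall a b, fsh f V a + fsh f V b * y = 0 -> a = 0 /\ b = 0) ->
  dbasis (M := regular_presheaf OC) 1 y.
Proof.
move=> affV sur inj; apply: dbasis_affine => //; first exact: OshP.
- by move=> s W h; apply: affine_is_loc; exact: fi_affine.
- by move=> r; have [a [b ->]] := sur r; exists a, b; rewrite -[fsh f V a in LHS]mulr1.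
- by move=> a b; rewrite -[X in X -> _]/(fsh f V a * 1 + fsh f V b * y = 0) mulr1; exact: inj.
Qed.

(** The field [chart_neq0] serves to place the generic point of the line in [V]. *)
Record chart (V : opens P) (y : OC (fi V)) (F : OP V) : Prop := Chart {
  chart_pid : pid_open OP V;
  chart_neq0 : exists w, oset V w;
  chart_sq : y * y = fsh f V F;
  chart_basis : dbasis (M := regular_presheaf OC) 1 y }.

Lemma chart_top (V : opens P) (y : OC (fi V)) (F : OP V) : chart y F ->
  (forall r, exists a b, r = fsh f V a + fsh f V b * y) /\
  (forall a b, fsh f V a + fsh f V b * y = 0 -> a = 0 /\ b = 0).
Proof.
case=> _ _ _ /dbasis_top[sur inj]; split=> [r|a b ab].
  by have [a [b ->]] := sur r; exists a, b; rewrite -[fsh f V a in RHS]mulr1.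
by apply: inj; rewrite -[LHS]/(fsh f V a * 1 + fsh f V b * y) mulr1.
Qed.

Lemma chart_res (V W : opens P) (h : W `<=` V) (y : OC (fi V)) (F : OP V) w :
  oset W w -> pid_open OP W -> chart y F ->
  chart (rres OC (fiS h) y) (rres OP h F).
Proof.
move=> Ww pW [pV _ sq be]; split=> //; first by exists w.
  by rewrite (fsh_res h (fiS h)) -sq rmorphM.
by have := dbasis_res h be; rewrite /= rmorph1.
Qed.

(* Completing the square: if (e1, e2) is a basis of f_* O and 1 = u e1 + v e2,
   then tr 1 = 2 makes (u, v) unimodular, and y spans the traceless part. *)
Lemma chart_exists (W : opens P) w : oset W w ->
  exists V (y : OC (fi V)) F, [/\ chart y F, oset V w & V `<=` W].
Proof.
move=> Ww; case: (hf) => _ /(_ w)[U [Uw [e be]]].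
have [V [pV Vw VUW]] := P1_pid_base (conj Uw Ww : oset (Defs.openI U W) w).
have VU : V `<=` U by move=> x /VUW[].
rewrite (pair2_eta e) in be.
have [e1 [e2 [sur inj]]] : exists e1 e2 : OC (fi V),
    (forall r, exists a b, r = fsh f V a * e1 + fsh f V b * e2) /\
    (forall a b, fsh f V a * e1 + fsh f V b * e2 = 0 -> a = 0 /\ b = 0).
  have /dbasisP/(dbasis_res VU)/dbasis_top := be.
  by exists (mres (regular_presheaf OC) (fiS VU) (e ord0)),
    (mres (regular_presheaf OC) (fiS VU) (e ord_max)).
have uniq a b a' b' : fsh f V a * e1 + fsh f V b * e2 = fsh f V a' * e1 + fsh f V b' * e2 ->
    a = a' /\ b = b'.
  move=> E; have [] := inj (a - a') (b - b').
    by rewrite !rmorphB !mulrBl addrACA E -opprD subrr.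
  by move=> /eqP + /eqP; rewrite !subr_eq0 => /eqP-> /eqP->.
have [h h1] := half_exists V; pose phi := fsh f V.
have [u [v uv]] := sur 1.
have [p1 [q1 m11]] := sur (e1 * e1); have [r1 [s1 m12]] := sur (e1 * e2).
have [r2 [s2 m22]] := sur (e2 * e2).
rewrite -/phi in sur inj uniq uv m11 m12 m22.
have [a1 a2] : u * p1 + v * r1 = 1 /\ u * q1 + v * s1 = 0.
  apply: uniq; rewrite rmorph0 rmorph1 mul0r addr0 !rmorphD !rmorphM.
  transitivity (phi u * (e1 * e1) + phi v * (e1 * e2)); first by rewrite m11 m12; ring.
  by rewrite mul1r -[RHS]mulr1 uv; ring.
have [a3 a4] : u * r1 + v * r2 = 0 /\ u * s1 + v * s2 = 1.
  apply: uniq; rewrite rmorph0 rmorph1 mul0r add0r !rmorphD !rmorphM.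
  transitivity (phi u * (e1 * e2) + phi v * (e2 * e2)); first by rewrite m22 m12; ring.
  by rewrite mul1r -[RHS]mulr1 uv; ring.
(* [t1] and [t2] are half the traces of multiplication by [e1] and [e2], read off from the
   multiplication table. *)
have [t1 t1E] : exists t, t = h * (p1 + s1) by exists (h * (p1 + s1)).
have [t2 t2E] : exists t, t = h * (r1 + s2) by exists (h * (r1 + s2)).
have det : u * t1 + v * t2 = 1.
  rewrite -h1; transitivity (h * ((u * p1 + v * r1) + (u * s1 + v * s2))).
    by rewrite t1E t2E; ring.
  by rewrite a1 a4; ring.
(* The matrix from [(e1, e2)] to [(1, y)] has determinant [u * t1 + v * t2 = 1], and the trace of
   [y] is [- t2 * (2 t1) + t1 * (2 t2) = 0]. *)
pose y : OC (fi V) := - phi t2 * e1 + phi t1 * e2.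
have [affV _ _] := pV.
have e1y : e1 = phi t1 - phi v * y.
  rewrite -[phi t1]mulr1 uv /y; transitivity (phi (u * t1 + v * t2) * e1).
    by rewrite det rmorph1 mul1r.
  by rewrite rmorphD !rmorphM; ring.
have e2y : e2 = phi t2 + phi u * y.
  rewrite -[phi t2]mulr1 uv /y; transitivity (phi (u * t1 + v * t2) * e2).
    by rewrite det rmorph1 mul1r.
  by rewrite rmorphD !rmorphM; ring.
have [A AE] : exists A : OP V, A = - t2 * p1 + t1 * r1 by eexists.
have [B BE] : exists B : OP V, B = - t2 * q1 + t1 * s1 by eexists.
have [D DE] : exists D : OP V, D = - t2 * r1 + t1 * r2 by eexists.
have ye1 : y * e1 = phi A * e1 + phi B * e2.
  transitivity (- phi t2 * (e1 * e1) + phi t1 * (e1 * e2)); first by rewrite /y; ring.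
  by rewrite m11 m12 AE BE !rmorphD !rmorphM !rmorphN; ring.
have ye2 : y * e2 = phi D * e1 - phi A * e2.
  transitivity (- phi t2 * (e1 * e2) + phi t1 * (e2 * e2)); first by rewrite /y; ring.
  rewrite m12 m22; have tr0 : - A = - t2 * s1 + t1 * s2 by rewrite AE t1E t2E; ring.
  transitivity (phi D * e1 + phi (- A) * e2); last by rewrite rmorphN; ring.
  by rewrite tr0 DE !rmorphD !rmorphM !rmorphN; ring.
(* Cayley-Hamilton: the traceless matrix [((A, B), (D, -A))] squares to the scalar
   [A * A + B * D]. *)
exists V, y, (A * A + B * D); split=> //; last by move=> x /VUW[].
split=> //; first by exists w.
  transitivity (phi u * (y * (y * e1)) + phi v * (y * (y * e2))).
    by rewrite -[LHS]mulr1 uv; ring.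
  rewrite ye1 ye2.
  transitivity (phi u * (phi A * (y * e1) + phi B * (y * e2)) +
                phi v * (phi D * (y * e1) - phi A * (y * e2))); first by ring.
  rewrite ye1 ye2 -/phi -[RHS]mulr1 uv rmorphD !rmorphM; ring.
apply: regular_dbasis_affine => // [r|a b ab].
  have [a [b ->]] := sur r; exists (a * t1 + b * t2), (b * u - a * v).
  by rewrite {1}e1y {1}e2y -/phi rmorphB !rmorphD !rmorphM; ring.
have [b1 b2] : a * u - b * t2 = 0 /\ a * v + b * t1 = 0.
  apply: inj; transitivity (phi a * 1 + phi b * y); last by rewrite mulr1 -[RHS]ab.
  by rewrite uv /y rmorphB rmorphD !rmorphM; ring.
split.
  rewrite -[a]mulr1 -det.
  transitivity ((a * u - b * t2) * t1 + (a * v + b * t1) * t2); first by ring.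
  by rewrite b1 b2; ring.
rewrite -[b]mulr1 -det.
transitivity ((a * v + b * t1) * u - (a * u - b * t2) * v); first by ring.
by rewrite b1 b2; ring.
Qed.

(* y acts on the basis (e1, e2) by a traceless matrix. *)
Record good (M : modPresheaf OC) (V : opens P) (y : OC (fi V)) (e1 e2 : M (fi V))
    (a b c : OP V) : Prop := Good {
  good_basis : dbasis e1 e2;
  good_y1 : y *: e1 = fsh f V a *: e1 + fsh f V b *: e2;
  good_y2 : y *: e2 = fsh f V c *: e1 - fsh f V a *: e2 }.

Lemma matrix_of_pair2 (M : modPresheaf OC) (U V : opens P) (h : V `<=` U)
    (r : push_ring (mcont f) OC U) (e1 e2 : M (fi V)) (p q s t : OP V) :
  (rres OC (fiS h) r : OC (fi V)) *: e1 = fsh f V p *: e1 + fsh f V q *: e2 ->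
  (rres OC (fiS h) r : OC (fi V)) *: e2 = fsh f V s *: e1 + fsh f V t *: e2 ->
  matrix_of (M := direct_image f M) (mul_endo (comor f) (push f M) r) h
    (pair2 (e1 : direct_image f M V) e2)
    (\matrix_(i, j) pair2 (pair2 p q j) (pair2 s t j) i).
Proof.
move=> E1 E2 i; rewrite (eq_bigr (fun j =>
   pair2 (pair2 p q j) (pair2 s t j) i *: pair2 (e1 : direct_image f M V) e2 j)); last first.
  by move=> j _; rewrite mxE.
rewrite (@sum_pair2 _ (direct_image f M V) (fun j => pair2 (pair2 p q j) (pair2 s t j) i)).
rewrite /pair2 /=; case: ifP => _; [exact: E1|exact: E2].
Qed.

Lemma trace_pair2 (R : pzRingType) (p q s t : R) :
  \tr (\matrix_(i, j) pair2 (pair2 p q j) (pair2 s t j) i : 'M[R]_2) = p + t.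
Proof.
by rewrite /mxtrace big_ord_recl big_ord1 !mxE /pair2 /=.
Qed.

Lemma chart_trace (V : opens P) (y : OC (fi V)) F : chart y F ->
  trace (mul_endo (comor f) (push f (regular_presheaf OC)) (y : push_ring (mcont f) OC V)) = 0.
Proof.
case=> _ _ sq /dbasisP be; have idV : V `<=` V by [].
have m : matrix_of (M := direct_image f (regular_presheaf OC))
    (mul_endo (comor f) (push f (regular_presheaf OC)) (y : push_ring (mcont f) OC V)) idV
    (pair2 (1 : OC (fi V)) (y : OC (fi V)) : 'I_2 -> direct_image f (regular_presheaf OC) V)
    (\matrix_(i, j) pair2 (pair2 (0 : OP V) 1 j) (pair2 F 0 j) i).
  apply: (@matrix_of_pair2 (regular_presheaf OC)); rewrite rres_id rmorph0 ?rmorph1 scale0r.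
    by rewrite add0r scale1r; exact: mulr1.
  by rewrite addr0 -sq; exact/esym/mulr1.
by rewrite (traceE be m) trace_pair2 addr0.
Qed.

(** Once [y] is traceless on [M], a section [p + q y] has trace [2 p] both on [M] and on [O].
    Conversely, the trace condition for [y] alone compares its trace on [M] with the trace [0] on
    the basis [1, y]. *)
Lemma traceableP (M : sheafOfModules C) :
  traceable f M <-> quasi_coherent M /\ forall w : P, exists V (y : OC (fi V)) F
    (e1 e2 : M (fi V)) a b c, [/\ oset V w, chart y F & good y e1 e2 a b c].
Proof.
split=> [[qc lf tr]|[qc H]]; split=> //.
- move=> w; have [U [Uw [e be]]] := lf w; rewrite (pair2_eta e) in be.
  have [V [y [F [ch Vw VU]]]] := chart_exists Uw.
  have /dbasisP/(dbasis_res VU) be' := be.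
  pose e1 : M (fi V) := mres M (fiS VU) (e ord0).
  pose e2 : M (fi V) := mres M (fiS VU) (e ord_max).
  exists V, y, F; have bV : dbasis e1 e2 := be'.
  have [sur inj] := dbasis_top bV.
  have [a [b E1]] := sur (y *: e1); have [c [d E2]] := sur (y *: e2).
  exists e1, e2, a, b, c; split=> //; split=> //; rewrite E2.
  have idV : V `<=` V by [].
  have := @matrix_of_pair2 M V V idV y e1 e2 a b c d.
  rewrite rres_id => /(_ E1 E2) m.
  have /dbasisP bV' := bV.
  have := tr V y; rewrite (traceE bV' m) trace_pair2 (chart_trace ch) => /eqP.
  by rewrite addrC addr_eq0 => /eqP->; rewrite rmorphN scaleNr.
- move=> w; have [V [y [F [e1 [e2 [a [b [c [Vw ch [be _ _]]]]]]]]]] := H w.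
  exists V; split=> //; exists (pair2 (e1 : direct_image f M V) e2); exact/dbasisP.
- move=> U r; apply: trace_eq_local; first exact: OshP.
  move=> w Uw; have [V [y [F [e1 [e2 [a [b [c [Vw ch [be E1 E2]]]]]]]]]] := H w.
  have iU := @openIl _ U V; have iV := @openIr _ U V.
  set W := Defs.openI U V in iU iV.
  have [_ _ sq bo] := ch.
  have be' := dbasis_res iV be.
  have bo' := dbasis_res iV bo; rewrite /= rmorph1 in bo'.
  pose r' : OC (fi W) := rres OC (fiS iU) r.
  pose y' : OC (fi W) := rres OC (fiS iV) y; rewrite -/y' in bo'.
  have [p [q rE]] : exists p q, r' = fsh f W p + fsh f W q * y'.
    have [sur _] := dbasis_top bo'; have [p [q E]] := sur r'.
    by exists p, q; rewrite [LHS]E -[fsh f W p in RHS]mulr1.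
  pose res := rres OP iV; have resE s : fsh f W (res s) = rres OC (fiS iV) (fsh f V s).
    exact: fsh_res.
  pose u1 : M (fi W) := mres M (fiS iV) e1; pose u2 : M (fi W) := mres M (fiS iV) e2.
  exists W, iU, 2, (pair2 (u1 : direct_image f M W) u2), (\matrix_(i, j)
    pair2 (pair2 (p + q * res a) (q * res b) j) (pair2 (q * res c) (p - q * res a) j) i), 2,
    (pair2 (1 : OC (fi W)) (y' : OC (fi W)) : 'I_2 -> direct_image f (regular_presheaf OC) W),
    (\matrix_(i, j) pair2 (pair2 p q j) (pair2 (q * res F) p j) i).
  split; first by split.
  have F1 : y' *: u1 = fsh f W (res a) *: u1 + fsh f W (res b) *: u2.
    by rewrite !resE -!mresZ -mresD -E1.
  have F2 : y' *: u2 = fsh f W (res c) *: u1 - fsh f W (res a) *: u2.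
    by rewrite !resE -!mresZ -mresB -E2.
  split.
  + exact/dbasisP.
  + exact/dbasisP.
  + apply: matrix_of_pair2; rewrite -/r' rE scalerDl -scalerA.
      by rewrite F1 scalerDr !scalerA -!rmorphM addrA -scalerDl -rmorphD.
    rewrite F2 scalerBr !scalerA -!rmorphM addrC -addrA; congr (_ + _).
    by rewrite addrC -scalerBl -rmorphB.
  + apply: (@matrix_of_pair2 (regular_presheaf OC)); rewrite -/r' rE.
      by rewrite -[LHS]/((fsh f W p + fsh f W q * y') * 1) mulr1 -[fsh f W p in LHS]mulr1.
    rewrite -[LHS]/((fsh f W p + fsh f W q * y') * y').
    rewrite -[RHS]/(fsh f W (q * res F) * 1 + fsh f W p * y').
    have sq' : y' * y' = fsh f W (res F) by rewrite resE -sq rmorphM.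
    by rewrite rmorphM -sq'; ring.
  + by rewrite !trace_pair2; ring.
Qed.

End DoubleCover.

(** * Stalks and rank one *)

Section Germs.
Variables (X : topologicalType) (O : ringPresheaf X) (M : modPresheaf O) (x : X).

Lemma rgerm_add (U : opens X) (Ux : oset U x) (s t : O U) :
  rgerm Ux s + rgerm Ux t = rgerm Ux (s + t).
Proof. exact: rgermD. Qed.

Lemma rgerm_opp (U : opens X) (Ux : oset U x) (s : O U) :
  - rgerm Ux s = rgerm Ux (- s).
Proof. exact: rgermN. Qed.

Lemma rgerm_mul (U : opens X) (Ux : oset U x) (s t : O U) :
  rgerm Ux s * rgerm Ux t = rgerm Ux (s * t).
Proof. exact: rgermM. Qed.

Lemma rgerm_one (U : opens X) (Ux : oset U x) : rgerm Ux (1 : O U) = 1.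
Proof. exact/esym/rgerm1. Qed.

Lemma mgerm_add (U : opens X) (Ux : oset U x) (s t : M U) :
  mgerm Ux s + mgerm Ux t = mgerm Ux (s + t).
Proof. exact: mgermD. Qed.

Lemma mgerm_scale (U : opens X) (Ux : oset U x) (a : O U) (m : M U) :
  rgerm Ux a *: mgerm Ux m = mgerm Ux (a *: m).
Proof. exact: mgermZ. Qed.

Lemma mgerm_zero (U : opens X) (Ux : oset U x) : mgerm Ux (0 : M U) = 0.
Proof. exact/esym/mgerm0. Qed.

Lemma rgerm_invertible (U V : opens X) (h : V `<=` U) (Ux : oset U x) (s : O U) :
  oset V x -> invertible (rres O h s) -> invertible (rgerm Ux s).
Proof.
move=> Vx [t ts]; exists (rgerm Vx t).
by rewrite -(rgerm_res h Ux Vx) rgerm_mul ts rgerm_one.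
Qed.

Lemma rgerm_eq (U V : opens X) (Ux : oset U x) (Vx : oset V x) (s : O U) (t : O V) :
  rgerm Ux s = rgerm Vx t -> exists (W : opens X) (h : W `<=` U) (k : W `<=` V),
    oset W x /\ rres O h s = rres O k t.
Proof. by move/(@germ_eqP X x (set_of_ring O)). Qed.

Lemma mgerm_eq (U V : opens X) (Ux : oset U x) (Vx : oset V x) (s : M U) (t : M V) :
  mgerm Ux s = mgerm Vx t -> exists (W : opens X) (h : W `<=` U) (k : W `<=` V),
    oset W x /\ mres M h s = mres M k t.
Proof. by move/(@germ_eqP X x (set_of_mod M)). Qed.

Lemma ring_stalkP (p : ring_stalk O x) :
  exists (U : opens X) (Ux : oset U x) s, p = rgerm Ux s.
Proof. exact: (@stalkP X x (set_of_ring O) p). Qed.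

Lemma mod_stalkP (p : mod_stalk x M) :
  exists (U : opens X) (Ux : oset U x) s, p = mgerm Ux s.
Proof. exact: (@stalkP X x (set_of_mod M) p). Qed.

Lemma ring_stalk2P (p q : ring_stalk O x) :
  exists (U : opens X) (Ux : oset U x) s t, p = rgerm Ux s /\ q = rgerm Ux t.
Proof. exact: (@stalk2P X x (set_of_ring O) (set_of_ring O) p q). Qed.

Lemma ring_mod_stalkP (p : ring_stalk O x) (q : mod_stalk x M) :
  exists (U : opens X) (Ux : oset U x) s t, p = rgerm Ux s /\ q = mgerm Ux t.
Proof. exact: (@stalk2P X x (set_of_ring O) (set_of_mod M) p q). Qed.

End Germs.

Section Specialization.
Variables (X : topologicalType) (O : ringPresheaf X) (M : modPresheaf O) (x eta : X).
Hypothesis etaP : forall W : opens X, oset W x -> oset W eta.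

(** Every open around [x] contains [eta], so a germ at [x] has a germ at [eta]. For the sheaf
    [f_* O] this map turns out to be the total quotient ring of the stalk, and [mspec] serves as the
    base change. *)
Definition rspec (p : ring_stalk O x) : ring_stalk O eta :=
  rgerm (etaP (gdomP (repr p))) (gval (repr p)).

Definition mspec (p : mod_stalk x M) : mod_stalk eta M :=
  mgerm (etaP (gdomP (repr p))) (gval (repr p)).

Lemma rspecE (U : opens X) (Ux : oset U x) (Ue : oset U eta) (s : O U) :
  rspec (rgerm Ux s) = rgerm Ue s.
Proof.
rewrite /rspec; set g := repr _.
have : rgerm (gdomP g) (gval g) = rgerm Ux s.
  by rewrite -[RHS]reprK -/g /rgerm /germ; congr (\pi _)%qT; case: (g).
move=> /rgerm_eq[W [h [k [Wx e]]]]; have We := etaP Wx.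
by rewrite -(rgerm_res h _ We) e rgerm_res.
Qed.

Lemma mspecE (U : opens X) (Ux : oset U x) (Ue : oset U eta) (s : M U) :
  mspec (mgerm Ux s) = mgerm Ue s.
Proof.
rewrite /mspec; set g := repr _.
have : mgerm (gdomP g) (gval g) = mgerm Ux s.
  by rewrite -[RHS]reprK -/g /mgerm /germ; congr (\pi _)%qT; case: (g).
move=> /mgerm_eq[W [h [k [Wx e]]]]; have We := etaP Wx.
by rewrite -(mgerm_res h _ We) e mgerm_res.
Qed.

Fact rspec_zmod : GRing.zmod_morphism rspec.
Proof.
move=> p q; have [U [Ux [s [t [-> ->]]]]] := ring_stalk2P p q.
by rewrite rgerm_opp rgerm_add !(rspecE _ (etaP Ux)) rgerm_opp rgerm_add.
Qed.

Fact rspec_monoid : GRing.monoid_morphism rspec.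
Proof.
have Xx : oset (Defs.openT X) x by [].
split=> [|p q]; first by rewrite -(rgerm_one _ Xx) (rspecE _ (etaP Xx)) rgerm_one.
have [U [Ux [s [t [-> ->]]]]] := ring_stalk2P p q.
by rewrite rgerm_mul !(rspecE _ (etaP Ux)) rgerm_mul.
Qed.

HB.instance Definition _ := GRing.isZmodMorphism.Build _ _ rspec rspec_zmod.
HB.instance Definition _ := GRing.isMonoidMorphism.Build _ _ rspec rspec_monoid.

Lemma mspec_semilinear a (m n : mod_stalk x M) :
  mspec (a *: m + n) = rspec a *: mspec m + mspec n.
Proof.
have [U [Ux [s [t [-> ->]]]]] := ring_mod_stalkP a m.
have [V [Vx [u ->]]] := mod_stalkP n.
have hU := @openIl _ U V; have hV := @openIr _ U V.
have Wx : oset (Defs.openI U V) x by [].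
rewrite -(rgerm_res hU Ux Wx) -(mgerm_res hU Ux Wx) -(mgerm_res hV Vx Wx).
by rewrite mgerm_scale mgerm_add !(mspecE _ (etaP Wx)) (rspecE _ (etaP Wx)) mgerm_scale mgerm_add.
Qed.

End Specialization.

Section RankOne.
Variables (R : comPzRingType) (M : lmodType R).

(* R is its own total quotient ring, so M itself is the base change. *)
Lemma nonzerodivisor_invertible_rank1 :
  (forall r : R, ~ zero_divisor r -> invertible r) -> module_rank1 M ->
  exists v : M, (forall m, exists r, m = r *: v) /\ (forall r, r *: v = 0 -> r = 0).
Proof.
move=> inv [Q [iota [[_ frac ker] [N [h [[hL huniv] [i [i' iK Ki]]]]]]]].
have injI a : iota a = 0 -> a = 0.
  by move=> /ker[s [/inv si sa]]; apply: (invertible_mulI si); rewrite sa mulr0.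
have surI q : exists a, iota a = q.
  have [a [s [/inv[t ts] e]]] := frac q; exists (t * a).
  by rewrite rmorphM -e mulrA -rmorphM ts rmorph1 mul1r.
pose j q := sval (cid (surI q)).
have jP q : iota (j q) = q by exact: (svalP (cid (surI q))).
have uniqI a b : iota a = iota b -> a = b.
  move=> e; apply/eqP; rewrite -subr_eq0; apply/eqP/injI.
  by rewrite rmorphB e subrr.
have jZ : GRing.zmod_morphism j.
  by move=> a b; apply: uniqI; rewrite rmorphB !jP.
have jM : GRing.monoid_morphism j.
  by split=> [|a b]; apply: uniqI; rewrite ?rmorph1 ?rmorphM !jP.
pose jz := GRing.isZmodMorphism.Build _ _ j jZ.
pose jm := GRing.isMonoidMorphism.Build _ _ j jM.
pose J : {rmorphism Q -> R} := HB.pack j jz jm.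
have JP q : iota (J q) = q := jP q.
(* Through [J] the module [M] is itself a [Q]-module, hence a target of the universal property: the
   identity of [M] factors as [k \o h]. *)
have [|k [[kL kh] _]] := huniv (restrict_scalars J M : lmodType Q) (fun m => m).
  by move=> a m n; rewrite {1}(_ : a = J (iota a)) //; apply: uniqI; rewrite JP.
(* Both [h \o k] and the identity factor [h] through itself, so uniqueness identifies them. *)
have hk n : h (k n) = n.
  have [k' [_ k'u]] := huniv N h hL.
  have /(_ id) := k'u; have := k'u (h \o k) => /=.
  move=> E1 E2; rewrite -[RHS]/(id n) -E2; last by split=> // a x y.
  rewrite E1 //; split=> [a x y|m /=]; last by rewrite kh.
  rewrite /= kL; transitivity (iota (J a) *: h (k x) + h (k y)); [exact: hL|by rewrite JP].
have h0 : h 0 = 0.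
  by have := hL (-1) 0 0; rewrite scaler0 addr0 rmorphN rmorph1 scaleN1r addNr.
have hZ a m : h (a *: m) = iota a *: h m by rewrite -[a *: m]addr0 hL h0 addr0.
exists (k (i' 1)); split=> [m|r].
  exists (J (i (h m))); rewrite -[LHS]kh -[RHS]kh hZ hk JP; congr k.
  by apply: (can_inj iK); rewrite linearZ /= Ki -[RHS]/(i (h m) * 1) mulr1.
move/(congr1 h); rewrite hZ hk h0 => /(congr1 i); rewrite linearZ linear0 /= Ki.
by rewrite -[LHS]/(iota r * 1) mulr1; exact: injI.
Qed.

(** [N] is free on [h v], so a semilinear [g] can only extend by sending [q *: h v] to [q *: g v].
    This extension agrees with [g] on all of [M] because [s *: m = r *: v] with [s] invertible in
    [Q]. *)
Lemma rank1_of_fraction_basis (Q : comPzRingType) (iota : {rmorphism R -> Q})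
    (N : lmodType Q) (h : M -> N) (v : M) :
  total_quotient_ring iota ->
  (forall a m n, h (a *: m + n) = iota a *: h m + h n) ->
  (forall n, exists q, n = q *: h v) -> (forall q, q *: h v = 0 -> q = 0) ->
  (forall m, exists s r, ~ zero_divisor s /\ s *: m = r *: v) ->
  module_rank1 M.
Proof.
move=> tq hL sur inj gen; exists Q, iota; split=> //.
have h0 : h 0 = 0.
  by have := hL (-1) 0 0; rewrite scaler0 addr0 rmorphN rmorph1 scaleN1r addNr.
have hZ a m : h (a *: m) = iota a *: h m by rewrite -[a *: m]addr0 hL h0 addr0.
pose i n := sval (cid (sur n)).
have iP n : i n *: h v = n by exact/esym/(svalP (cid (sur n))).
have uniq p q : p *: h v = q *: h v -> p = q.
  by move/eqP; rewrite -subr_eq0 -scalerBl => /eqP/inj/eqP; rewrite subr_eq0 => /eqP.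
exists N, h; split; last first.
  have iL : linear (i : N -> Q^o).
    move=> a x y; suff : i (a *: x + y) = a * i x + i y by [].
    by apply: uniq; rewrite scalerDl -scalerA !iP.
  pose ia := GRing.isLinear.Build _ _ _ _ (i : N -> Q^o) iL.
  pose I : {linear N -> Q^o} := HB.pack (i : N -> Q^o) ia.
  exists I; exists (fun q : Q => q *: h v) => [n|q]; first exact: iP.
  by apply: uniq; rewrite [LHS]iP.
split=> // T g gL.
have g0 : g 0 = 0.
  by have := gL (-1) 0 0; rewrite scaler0 addr0 rmorphN rmorph1 scaleN1r addNr.
have gZ a m : g (a *: m) = iota a *: g m by rewrite -[a *: m]addr0 gL g0 addr0.
exists (fun n => i n *: g v); split; first split.
- move=> a x y; rewrite scalerA -scalerDl; congr (_ *: _); apply: uniq.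
  by rewrite iP scalerDl -scalerA !iP.
- move=> m; have [s [r [sn e]]] := gen m.
  have [inv _ _] := tq; have is1 := inv s sn.
  apply: (invertible_scaleI is1) => /=; rewrite -gZ e gZ scalerA; congr (_ *: _).
  by apply: uniq; rewrite -scalerA iP -!hZ e.
- move=> k [kL kh]; apply/funext => n.
  have k0 : k 0 = 0 by have := kL (-1) 0 0; rewrite scaler0 addr0 scaleN1r addNr.
  have kZ a m : k (a *: m) = a *: k m by rewrite -[a *: m]addr0 kL k0 addr0.
  by rewrite -[in RHS](iP n) kZ kh.
Qed.

End RankOne.

(** * Traceable modules on a chart *)

Section CoverStalks.
Variables (X Y : scheme) (f : schemeMorphism X Y).
Local Notation OX := (Osh X).
Local Notation OY := (Osh Y).
Local Notation fi V := (opre (mcont f) V).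
Local Notation PR := (push_ring (mcont f) OX).

Variables (V : opens Y) (w : Y) (Vw : oset V w).
Hypothesis affV : affine OY V.

Definition rg (r : OX (fi V)) : ring_stalk PR w := @rgerm Y PR w V Vw r.

Fact rg_zmod : GRing.zmod_morphism rg.
Proof. by move=> r s; rewrite /rg rgerm_opp rgerm_add. Qed.

Fact rg_monoid : GRing.monoid_morphism rg.
Proof. by split=> [|r s]; [exact: rgerm_one|rewrite /rg rgerm_mul]. Qed.

HB.instance Definition _ := GRing.isZmodMorphism.Build _ _ rg rg_zmod.
HB.instance Definition _ := GRing.isMonoidMorphism.Build _ _ rg rg_monoid.

Lemma rg_unit (g : OY V) : unit_at g w -> invertible (rg (fsh f V g)).
Proof.
move=> [W [h [Ww inv]]].
apply: (@rgerm_invertible Y PR w V W h Vw (fsh f V g) Ww).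
rewrite -[rres _ _ _]/(rres OX (fiS h) (fsh f V g)) -(fsh_res h (fiS h)).
exact: invertible_morph.
Qed.

Section Module.
Variable M : modPresheaf OX.
Hypothesis loc : basic_loc M (fi V).

Definition mg (m : M (fi V)) : mod_stalk w (push f M) := @mgerm Y PR w (push f M) V Vw m.

Lemma mgZ r m : mg (r *: m) = rg r *: mg m.
Proof. by rewrite /mg /rg (mgerm_scale (M := push f M)). Qed.

Lemma mgD m n : mg (m + n) = mg m + mg n.
Proof. by rewrite /mg (mgerm_add (M := push f M)). Qed.

Lemma mg0 : mg 0 = 0.
Proof. exact: (mgerm_zero (push f M)). Qed.

Lemma mgB m n : mg (m - n) = mg m - mg n.
Proof. by rewrite -scaleN1r mgD mgZ rmorphN rmorph1 scaleN1r. Qed.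

(** Denominators can be taken from [O_Y]: the stalk is that of a direct image at [w], and the opens
    [basic_open g] of the base already shrink to [w]. *)
Lemma mod_stalk_frac (p : mod_stalk w (push f M)) :
  exists g m, unit_at g w /\ rg (fsh f V g) *: p = mg m.
Proof.
have [U [Uw [s ->]]] := mod_stalkP p.
have [g [ug gU]] := affine_base affV Vw Uw.
have h : basic_open g `<=` V := @basic_openS Y OY V g.
have [sur _] := direct_image_loc loc h (erefl _).
have [m [k e]] := sur (mres (push f M) gU s); exists (g ^+ k), m.
split; first exact: unit_atX.
have Dw : oset (basic_open g) w by [].
rewrite /rg /mg -(rgerm_res (O := PR) h Vw Dw) -(mgerm_res (M := push f M) gU Uw Dw).
rewrite (mgerm_scale (M := push f M)) -(mgerm_res (M := push f M) h Vw Dw); congr (mgerm _ _).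
by rewrite -[RHS]e -[rres PR h _]/(rres OX (fiS h) (fsh f V (g ^+ k))) -(fsh_res h (fiS h)).
Qed.

Lemma mg_eq0 (m : M (fi V)) : mg m = 0 -> exists2 g, unit_at g w & fsh f V g *: m = 0.
Proof.
rewrite -mg0 => /(mgerm_eq (M := push f M))[W [h [k [Ww e]]]].
have [g [ug gW]] := affine_base affV Vw Ww.
have l : basic_open g `<=` V := @basic_openS Y OY V g.
have [_ inj] := direct_image_loc loc l (erefl _).
have [|j ej] := inj m; last by exists (g ^+ j); [exact: unit_atX|].
rewrite -[LHS]/(mres (push f M) l m) -(mres_comp h gW l) e mres0.
exact: mres0.
Qed.

End Module.

Lemma ring_stalk_frac (hX : affine OX (fi V)) (p : ring_stalk PR w) :
  exists g r, unit_at g w /\ rg (fsh f V g) * p = rg r.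
Proof.
have [U [Uw [s ->]]] := ring_stalkP p.
have loc : basic_loc (regular_presheaf OX) (fi V) by move=> t W h; exact: affine_is_loc.
have [g [ug gU]] := affine_base affV Vw Uw.
have h : basic_open g `<=` V := @basic_openS Y OY V g.
have [sur _] := direct_image_loc loc h (erefl _).
have [m [k e]] := sur (rres PR gU s); exists (g ^+ k), m.
split; first exact: unit_atX.
have Dw : oset (basic_open g) w by [].
rewrite /rg -(rgerm_res (O := PR) h Vw Dw) -(rgerm_res (O := PR) gU Uw Dw).
rewrite rgerm_mul -(rgerm_res (O := PR) h Vw Dw); congr (rgerm _ _).
by rewrite -[RHS]e -[rres PR h _]/(rres OX (fiS h) (fsh f V (g ^+ k))) -(fsh_res h (fiS h)).
Qed.

Lemma rg_eq0 (hX : affine OX (fi V)) (r : OX (fi V)) : rg r = 0 ->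
  exists2 g, unit_at g w & fsh f V g * r = 0.
Proof.
have loc : basic_loc (regular_presheaf OX) (fi V) by move=> t W h; exact: affine_is_loc.
rewrite -(rmorph0 rg) => /(rgerm_eq (O := PR))[W [h [k [Ww e]]]].
have [g [ug gW]] := affine_base affV Vw Ww.
have l : basic_open g `<=` V := @basic_openS Y OY V g.
have [_ inj] := direct_image_loc loc l (erefl _).
have [|j ej] := inj r; last by exists (g ^+ j); [exact: unit_atX|].
by rewrite -[LHS]/(rres PR l r) -(rres_comp h gW l) e !rmorph0.
Qed.

End CoverStalks.

Section GoodModules.
Variables (K : fieldType) (P : projectiveLine K) (C : scheme) (f : schemeMorphism C P).
Hypothesis hf : double_cover f.
Local Notation OC := (Osh C).
Local Notation OP := (Osh P).
Local Notation fi V := (opre (mcont f) V).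
Local Notation PR := (push_ring (mcont f) OC).

Section Chart.
Variables (V : opens P) (y : OC (fi V)) (F : OP V).
Hypothesis ch : chart y F.
Local Notation phi := (fsh f V).

Let affV : affine OP V. Proof. by case: ch => -[]. Qed.
Let affC : affine OC (fi V). Proof. exact: fi_affine. Qed.
Let dom : integral_ring (OP V). Proof. by case: ch => -[]. Qed.

(** [r'] is the conjugate of [r] and [nu] its norm. When [nu = 0] and [r] is nonzero, the conjugate
    witnesses that [r] is a zero divisor. *)
Lemma chart_norm (r : OC (fi V)) :
  exists r' nu, r * r' = phi nu /\ (r' = 0 -> r = 0).
Proof.
have [sur inj] := chart_top ch; have [a [b ->]] := sur r; have sq := chart_sq ch.
exists (phi a - phi b * y), (a * a - b * b * F); split.
  by rewrite rmorphB !rmorphM -sq; ring.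
rewrite -mulNr -rmorphN => /inj[-> /eqP]; rewrite oppr_eq0 => /eqP->.
by rewrite rmorph0 mul0r addr0.
Qed.

Lemma chart_cancel g r : phi g * r = 0 -> g = 0 \/ r = 0.
Proof.
have [sur inj] := chart_top ch; have [a [b ->]] := sur r.
rewrite mulrDr mulrA -!rmorphM => /inj[/dom.2[-> _|->]]; first by left.
by move/dom.2 => [->|->]; [left|right]; rewrite // !rmorph0 mul0r addr0.
Qed.

Lemma chart_phi0 g : phi g = 0 -> g = 0.
Proof.
move=> g0; have [_ inj] := chart_top ch.
by have [] := inj g 0; first by rewrite g0 rmorph0 mul0r addr0.
Qed.

Lemma unit_at_neq0 (g : OP V) w : unit_at g w -> g <> 0.
Proof. by move=> u g0; rewrite g0 in u; exact: (@unit_at0 _ _ _ affV _ u). Qed.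

Lemma rg_inj w (Vw : oset V w) : injective (rg (f := f) Vw).
Proof.
move=> r s /eqP; rewrite -subr_eq0 -rmorphB => /eqP/(rg_eq0 affV affC)[g ug].
by move/chart_cancel => [/(unit_at_neq0 ug)//|/eqP]; rewrite subr_eq0 => /eqP.
Qed.

Lemma rg_eq0_inj w (Vw : oset V w) r : rg (f := f) Vw r = 0 -> r = 0.
Proof. by rewrite -(rmorph0 (rg Vw)) => /rg_inj. Qed.

Lemma rg_nonzerodivisor w (Vw : oset V w) (g : OP V) : g <> 0 ->
  ~ zero_divisor (rg (f := f) Vw (phi g)).
Proof.
move=> g0 [t /eqP t0 tg]; apply: t0.
have [h [r [uh e]]] := ring_stalk_frac Vw affV affC t.
have invh := rg_unit f Vw uh; apply: (invertible_mulI invh); rewrite mulr0 e.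
have : rg Vw (r * phi g) = 0 by rewrite rmorphM /= -e -mulrA tg mulr0.
by move/rg_eq0_inj; rewrite mulrC => /chart_cancel[//|->]; rewrite rmorph0.
Qed.

Variable M : sheafOfModules C.
Hypothesis qc : quasi_coherent M.

Let loc : basic_loc M (fi V). Proof. exact: (quasi_coherentP M).1. Qed.

Section Good.
Variables (e1 e2 : M (fi V)) (a b c : OP V).
Hypothesis gd : good y e1 e2 a b c.

Lemma good_cancel g (m : M (fi V)) : phi g *: m = 0 -> g = 0 \/ m = 0.
Proof.
have [sur inj] := dbasis_top (good_basis gd); have [p [q ->]] := sur m.
rewrite scalerDr !scalerA -!rmorphM => /inj[/dom.2[-> _|->]]; first by left.
by move/dom.2 => [->|->]; [left|right]; rewrite // !rmorph0 !scale0r addr0.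
Qed.

(** Apply [y * y = F] to [e1] and compare the coefficients of [e1]; that of [e2] is [a b - b a]. *)
Lemma good_square : F = a * a + b * c.
Proof.
have [_ inj] := dbasis_top (good_basis gd); apply/eqP; rewrite -subr_eq0; apply/eqP.
suff [] : F - (a * a + b * c) = 0 /\ (0 : OP V) = 0 by [].
apply: inj; rewrite rmorph0 scale0r addr0 rmorphB scalerBl -(chart_sq ch) -scalerA.
rewrite (good_y1 gd) scalerDr !scalerA ![y * _]mulrC -!scalerA (good_y1 gd) (good_y2 gd).
rewrite scalerDr scalerBr !scalerA -!rmorphM addrACA [b * a]mulrC subrr addr0.
by rewrite -scalerDl -rmorphD subrr.
Qed.

Lemma mg_inj0 w (Vw : oset V w) (m : M (fi V)) : mg (f := f) Vw m = 0 -> m = 0.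
Proof. by move=> /(mg_eq0 affV loc)[g ug /good_cancel[/(unit_at_neq0 ug)|]]. Qed.

(** After clearing denominators, [s *: m = 0] implies that the norm [nu] of [s] kills [m]. Since
    [f_* M] is free over a domain, [m <> 0] forces [nu = 0], and then [s] is zero or killed by its
    nonzero conjugate. *)
Lemma good_torsion_free w (Vw : oset V w) : module_torsion_free (mod_stalk w (push f M)).
Proof.
move=> p p0 r rp.
have [g [m [ug em]]] := mod_stalk_frac Vw affV loc p.
have [h [s [uh es]]] := ring_stalk_frac Vw affV affC r.
have ig := rg_unit f Vw ug; have ih := rg_unit f Vw uh.
have [s' [nu [ns ss]]] := chart_norm s.
have /mg_inj0 sm : mg (f := f) Vw (s *: m) = 0.
  by rewrite mgZ -em -es scalerA mulrAC -scalerA rp scaler0.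
have : phi nu *: m = 0 by rewrite -ns mulrC -scalerA sm scaler0.
move/good_cancel => [nu0|m0]; last first.
  case/eqP: p0; apply: (invertible_scaleI ig); rewrite /= scaler0 em m0; exact: mg0.
case: (pselect (s = 0)) => [s0|sn0].
  by left; apply: (invertible_mulI ih); rewrite mulr0 es s0 rmorph0.
right; exists (rg Vw s'); first by apply/eqP => /rg_eq0_inj/ss.
apply: (invertible_mulI ih); rewrite mulr0 mulrCA es -rmorphM mulrC ns nu0.
by rewrite !rmorph0.
Qed.

(** Cramer's rule for [(v, y v)], with [q] in the role of the determinant. The factor [q] is kept in
    both clauses: it is made nonzero to obtain rank 1, and a unit at a point to obtain a line
    bundle. *)
Definition cyclic_vector (v : M (fi V)) (q : OP V) :=
  (forall s t, phi s *: v + phi t *: (y *: v) = 0 -> q * s = 0 /\ q * t = 0) /\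
  (forall m, exists s t, phi q *: m = phi s *: v + phi t *: (y *: v)).

(* The second argument is det (v, y v), a quadratic form in the coordinates (l, m)
   of v. As 2 is invertible, it vanishes at (1, 0), (0, 1) and (1, 1) only if
   a = b = c = 0. *)
Lemma good_cyclic_vector (l m : OP V) :
  cyclic_vector (phi l *: e1 + phi m *: e2) (l * (l * b - m * a) - m * (l * a + m * c)).
Proof.
have [sur inj] := dbasis_top (good_basis gd).
set v := _ + _; set q := l * (l * b - m * a) - _.
have yv : y *: v = phi (l * a + m * c) *: e1 + phi (l * b - m * a) *: e2.
  rewrite /v scalerDr !scalerA ![y * _]mulrC -!scalerA (good_y1 gd) (good_y2 gd).
  rewrite scalerDr scalerBr !scalerA -!rmorphM addrACA -scalerDl -scalerBl.
  by rewrite -rmorphD -rmorphB.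
have comb s t : phi s *: v + phi t *: (y *: v) =
    phi (s * l + t * (l * a + m * c)) *: e1 + phi (s * m + t * (l * b - m * a)) *: e2.
  rewrite yv /v !scalerDr !scalerA -!rmorphM addrACA -!scalerDl -!rmorphD.
  by [].
split=> [s t|n].
  rewrite comb => /inj[E1 E2]; split.
    transitivity ((s * l + t * (l * a + m * c)) * (l * b - m * a) -
      (s * m + t * (l * b - m * a)) * (l * a + m * c)); first by rewrite /q; ring.
    by rewrite E1 E2 !mul0r subrr.
  transitivity ((s * m + t * (l * b - m * a)) * l - (s * l + t * (l * a + m * c)) * m).
    by rewrite /q; ring.
  by rewrite E1 E2 !mul0r subrr.
have [p [r ->]] := sur n.
(* The adjugate of the matrix of [(v, y v)], applied to the coordinates [(p, r)] of [n]. *)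
exists (p * (l * b - m * a) - r * (l * a + m * c)), (r * l - p * m).
rewrite comb scalerDr !scalerA -!rmorphM; congr (phi _ *: _ + phi _ *: _); rewrite /q; ring.
Qed.

End Good.
End Chart.
End GoodModules.

Section TraceableModules.
Variables (K : fieldType) (P : projectiveLine K) (C : scheme) (f : schemeMorphism C P).
Hypothesis hK : 2%N \notin [pchar K].
Hypothesis hf : double_cover f.
Local Notation OC := (Osh C).
Local Notation OP := (Osh P).
Local Notation fi V := (opre (mcont f) V).
Local Notation PR := (push_ring (mcont f) OC).

Lemma traceable_torsion_free (M : sheafOfModules C) : traceable f M -> torsion_free f M.
Proof.
move=> /(traceableP hK hf)[qc H] w.
have [V [y [F [e1 [e2 [a [b [c [Vw ch gd]]]]]]]]] := H w.
exact: (good_torsion_free hf ch qc gd Vw).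
Qed.

Variable eta : P.
Hypothesis etaP : forall (W : opens P) w, oset W w -> oset W eta.

Lemma unit_at_eta (V : opens P) (g : OP V) : pid_open OP V -> g <> 0 -> unit_at g eta.
Proof.
move=> [affV iV _] g0; have [eta' _ [ueta _]] := generic_point_affine affV iV.
exact: (etaP (W := basic_open g) (ueta g g0)).
Qed.

(** A nonzerodivisor has nonzero norm, since otherwise its conjugate would kill it, and a nonzero
    norm is a unit at [eta]. Conversely, elements at [eta] have denominators from the base, which
    are nonzerodivisors at [w]. *)
Lemma chart_total_quotient (V : opens P) (y : OC (fi V)) F w (Vw : oset V w) :
  chart y F -> total_quotient_ring (rspec (O := PR) (fun W Ww => etaP (W := W) (w := w) Ww)).
Proof.
move=> ch; have Ve := etaP Vw; have [pV _ _ _] := ch; have [affV iV _] := pV.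
have affC := fi_affine hf affV.
have specE r : rspec (O := PR) (fun W Ww => etaP (W := W) (w := w) Ww) (rg Vw r) = rg Ve r.
  exact: (rspecE (O := PR)).
split.
- move=> s sn; have [h [r [uh es]]] := ring_stalk_frac Vw affV affC s.
  have ih := rg_unit f Vw uh.
  have [r' [nu [rr r'0]]] := chart_norm ch r.
  have nu0 : nu <> 0.
    (* If the conjugate vanishes then [s] itself is zero, and the nonzero element [1] annihilates
       it. *)
    move=> nu0; apply: sn; case: (pselect (r' = 0)) => [/r'0 r0|r'n0].
      exists 1.
        apply/eqP; rewrite -(rmorph1 (rg Vw)) => /(rg_eq0_inj hf ch) one0.
        have [_ inj] := chart_top ch; have [|] := inj 1 0; last by case: iV.
        by rewrite rmorph1 rmorph0 mul0r addr0.
      by apply: (invertible_mulI ih); rewrite mulr0 mul1r es r0 rmorph0.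
    exists (rg Vw r'); first by apply/eqP => /(rg_eq0_inj hf ch).
    by apply: (invertible_mulI ih); rewrite mulr0 mulrCA es -rmorphM mulrC rr nu0 !rmorph0.
  have inu := rg_unit f Ve (unit_at_eta pV nu0).
  move: inu; rewrite -rr rmorphM /= -specE -es rmorphM => /invertible_mull.
  by rewrite mulrC => /invertible_mull.
- move=> q; have [g [r [ug e]]] := ring_stalk_frac Ve affV affC q.
  exists (rg Vw r), (rg Vw (fsh f V g)); rewrite /= !specE; split=> //.
  apply: (rg_nonzerodivisor hf ch); exact: (unit_at_neq0 ch ug).
- move=> p p0; have [g [r [ug e]]] := ring_stalk_frac Vw affV affC p.
  exists 1; split; first by move=> [t /eqP t0]; rewrite mulr1.
  rewrite mul1r; apply: (invertible_mulI (rg_unit f Vw ug)); rewrite mulr0 e.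
  have : rg Ve r = 0 by rewrite -specE -e rmorphM p0 mulr0.
  by move/(rg_eq0_inj hf ch)->; rewrite rmorph0.
Qed.

Lemma good_rank1 (M : sheafOfModules C) (V : opens P) (y : OC (fi V)) F
    (e1 e2 : M (fi V)) a b c w (Vw : oset V w) :
  quasi_coherent M -> chart y F -> good y e1 e2 a b c ->
  ~ (a = 0 /\ b = 0 /\ c = 0) -> module_rank1 (mod_stalk w (push f M)).
Proof.
move=> qc ch gd abc; have Ve := etaP Vw; have [pV _ _ _] := ch; have [affV iV _] := pV.
have affC := fi_affine hf affV.
have loc : basic_loc M (fi V) by exact: (quasi_coherentP M).1.
have [v [q [q0 cv]]] : exists (v : M (fi V)) (q : OP V), q <> 0 /\ cyclic_vector y v q.
  (* The determinants at [(1, 0)], [(0, 1)] and [(1, 1)] are [b], [- c] and [b - 2 a - c]. *)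
  case: (pselect (b = 0)) => [b0|bn0]; last first.
    have cv := good_cyclic_vector gd 1 0.
    eexists; eexists; split; last exact: cv.
    by move=> E; apply: bn0; rewrite -E; ring.
  case: (pselect (c = 0)) => [c0|cn0]; last first.
    have cv := good_cyclic_vector gd 0 1.
    eexists; eexists; split; last exact: cv.
    by move=> E; apply: cn0; rewrite -[c]opprK -[RHS]oppr0 -E; ring.
  have cv := good_cyclic_vector gd 1 1.
  eexists; eexists; split; last exact: cv.
  move=> E; apply: abc; split=> //; have [h h2] := half_exists hK V.
  rewrite -[a]mul1r -h2; transitivity (- h * (1 * (1 * b - 1 * a) - 1 * (1 * a + 1 * c))).
    by rewrite b0 c0; ring.
  by rewrite E mulr0.
have [cv1 cv2] := cv.
have gen n : exists r, fsh f V q *: n = r *: v.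
  have [s [t e]] := cv2 n; exists (fsh f V s + fsh f V t * y).
  by rewrite e scalerDl scalerA.
have ann r : r *: v = 0 -> r = 0.
  have [sur _] := chart_top ch; have [s [t ->]] := sur r.
  rewrite scalerDl -scalerA => /cv1[qs qt].
  have [_ dom] := iV; case: (dom _ _ qs) => // ->; case: (dom _ _ qt) => // ->.
  by rewrite !rmorph0 mul0r addr0.
pose h := mspec (M := push f M) (fun W Ww => etaP (W := W) (w := w) Ww).
have hE m : h (mg Vw m) = mg Ve m by exact: (mspecE (M := push f M)).
apply: (rank1_of_fraction_basis (h := h) (v := mg Vw v) (chart_total_quotient Vw ch)).
- exact: mspec_semilinear.
- move=> n; have [g [m [ug e]]] := mod_stalk_frac Ve affV loc n.
  have [r er] := gen m; have := rg_unit f Ve (unit_at_eta pV q0).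
  move=> /invertibleM/(_ (rg_unit f Ve ug))[t et].
  exists (t * rg Ve r); rewrite hE -scalerA -mgZ -er mgZ -e.
  by rewrite [rg Ve (fsh f V q) *: _]scalerA scalerA et scale1r.
- move=> x; rewrite hE => x0; have [g [r [ug e]]] := ring_stalk_frac Ve affV affC x.
  apply: (invertible_mulI (rg_unit f Ve ug)); rewrite mulr0 e.
  have : mg Ve (r *: v) = 0 by rewrite mgZ -e -scalerA x0 scaler0.
  by move/(mg_inj0 hf ch qc gd)/ann->; rewrite rmorph0.
- move=> m; have [g [n [ug e]]] := mod_stalk_frac Vw affV loc m; have [r er] := gen n.
  exists (rg Vw (fsh f V (q * g))), (rg Vw r); split.
    apply: (rg_nonzerodivisor hf ch) => /iV.2[//|]; exact: (unit_at_neq0 ch ug).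
  by rewrite -mgZ -er mgZ -e rmorphM rmorphM -scalerA.
Qed.

Lemma reduced_chart (V : opens P) (y : OC (fi V)) F : reduced C -> chart y F -> F <> 0.
Proof.
move=> red ch F0; have [[_ [V1 _] _] _ sq _] := ch; have [_ inj] := chart_top ch.
have y0 : y = 0 by apply: (red _ _ 2); rewrite expr2 sq F0 rmorph0.
have [|_] := inj 0 1; last exact: V1.
by rewrite y0 rmorph0 mulr0 addr0.
Qed.

(** [F] is nonzero, since otherwise [y] would be a nonzero nilpotent; as [F = a ^ 2 + b c], the
    matrix of [y] is nonzero on every chart. *)
Lemma traceable_rank1 (M : sheafOfModules C) : reduced C -> traceable f M -> rank1 f M.
Proof.
move=> red /(traceableP hK hf)[qc H] w.
have [V [y [F [e1 [e2 [a [b [c [Vw ch gd]]]]]]]]] := H w.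
apply: (good_rank1 Vw qc ch gd) => -[a0 [b0 c0]]; apply: (reduced_chart red ch).
by rewrite (good_square ch gd) a0 b0 c0 !mul0r addr0.
Qed.

(** Two sections generate [f_* M] locally over [O_P], hence [M] over [O_C]. An affine open of [C] is
    in general not a preimage, which is why local generators are used. *)
Lemma traceable_coherent (M : sheafOfModules C) : traceable f M -> coherent M.
Proof.
move=> /(traceableP hK hf)[qc H]; split=> // U affU.
have /quasi_coherentP loc := qc.
apply: (fg_of_local_generators affU (loc U affU)) => x Ux.
have [V [y [F [e1 [e2 [a [b [c [Vw ch gd]]]]]]]]] := H (f x).
exists (fi V), 2, (pair2 e1 e2); split=> // W WV m z Wz.
have affV : affine OP V by case: ch => -[].
have affC := fi_affine hf affV.
have [s [us sW]] := affine_base affC (WV z Wz) Wz.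
have h : basic_open s `<=` fi V := @basic_openS C OC (fi V) s.
have [inv _ _] := affine_loc affC h (erefl _).
have [sur _] := loc _ affC s _ h (erefl _).
have [n [k e]] := sur (mres M sW m).
have [t et] := invertibleX k inv.
have [surV _] := dbasis_top (good_basis gd); have [p [q en]] := surV n.
exists (basic_open s), sW, h, (t *: map_mx (rres OC h) (\row_i pair2 (fsh f V p) (fsh f V q) i)).
split=> //; rewrite lincombZ /lincomb.
rewrite (eq_bigr (fun i => pair2 (rres OC h (fsh f V p)) (rres OC h (fsh f V q)) i *:
   pair2 (mres M h e1) (mres M h e2) i)); last first.
  by move=> i _; rewrite !mxE /pair2; case: ifP.
rewrite (sum_pair2 (pair2 _ _)) /= -!mresZ -mresD -en -e scalerA rmorphXn et.
by rewrite scale1r.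
Qed.

(** Where rank 1 fails, the matrix of [y] is zero and so is [F]; through the generic point this
    holds on all charts. There a nilpotent is, up to a unit, a multiple of [y], which acts as
    zero. *)
Lemma traceable_nilradical (M : sheafOfModules C) :
  traceable f M -> ~ rank1 f M -> killed_by_nilradical M.
Proof.
move=> /(traceableP hK hf)[qc H] nr1.
have /quasi_coherentP loc := qc.
have [w nw] : exists w : P, ~ module_rank1 (mod_stalk w (push f M)).
  by apply: contrapT => nex; apply: nr1 => w; apply: contrapT => nw; apply: nex; exists w.
have [V [y [F [e1 [e2 [a [b [c [Vw ch gd]]]]]]]]] := H w.
have [a0 [b0 c0]] : a = 0 /\ b = 0 /\ c = 0.
  by apply: contrapT => abc; apply: nw; exact: (good_rank1 Vw qc ch gd abc).
have F0 : F = 0 by rewrite (good_square ch gd) a0 b0 c0 !mul0r addr0.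
(* Another chart is compared on a common open [W] around [eta], to which functions on [V'] restrict
   injectively. *)
have all0 (V' : opens P) (y' : OC (fi V')) F' (e1' e2' : M (fi V')) a' b' c' :
    chart y' F' -> good y' e1' e2' a' b' c' -> [/\ a' = 0, b' = 0 & c' = 0].
  move=> ch' gd'; have [w' Vw'] := chart_neq0 ch'.
  have [W [pW We WVV]] := P1_pid_base (conj (etaP Vw) (etaP Vw') : oset (Defs.openI V V') eta).
  have hV : W `<=` V by move=> z /WVV[].
  have hV' : W `<=` V' by move=> z /WVV[].
  have chW := chart_res hV We pW ch; have chW' := chart_res hV' We pW ch'.
  have [sur inj] := chart_top chW; have [_ inj'] := chart_top chW'.
  have [affW [W1 dom] _] := pW.
  set yW := rres OC (fiS hV) y in chW sur inj; set yW' := rres OC (fiS hV') y' in chW' inj'.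
  have [al [be e]] := sur yW'.
  have be0 : be <> 0.
    move=> be0; have [|_ /eqP] := inj' al (-1); last by rewrite oppr_eq0 => /eqP.
    by rewrite e be0 rmorphN rmorph1 rmorph0 mul0r addr0 mulN1r subrr.
  have sq : yW * yW = 0 by rewrite (chart_sq chW) F0 !rmorph0.
  (* Square [yW' = al + be yW]: since [yW ^ 2 = 0], the coefficient of [yW] gives [2 al be = 0], and
     [be] is nonzero. *)
  have al0 : al = 0.
    have [h h2] := half_exists hK W.
    have E : fsh f W (al * al - rres OP hV' F') + fsh f W (2%:R * al * be) * yW = 0.
      rewrite rmorphB !rmorphM rmorph_nat -(chart_sq chW') -/yW' e.
      transitivity (- (fsh f W be * fsh f W be * (yW * yW))); first by ring.
      by rewrite sq mulr0 oppr0.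
    have [_ /dom[/(congr1 ( *%R h))|//]] := inj _ _ E.
    by rewrite mulr0 mulrA [h * _]mulrC h2 mul1r.
  have y0 i : yW *: mres M (fiS hV) i = 0.
    have [surM _] := dbasis_top (good_basis gd); have [p [q ->]] := surM i.
    rewrite /yW -mresZ scalerDr !scalerA ![y * _]mulrC -!scalerA (good_y1 gd) (good_y2 gd).
    by rewrite a0 b0 c0 !rmorph0 !scale0r subrr addr0 !scaler0 addr0 mres0.
  have yW0 (i : M (fi W)) : yW *: i = 0.
    have [surM _] := dbasis_top (dbasis_res hV (good_basis gd)); have [p [q ->]] := surM i.
    by rewrite scalerDr !scalerA ![yW * _]mulrC -!scalerA !y0 !scaler0 addr0.
  have yW0' (i : M (fi W)) : yW' *: i = 0.
    by rewrite e al0 rmorph0 add0r -scalerA yW0 scaler0.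
  have [_ injM] := dbasis_top (dbasis_res hV' (good_basis gd')).
  have affV' : affine OP V' by case: ch' => -[].
  have iV' : integral_ring (OP V') by case: ch' => -[].
  have inj0 s : rres OP hV' s = 0 -> s = 0.
    by rewrite -(rmorph0 (rres OP hV')) => /(integral_res_inj affV' iV' We).
  have [/inj0 -> /inj0 ->] : rres OP hV' a' = 0 /\ rres OP hV' b' = 0.
    apply: injM; rewrite !(fsh_res hV' (fiS hV')) -!mresZ -mresD -(good_y1 gd') mresZ.
    exact: yW0'.
  have [/inj0 -> _] : rres OP hV' c' = 0 /\ - rres OP hV' a' = 0; last by split.
  apply: injM; rewrite -rmorphN !(fsh_res hV' (fiS hV')) -!mresZ -mresD rmorphN scaleNr.
  by rewrite -(good_y2 gd') mresZ; exact: yW0'.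
move=> U s m nil; apply: (mres_sep (@smodP C M)) => x Ux.
have [V0 [h0 [n [V0x sn]]]] := nil x Ux.
have [V' [y' [F' [e1' [e2' [a' [b' [c' [Vw' ch' gd']]]]]]]]] := H (f x).
have [a'0 b'0 c'0] := all0 _ _ _ _ _ _ _ _ ch' gd'.
have F'0 : F' = 0 by rewrite (good_square ch' gd') a'0 b'0 c'0 !mul0r addr0.
have [affV' [V'1 dom] _] := chart_pid ch'; have affC := fi_affine hf affV'.
have [t [ut tV0]] := affine_base affC (Vw' : oset (fi V') x) V0x.
have h : basic_open t `<=` fi V' := @basic_openS C OC (fi V') t.
have [invt surO injO] := affine_loc affC h (erefl _).
have [surM _] := loc _ affC t _ h (erefl _).
have hU := subset_trans tV0 h0; exists (basic_open t), hU; split=> //.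
have [r [k er]] := surO (rres OC hU s).
(* Near [x] the section [s] is [r / t ^ k]; its nilpotency descends to [V'] up to a power of [t]. *)
have [|j ej] := injO (r ^+ n).
  have s0 : rres OC hU s ^+ n = 0.
    by rewrite -(rres_comp h0 tV0 hU) -rmorphXn sn rmorph0.
  by rewrite rmorphXn -er exprMn s0 mulr0.
have [sur inj] := chart_top ch'; have [al [be e]] := sur (t ^+ j * r).
have yy : y' * y' = 0 by rewrite (chart_sq ch') F'0 rmorph0.
have al0 : al = 0.
  (* Since [y' ^ 2 = 0], [al ^ 2] is the norm of [t ^ j * r]. The exponent [n + 1] makes the
     vanishing factor [t ^ j * r ^ n] appear even for [n = 0]. *)
  have E : fsh f V' ((al * al) ^+ n.+1) = 0.
    rewrite rmorphXn.
    have -> : fsh f V' (al * al) = (t ^+ j * r) * (fsh f V' al - fsh f V' be * y').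
      rewrite e; transitivity (fsh f V' al * fsh f V' al - fsh f V' be * fsh f V' be * (y' * y')).
        by rewrite yy mulr0 subr0 rmorphM.
      by ring.
    rewrite exprMn; set z := (_ - _) ^+ _.
    transitivity ((t ^+ j) ^+ n * (t ^+ j * r ^+ n) * r * z).
      by rewrite exprMn !exprS; ring.
    by rewrite ej mulr0 !mul0r.
  have pow0 (d : OP V') i : d ^+ i = 0 -> d = 0.
    by elim: i => [/V'1//|i IH]; rewrite exprS => /dom[//|/IH].
  by move/(chart_phi0 ch')/pow0: E => /dom[].
have [m' [i em]] := surM (mres M hU m).
have := congr1 (mres M h) (_ : (t ^+ j * r) *: m' = 0); rewrite mresZ -em rmorphM rmorphXn -er.
rewrite !rmorphXn scalerA mres0 => E; rewrite mresZ mres0.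
apply: (invertible_scaleI (invertibleX (j + k + i) invt)) => /=.
rewrite scaler0 -[RHS]E; first by rewrite scalerA; congr (_ *: _); rewrite !exprD; ring.
rewrite e al0 rmorph0 add0r -scalerA.
have [surV _] := dbasis_top (good_basis gd'); have [p [q ->]] := surV m'.
rewrite scalerDr !scalerA ![y' * _]mulrC -!scalerA (good_y1 gd') (good_y2 gd').
by rewrite a'0 b'0 c'0 !rmorph0 !scale0r subrr addr0 !scaler0 addr0 scaler0.
Qed.

End TraceableModules.

(** * Coherent torsion-free modules of rank one *)

Lemma scaler_swap (R : comPzRingType) (M : lmodType R) (a b : R) (m : M) :
  a *: (b *: m) = b *: (a *: m).
Proof. by rewrite !scalerA mulrC. Qed.

Section CoherentModules.
Variables (K : fieldType) (P : projectiveLine K) (C : scheme) (f : schemeMorphism C P).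
Hypothesis hK : 2%N \notin [pchar K].
Hypothesis hf : double_cover f.
Local Notation OC := (Osh C).
Local Notation OP := (Osh P).
Local Notation fi V := (opre (mcont f) V).
Local Notation PR := (push_ring (mcont f) OC).

Variable M : sheafOfModules C.

(** At [eta] the stalk ring is its own total quotient ring, so rank 1 gives a free generator
    [u = v / g] of the stalk. Each section over [fi V] is then a multiple of [v] up to a nonzero
    factor from [O(V)], and finite generation makes this factor uniform. *)
Lemma rank1_lattice (V : opens P) (y : OC (fi V)) (F : OP V) :
  chart y F -> coherent M -> rank1 f M -> exists (v : M (fi V)) (d : OP V),
    [/\ d <> 0, forall r, r *: v = 0 -> r = 0
      & forall n, exists r, fsh f V d *: n = r *: v].
Proof.
move=> ch [qc fg] r1; have [eta etaP] := P1_generic_point P.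
have [w Vw] := chart_neq0 ch; have Ve := etaP _ _ Vw.
have pV := chart_pid ch; have [affV [V1 dom] _] := pV; have affC := fi_affine hf affV.
have loc : basic_loc M (fi V) by exact: (quasi_coherentP M).1.
(* The case [w = eta] of [chart_total_quotient], where specialization is the identity. *)
have inv (s : ring_stalk PR eta) : ~ zero_divisor s -> invertible s.
  have [Hinv _ _] := chart_total_quotient hf etaP Ve ch.
  move=> /Hinv /=; have [U [Ue [t ->]]] := ring_stalkP s.
  by rewrite (rspecE (O := PR) _ Ue Ue).
have [u [surR injR]] := nonzerodivisor_invertible_rank1 inv (r1 eta).
have [g [v [ug ev]]] := mod_stalk_frac Ve affV loc u.
have g0 : g <> 0 := unit_at_neq0 ch ug.
exists v.
have gen n : exists d r, d <> 0 /\ fsh f V d *: n = r *: v.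
  have [x ex] := surR (mg Ve n); have [h [r [uh er]]] := ring_stalk_frac Ve affV affC x.
  have [|g' ug' e'] := mg_eq0 (f := f) (Vw := Ve) affV loc
      (m := fsh f V (g * h) *: n - r *: v).
    rewrite mgB !mgZ ex -ev -er !rmorphM /= !scalerA.
    rewrite [X in X *: _ - _](_ : _ = rg Ve (fsh f V h) * x * rg Ve (fsh f V g)) ?subrr //.
    by rewrite -!mulrA [RHS]mulrC -!mulrA mulrC -!mulrA [rg Ve (fsh f V g) * _]mulrC -!mulrA.
  exists (g' * (g * h)), (fsh f V g' * r); split.
    by move=> /dom[/(unit_at_neq0 ch ug')|/dom[//|/(unit_at_neq0 ch uh)]].
  by move/eqP: e'; rewrite scalerBr !scalerA subr_eq0 -rmorphM => /eqP.
have [d [d0 dP]] : exists d, d <> 0 /\ forall n, exists r, fsh f V d *: n = r *: v.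
  have [l lP] := (fg_moduleP (M (fi V))).1 (fg (fi V) affC).
  have [d [d0 dl]] : exists d, d <> 0 /\
      forall n, n \in l -> exists r, fsh f V d *: n = r *: v.
    elim: l {lP} => [|n l [d [d0 IH]]]; first by exists 1.
    have [h [r [h0 e]]] := gen n; exists (d * h); split; first by move=> /dom[].
    move=> m; rewrite inE => /orP[/eqP->|/IH[s es]].
      by exists (fsh f V d * r); rewrite rmorphM -scalerA e scalerA.
    by exists (fsh f V h * s); rewrite mulrC rmorphM -scalerA es scalerA.
  exists d; split=> // n; apply: (lP n [set n | exists r, fsh f V d *: n = r *: v]) => //.
  split=> [|m m' [r e] [r' e']|s m [r e]]; first by exists 0; rewrite scaler0 scale0r.
    by exists (r + r'); rewrite scalerDr e e' scalerDl.
  by exists (s * r) => /=; rewrite scaler_swap e scalerA.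
exists d; split=> // r rv.
have /(rg_eq0_inj hf ch) : rg Ve (r * fsh f V g) = 0.
  by apply: injR; rewrite rmorphM /= -scalerA ev -mgZ rv mg0.
by rewrite mulrC => /(chart_cancel ch)[].
Qed.

(** A nonzero [g] is a nonzerodivisor in every stalk over [V], so the germ of [n] at each [f x]
    vanishes, and [n] is zero near each fibre. *)
Lemma torsion_free_cancel (V : opens P) (y : OC (fi V)) (F : OP V) g (n : M (fi V)) :
  chart y F -> quasi_coherent M -> torsion_free f M -> g <> 0 -> fsh f V g *: n = 0 -> n = 0.
Proof.
move=> ch qc tf g0 gn; apply: (mres_sep (@smodP C M)) => x Vx.
have [affV _ _] := chart_pid ch; have affC := fi_affine hf affV.
have loc : basic_loc M (fi V) by exact: (quasi_coherentP M).1.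
have Vw : oset V (f x) by [].
have n0 : mg (f := f) Vw n = 0.
  apply: contrapT => /eqP n0; have [|g00|] := tf (f x) _ n0 (rg Vw (fsh f V g)).
  - by rewrite -mgZ gn mg0.
  - by apply: g0; apply: (chart_phi0 ch); exact: (rg_eq0_inj hf ch g00).
  - exact: (rg_nonzerodivisor hf ch g0).
have [h uh hn] := mg_eq0 affV loc n0.
have k : fi (basic_open h) `<=` fi V := fiS (@basic_openS P OP V h).
exists (fi (basic_open h)), k; split=> //.
have [inv _ _] := affine_loc affC k (opre_basic_open f h).
by apply: (invertible_scaleI inv) => /=; rewrite -!mresZ hn scaler0 mres0.
Qed.

Lemma coherent_traceable : coherent M -> rank1 f M -> torsion_free f M -> traceable f M.
Proof.
move=> coh r1 tf; have [qc _] := coh; apply/(traceableP hK hf); split=> // w.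
have [V [y [F [ch Vw _]]]] := chart_exists hK hf (I : oset (Defs.openT P) w).
have [v [d [d0 ann gen]]] := rank1_lattice ch coh r1.
have cancel g (n : M (fi V)) : g <> 0 -> fsh f V g *: n = 0 -> n = 0.
  exact: (torsion_free_cancel ch qc tf).
have [affV [V1 dom] pid] := chart_pid ch; have affC := fi_affine hf affV.
have [sur inj] := chart_top ch; pose phi := fsh f V; rewrite -/phi in sur inj cancel gen.
have loc : basic_loc M (fi V) by exact: (quasi_coherentP M).1.
have cancelE g (n n' : M (fi V)) : g <> 0 -> phi g *: n = phi g *: n' -> n = n'.
  move=> g0 /eqP; rewrite -subr_eq0 -scalerBr => /eqP/(cancel _ _ g0)/eqP.
  by rewrite subr_eq0 => /eqP.
have coord a b a' b' : (phi a + phi b * y) *: v = (phi a' + phi b' * y) *: v ->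
    a = a' /\ b = b'.
  move/eqP; rewrite -subr_eq0 -scalerBl => /eqP/ann E.
  have [] := inj (a - a') (b - b'); first by rewrite -[RHS]E !rmorphB; ring.
  by move=> /eqP + /eqP; rewrite !subr_eq0 => /eqP-> /eqP->.
(* Hermite normal form of the lattice d M(V) inside O(V) v + O(V) y v. *)
have [|d1 [x [n1 e1]] d1P] := pid [set b | exists a n, phi d *: n = (phi a + phi b * y) *: v].
  split.
  - by exists 0, 0; rewrite !rmorph0 mul0r addr0 scaler0 scale0r.
  - move=> b b' [a [n e]] [a' [n' e']]; exists (a + a'), (n + n').
    by rewrite scalerDr e e' -scalerDl !rmorphD; congr (_ *: _); ring.
  - move=> c b [a [n e]]; exists (c * a), (phi c *: n).
    by rewrite scaler_swap e scalerA !rmorphM; congr (_ *: _); ring.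
(* [d1] generates the ideal of [y]-coordinates and [d2] that of elements without [y]-coordinate, so
   the basis is triangular: [d n1 = (x + d1 y) v] and [d n2 = d2 v]. *)
have [|d2 [n2 e2] d2P] := pid [set a | exists n, phi d *: n = phi a *: v].
  split.
  - by exists 0; rewrite rmorph0 scaler0 scale0r.
  - by move=> a a' [n e] [n' e']; exists (n + n'); rewrite scalerDr e e' -scalerDl rmorphD.
  - move=> c a [n e]; exists (phi c *: n).
    by rewrite scaler_swap e scalerA rmorphM.
(* [d y v] and [d v] lie in the lattice, so [d] is a multiple of [d1] and of [d2]. *)
have d10 : d1 <> 0.
  move=> d10; have [|b] := d1P d; last by rewrite d10 mulr0 => /d0.
  by exists 0, (y *: v); rewrite rmorph0 add0r scalerA.
have d20 : d2 <> 0.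
  move=> d20; have [|b] := d2P d; last by rewrite d20 mulr0 => /d0.
  by exists v.
have comb p q : phi d *: (phi p *: n1 + phi q *: n2) =
    (phi (p * x + q * d2) + phi (p * d1) * y) *: v.
  rewrite scalerDr !scalerA ![phi d * _]mulrC -!scalerA e1 e2 !scalerA -scalerDl.
  by rewrite !rmorphD !rmorphM; congr (_ *: _); ring.
have gen2 n : exists p q, n = phi p *: n1 + phi q *: n2.
  have [r er] := gen n; have [a [b rE]] := sur r.
  have [|p bp] := d1P b; first by exists a, n; rewrite er rE.
  have [|q aq] := d2P (a - p * x).
    exists (n - phi p *: n1); rewrite scalerBr er rE scaler_swap e1 scalerA -scalerBl.
    by rewrite bp rmorphB !rmorphM; congr (_ *: _); ring.
  exists p, q; apply: (cancelE _ _ _ d0); rewrite comb er rE -bp -aq.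
  by rewrite [p * x + _](_ : _ = a) //; ring.
have be : dbasis n1 n2.
  apply: dbasis_affine => //; first exact: smodP.
  move=> p q pq0; have := comb p q; rewrite pq0 scaler0 => E.
  have [E1 /dom[p0|//]] : 0 = p * x + q * d2 /\ p * d1 = 0.
    have [|E1 E2] := coord 0 0 (p * x + q * d2) (p * d1); last by split.
    by rewrite -E rmorph0 mul0r addr0 scale0r.
  by move: E1; rewrite p0 mul0r add0r => /esym/dom[].
have [p [q ye1]] := gen2 (y *: n1); have [r [s ye2]] := gen2 (y *: n2).
exists V, y, F, n1, n2, p, q, r; split=> //; split=> //.
rewrite ye2; suff -> : s = - p by rewrite rmorphN scaleNr.
have sq := chart_sq ch.
(* Coordinates of [y n2] give [d2 = r d1] and [r x + s d2 = 0], those of [y n1] give [x = p d1];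
   together [r (p + s) d1 = 0], and the trace [p + s] vanishes. *)
have [E1 E2] : 0 = r * x + s * d2 /\ d2 = r * d1.
  apply: coord; rewrite -comb -ye2 scaler_swap e2 scalerA rmorph0.
  by congr (_ *: _); ring.
have [E3 E4] : d1 * F = p * x + q * d2 /\ x = p * d1.
  apply: coord; rewrite -comb -ye1 scaler_swap e1 scalerA rmorphM -sq.
  by congr (_ *: _); rewrite /phi; ring.
have r0 : r <> 0 by move=> r0; apply: d20; rewrite E2 r0 mul0r.
have /dom[//|/dom[/eqP|//]] : r * ((p + s) * d1) = 0.
  by rewrite [RHS]E1 E2 E4; ring.
by rewrite addrC addr_eq0 => /eqP.
Qed.

End CoherentModules.

(** * Smooth covers *)

Section QuadraticExtension.
Variables (R : comPzRingType) (d : R).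

(** [R[Z] / (Z ^ 2 - d)], the pair [(a, b)] standing for [a + b Z]; [d = 0] gives the dual
    numbers. *)
Definition quad of R : Type := (R * R)%type.
Local Notation Q := (quad d).

HB.instance Definition _ := GRing.Zmodule.copy Q (R * R)%type.

Definition quad_mul (x y : Q) : Q := (x.1 * y.1 + x.2 * y.2 * d, x.1 * y.2 + x.2 * y.1).

Fact quad_mulA : associative quad_mul.
Proof. by move=> [a b] [a' b'] [a'' b'']; congr pair; rewrite /=; ring. Qed.

Fact quad_mulC : commutative quad_mul.
Proof. by move=> [a b] [a' b']; congr pair; rewrite /=; ring. Qed.

Fact quad_mul1 : left_id ((1, 0) : Q) quad_mul.
Proof. by move=> [a b]; congr pair; rewrite /=; ring. Qed.

Fact quad_mulD : left_distributive quad_mul +%R.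
Proof.
move=> [a b] [a' b'] [a'' b''].
rewrite -[LHS]/((_, _) : Q) -[RHS]/((_, _) : Q); congr pair; rewrite /=; ring.
Qed.

HB.instance Definition _ := GRing.Zmodule_isComPzRing.Build Q
  quad_mulA quad_mulC quad_mul1 quad_mulD.

Lemma quad_mulE (a b a' b' : R) :
  ((a, b) : Q) * ((a', b') : Q) = (a * a' + b * b' * d, a * b' + b * a') :> Q.
Proof. by []. Qed.

Lemma quad_addE (a b a' b' : R) : ((a, b) : Q) + ((a', b') : Q) = (a + a', b + b') :> Q.
Proof. by []. Qed.

Lemma quad_subE (a b a' b' : R) : ((a, b) : Q) - ((a', b') : Q) = (a - a', b - b') :> Q.
Proof. by []. Qed.

Lemma quad_zeroE : 0 = (0, 0) :> Q.
Proof. by []. Qed.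

Definition quad_inj (a : R) : Q := (a, 0).

Fact quad_inj_zmod : GRing.zmod_morphism quad_inj.
Proof. by move=> a b; rewrite /quad_inj quad_subE subrr. Qed.

Fact quad_inj_monoid : GRing.monoid_morphism quad_inj.
Proof.
split=> [|a b]; first by [].
by rewrite /quad_inj quad_mulE !mul0r mulr0 !addr0.
Qed.

HB.instance Definition _ := GRing.isZmodMorphism.Build R Q quad_inj quad_inj_zmod.
HB.instance Definition _ := GRing.isMonoidMorphism.Build R Q quad_inj quad_inj_monoid.

End QuadraticExtension.

Section JacobianCriterion.
Variables (k D A : comPzRingType) (alpha : {rmorphism k -> D}) (phi : {rmorphism D -> A}).
Variables (y : A) (F : D).
Hypothesis sq : y * y = phi F.
Hypothesis coord : forall r, exists s t, r = phi s + phi t * y.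
Hypothesis free : forall s t, phi s + phi t * y = 0 -> s = 0 /\ t = 0.

(* With I = (Y ^ 2 - F), B = D[e, Y] / (e ^ 2, Y ^ 2 - F - e) is D[Y] / I ^ 2, a
   square-zero extension of A = D[Y] / I. *)
Local Notation De := (quad (0 : D)).
Local Notation B := (quad ((F, 1) : De)).

(** Reduction modulo [e] with [Y] sent to [y]: of [(a + a' e) + (c + c' e) Y] only [a] and [c] are
    kept. *)
Definition thick_proj (b : B) : A := phi b.1.1 + phi b.2.1 * y.

Fact thick_proj_zmod : GRing.zmod_morphism thick_proj.
Proof.
by move=> [[a b] [c d]] [[a' b'] [c' d']]; rewrite /thick_proj /= !rmorphB; ring.
Qed.

Fact thick_proj_monoid : GRing.monoid_morphism thick_proj.
Proof.
split=> [|[[a b] [c d]] [[a' b'] [c' d']]].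
  by rewrite /thick_proj /= rmorph1 rmorph0 mul0r addr0.
rewrite quad_mulE !quad_mulE !quad_addE /thick_proj /= !rmorphD !rmorphM !rmorph0.
by rewrite -sq; ring.
Qed.

HB.instance Definition _ := GRing.isZmodMorphism.Build B A thick_proj thick_proj_zmod.
HB.instance Definition _ := GRing.isMonoidMorphism.Build B A thick_proj thick_proj_monoid.

(** On [D] a lift [h] of the identity is [s |-> s + delta(s) e] up to multiples of [e Y], and
    multiplicativity makes [delta] a derivation. With [h(y) = Y + (p + q Y) e], the coefficient of
    [e] in [h(y) ^ 2 = h(F)] is [1 + 2 q F = delta F]; the [1] comes from [Y ^ 2 = F + e]. *)
Lemma smooth_derivation (alphaA : k -> A) :
  (forall c, alphaA c = phi (alpha c)) -> formally_smooth alphaA ->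
  exists delta : D -> D, [/\ forall s t, delta (s + t) = delta s + delta t,
    forall s t, delta (s * t) = s * delta t + t * delta s
    & exists q, delta F = 1 + 2%:R * q * F].
Proof.
move=> eA smooth.
have [||c|h [hpi _]] := smooth B A
    (quad_inj ((F, 1) : De) \o quad_inj (0 : D) \o alpha) thick_proj idfun.
- move=> r; have [s [t ->]] := coord r; exists ((s, 0), (t, 0)).
  by rewrite /thick_proj.
- move=> [[a b] [c d]] [[a' b'] [c' d']].
  move=> /free[/= -> ->] /free[/= -> ->].
  rewrite quad_mulE !quad_mulE !quad_addE quad_zeroE quad_zeroE.
  by congr pair; congr pair; rewrite /=; ring.
- by rewrite /= eA /thick_proj /= rmorph0 mul0r addr0.
have hphi s : exists ds ds', h (phi s) = ((s, ds), (0, ds')).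
  have := hpi (phi s); case: (h (phi s)) => [[a b] [c d]] /eqP.
  rewrite -subr_eq0 /thick_proj /= => /eqP E.
  have [|/eqP + ->] := free (s := a - s) (t := c).
    by rewrite -[RHS]E /thick_proj /= rmorphB; ring.
  by rewrite subr_eq0 => /eqP->; exists b, d.
pose delta s := (h (phi s)).1.2.
have hE s : exists ds', h (phi s) = ((s, delta s), (0, ds')).
  by have [ds [ds' e]] := hphi s; exists ds'; rewrite /delta e.
exists delta; split=> [s t|s t|].
- have [ds es] := hE s; have [dt et] := hE t.
  by rewrite {1}/delta !rmorphD es et.
- have [ds es] := hE s; have [dt et] := hE t.
  rewrite {1}/delta !rmorphM es et quad_mulE !quad_mulE !quad_addE /=; ring.
- have [p [q e]] : exists p q, h y = ((0, p), (1, q)).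
    have := hpi y; case: (h y) => [[a b] [c d]] /eqP.
    rewrite -subr_eq0 /thick_proj /= => /eqP E.
    have [|-> /eqP] := free (s := a) (t := c - 1).
      by rewrite -[RHS]E /thick_proj /= rmorphB rmorph1; ring.
    by rewrite subr_eq0 => /eqP->; exists b, d.
  exists q; have := congr1 (fun r => (h r).1.2) sq.
  rewrite -/(delta F) => <-; rewrite rmorphM e quad_mulE !quad_mulE !quad_addE /=; ring.
Qed.

End JacobianCriterion.

Section SmoothCovers.
Variables (K : fieldType) (P : projectiveLine K) (C : scheme) (f : schemeMorphism C P).
Hypothesis hK : 2%N \notin [pchar K].
Hypothesis hf : double_cover f.
Local Notation OC := (Osh C).
Local Notation OP := (Osh P).
Local Notation fi V := (opre (mcont f) V).

Lemma good_res (M : sheafOfModules C) (V W : opens P) (h : W `<=` V) (y : OC (fi V))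
    (e1 e2 : M (fi V)) a b c :
  good y e1 e2 a b c -> good (rres OC (fiS h) y) (mres M (fiS h) e1) (mres M (fiS h) e2)
    (rres OP h a) (rres OP h b) (rres OP h c).
Proof.
case=> be E1 E2; split; first exact: dbasis_res.
  by rewrite !(fsh_res h (fiS h)) -!mresZ -mresD E1.
by rewrite !(fsh_res h (fiS h)) -!mresZ -mresB E2.
Qed.

(* If a, b and c all vanish at w, then so does delta F = delta (a ^ 2 + b c), while
   delta F = 1 modulo F. *)
Lemma smooth_unit (V : opens P) (y : OC (fi V)) (F : OP V) (M : sheafOfModules C)
    (e1 e2 : M (fi V)) a b c w : smooth (over_P1 f) -> oset V w ->
  chart y F -> good y e1 e2 a b c -> [\/ unit_at a w, unit_at b w | unit_at c w].
Proof.
move=> sm Vw ch gd; have [affV _ _] := chart_pid ch.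
have [sur inj] := chart_top ch.
have [_ fs] := sm _ (fi_affine hf affV).
have eA c0 : over_P1 f (fi V) c0 =
    fsh f V ((rres OP (@openTS _ V) \o structK P) c0).
  by rewrite /= (fsh_res (@openTS _ V) (fiS (@openTS _ V))); exact: rresE.
have [delta [dD dM [q dF]]] := smooth_derivation (chart_sq ch) sur inj eA fs.
have [v0 vD vM v1 vP] := affine_prime affV Vw.
have FE := good_square ch gd.
apply: contrapT => nu.
have [na nb nc] : [/\ ~ unit_at a w, ~ unit_at b w & ~ unit_at c w].
  by split=> u; apply: nu; [constructor 1|constructor 2|constructor 3].
have nF : ~ unit_at F w by rewrite FE; apply: (vD); apply: (vM).
apply: v1.
have -> : 1 = 2%:R * delta a * a + (delta c * b + delta b * c) + - (2%:R * q) * F.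
  have := dF; rewrite {1}FE dD !dM => E.
  transitivity ((1 + 2%:R * q * F) - 2%:R * q * F); first by ring.
  by rewrite -E; ring.
apply: (vD); last exact: vM.
apply: (vD); first exact: vM.
by apply: (vD); exact: vM.
Qed.

Lemma basis1P (M : sheafOfModules C) (U : opens C) (v : M U) :
  affine OC U -> basic_loc M U ->
  (forall m, exists r, m = r *: v) -> (forall r, r *: v = 0 -> r = 0) ->
  is_basis (fun _ : 'I_1 => v).
Proof.
move=> affU loc sur inj; have idU : U `<=` U by [].
apply: (basis_affine (@OshP C) (@smodP C M) (id_U := idU) affU loc).
split=> [m|r]; rewrite /lincomb.
  have [r ->] := sur m; exists (\row_i r).
  by rewrite big_ord1 mxE mres_id.
rewrite big_ord1 mres_id => /inj r0; apply/rowP => i; rewrite mxE.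
by rewrite (ord1 i).
Qed.

Lemma basis1_top (M : sheafOfModules C) (U V : opens C) (h : V `<=` U) (v : M U) :
  is_basis (fun _ : 'I_1 => v) ->
  (forall m, exists r, m = r *: mres M h v) /\ (forall r, r *: mres M h v = 0 -> r = 0).
Proof.
move=> /is_basisE/(_ V h)[sur inj]; split=> [m|r r0].
  by have [a ->] := sur m; exists (a ord0 ord0); rewrite /lincomb big_ord1.
have := inj (\row_i r); rewrite /lincomb big_ord1 mxE => /(_ r0)/rowP/(_ ord0).
by rewrite !mxE.
Qed.

(** As [a], [b], [c] have no common zero, [det (v, y v)] can be made a unit at [f x]; then [v]
    generates [M] over the preimage of a whole neighbourhood of [f x]. *)
Lemma traceable_line_bundle (M : sheafOfModules C) :
  smooth (over_P1 f) -> traceable f M -> line_bundle M.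
Proof.
move=> sm /(traceableP hK hf)[qc H] x; have Vx := H (f x).
have [V [y [F [e1 [e2 [a [b [c [Vw ch gd]]]]]]]]] := Vx.
have [affV _ _] := chart_pid ch.
have [l [m uq]] : exists l m : OP V,
    unit_at (l * (l * b - m * a) - m * (l * a + m * c)) (f x).
  have [v0 vD vM v1 vP] := affine_prime affV Vw.
  apply: contrapT => nex.
  have nb : ~ unit_at b (f x).
    move=> ub; apply: nex; exists 1, 0.
    by rewrite [X in unit_at X _](_ : _ = b) //; ring.
  have nc : ~ unit_at c (f x).
    move=> ub; apply: nex; exists 0, 1; rewrite [X in unit_at X _](_ : _ = -1 * c); last by ring.
    apply/unit_atM; split=> //; apply: invertible_unit_at => //.
    by exists (-1); rewrite mulrNN mulr1.
  have na : ~ unit_at a (f x).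
    have [h h2] := half_exists hK V.
    (* The form at [(1, 1)] is [b - 2 a - c]; if it vanishes at [f x] together with [b] and [c], so
       does [a = h (2 a)]. *)
    have -> : a = h * (1 * b + -1 * c) + - h * (1 * (1 * b - 1 * a) - 1 * (1 * a + 1 * c)).
      by transitivity (2%:R * h * a); [rewrite h2 mul1r|ring].
    apply: (vD); apply: (vM); first by apply: (vD); exact: vM.
    by move=> u; apply: nex; exists 1, 1.
  by have [] := smooth_unit sm Vw ch gd.
set q := _ - _ in uq.
have h : basic_open q `<=` V := @basic_openS P OP V q.
have pD := pid_basic_open (chart_pid ch) uq.
have chD := chart_res h uq pD ch; have gdD := good_res h gd.
have [affD _ _] := pD; have affC := fi_affine hf affD.
have [inv _ _] := affine_loc affV h (erefl _).
have [cv1 cv2] := good_cyclic_vector gdD (rres OP h l) (rres OP h m).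
move: cv1 cv2; set v := _ + _; rewrite -!rmorphM -!rmorphD -!rmorphB -!rmorphM -rmorphB -/q.
move=> cv1 cv2; exists (fi (basic_open q)); split; first exact: uq.
exists (fun _ => v); apply: basis1P => //; first exact: (quasi_coherentP M).1.
  move=> n; have [s [t e]] := cv2 n; have [u eu] := inv.
  exists (fsh f _ u * (fsh f _ s + fsh f _ t * rres OC (fiS h) y)).
  by rewrite -scalerA scalerDl -scalerA -e scalerA -rmorphM eu rmorph1 scale1r.
have [sur _] := chart_top chD.
move=> r; have [s [t ->]] := sur r; rewrite scalerDl -scalerA => /cv1[s0 t0].
have -> : s = 0 by apply: (invertible_mulI inv); rewrite s0 mulr0.
have -> : t = 0 by apply: (invertible_mulI inv); rewrite t0 mulr0.
by rewrite !rmorph0 mul0r addr0.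
Qed.

End SmoothCovers.

(** * Line bundles *)

Section LineBundles.
Variables (K : fieldType) (P : projectiveLine K) (C : scheme) (f : schemeMorphism C P).
Hypothesis hK : 2%N \notin [pchar K].
Hypothesis hf : double_cover f.
Local Notation OC := (Osh C).
Local Notation OP := (Osh P).
Local Notation fi V := (opre (mcont f) V).

Section Generators.
Variable M : sheafOfModules C.

Definition generates_at (U : opens C) (n : M U) (x : C) :=
  exists (W : opens C) (h : W `<=` U), oset W x /\ is_basis (fun _ : 'I_1 => mres M h n).

Lemma generates_at_in (U : opens C) (n : M U) x : generates_at n x -> oset U x.
Proof. by move=> [W [h [Wx _]]]; exact: h. Qed.

Lemma generates_everywhere (U : opens C) (n : M U) :
  (forall x, oset U x -> generates_at n x) -> is_basis (fun _ : 'I_1 => n).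
Proof.
move=> gen; apply: (is_basis_local (@OshP C) (@smodP C M)) => W x WU Wx.
have [W' [k [W'x be]]] := gen x (WU x Wx).
have iW := @openIl _ W W'; have iW' := @openIr _ W W'.
exists (Defs.openI W W'), (subset_trans iW WU); split=> //.
have := (is_basisE _).1 be _ iW'.
have E a : lincomb (fun _ : 'I_1 => mres M k n) iW' a =
    lincomb (fun _ : 'I_1 => n) (subset_trans iW WU) a.
  by apply: eq_bigr => i _; rewrite (mres_comp _ _ (subset_trans iW WU)).
by move=> [sur inj]; split=> [m|a]; [have [a] := sur m|move: (inj a)]; rewrite E //; exists a.
Qed.

(** If [n] generates, expressing [e] through [n] inverts [r]; where [r] is invertible, [r *: e] is
    as good a generator as [e]. Generation thus becomes a statement about the prime ideal of [x]. *)
Lemma generates_at_unit (U V : opens C) (h : V `<=` U) (e : M V) (n : M U) r x :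
  oset V x -> is_basis (fun _ : 'I_1 => e) -> mres M h n = r *: e ->
  generates_at n x <-> unit_at r x.
Proof.
move=> Vx be nr; split=> [[W [k [Wx bn]]]|[W [k [Wx [t tr]]]]].
  have iW := @openIl _ W V; have iV := @openIr _ W V.
  have [surn _] := basis1_top iW bn; have [_ inje] := basis1_top iV be.
  have [t et] := surn (mres M iV e).
  exists (Defs.openI W V), iV; split=> //; exists t.
  apply/eqP; rewrite -subr_eq0; apply/eqP/inje.
  rewrite scalerBl scale1r -scalerA -mresZ -nr (mres_comp _ _ (subset_trans iV h)).
  by rewrite [X in _ - X]et (mres_comp _ _ (subset_trans iV h)) subrr.
exists W, (subset_trans k h); split=> //.
apply: generates_everywhere => x' Wx'; exists W, (fun z => id); split=> //.
apply/is_basisE => Z l.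
have [sur inj] := basis1_top (subset_trans l k) be.
have E a : lincomb (fun _ : 'I_1 => mres M (fun z => id) (mres M (subset_trans k h) n)) l a =
    (a ord0 ord0 * rres OC l (rres OC k r)) *: mres M (subset_trans l k) e.
  rewrite /lincomb big_ord1 mres_id -(mres_comp h k) nr !mresZ scalerA.
  by rewrite (mres_comp k l (subset_trans l k)).
have lt : rres OC l t * rres OC l (rres OC k r) = 1 by rewrite -rmorphM tr rmorph1.
split=> [m|a].
  have [s ->] := sur m; exists (\row_i (s * rres OC l t)).
  by rewrite E mxE -mulrA lt mulr1.
rewrite E => /inj a0; apply/rowP => i; rewrite mxE (ord1 i).
by rewrite -[LHS]mulr1 -lt [rres OC l t * _]mulrC mulrA a0 mul0r.
Qed.

Variable U : opens C.
Hypothesis affU : affine OC U.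
Hypothesis lb : line_bundle M.

Lemma local_generator x : oset U x -> exists (a : OC U) (e : M (basic_open a)),
  unit_at a x /\ is_basis (fun _ : 'I_1 => e).
Proof.
move=> Ux; have [W [Wx [e be]]] := lb x.
have [a [ua aW]] := affine_base affU Ux Wx.
exists a, (mres M aW (e ord0)); split=> //.
have := is_basis_res aW be; congr (is_basis _).
by apply/funext => i; rewrite (ord1 i).
Qed.

Lemma generates_at_add (n n' : M U) x : generates_at n x -> ~ generates_at n' x ->
  generates_at (n + n') x.
Proof.
move=> gn gn'; have Ux := generates_at_in gn.
have [a [e [ua be]]] := local_generator Ux; have Dx : oset (basic_open a) x := ua.
have h : basic_open a `<=` U := @basic_openS C OC U a.
have [sur _] := basis1_top (fun z => id) be; rewrite mres_id in sur.
have affD := affine_basic_open affU a.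
have [r er] := sur (mres M h n); have [r' er'] := sur (mres M h n').
have [v0 vD vM _ _] := affine_prime affD ua.
apply/(generates_at_unit (r := r + r') Dx be); first by rewrite mresD er er' scalerDl.
apply: contrapT => nr; have ur := (generates_at_unit Dx be er).1 gn.
suff : ~ unit_at ((r + r') + -1 * r') x by apply; rewrite (_ : _ + -1 * r' = r) //; ring.
by apply: (vD) => //; apply: (vM) => /(generates_at_unit Dx be er').
Qed.

Lemma generates_at_exists x : oset U x -> exists n : M U, generates_at n x.
Proof.
move=> Ux; have [a [e [ua be]]] := local_generator Ux; have Dx : oset (basic_open a) x := ua.
have h : basic_open a `<=` U := @basic_openS C OC U a.
have qc := locally_free_quasi_coherent (@smodP C M) lb.
have [sur _] := (quasi_coherentP M).1 qc U affU a _ h (erefl _).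
have [n [k en]] := sur e; exists n.
apply/(generates_at_unit Dx be (esym en)); apply/unit_at_res => //.
exact: unit_atX.
Qed.

(** If neither section works at both points, each generates at exactly one of them, and their sum
    generates at both. *)
Lemma generates_at_pair x x' : oset U x -> oset U x' ->
  exists n : M U, generates_at n x /\ generates_at n x'.
Proof.
move=> Ux Ux'; have [n gn] := generates_at_exists Ux.
have [n' gn'] := generates_at_exists Ux'.
case: (pselect (generates_at n x')) => [g1|g1]; first by exists n.
case: (pselect (generates_at n' x)) => [g2|g2]; first by exists n'.
exists (n + n'); split; first exact: generates_at_add.
by rewrite addrC; exact: generates_at_add.
Qed.

End Generators.

Section Fibres.
Variables (V : opens P) (y : OC (fi V)) (F : OP V).
Hypothesis ch : chart y F.
Local Notation phi := (fsh f V).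

(** Lying over: a prime that contains the extension [I] of the ideal of [w] and misses the image [S]
    of its complement contracts to that ideal. [I] and [S] are disjoint because [1, y] is a
    basis. *)
Lemma fibre_point w : oset V w -> exists2 x, oset (fi V) x & f x = w.
Proof.
move=> Vw; have [affV _ _] := chart_pid ch; have affC := fi_affine hf affV.
have [sur inj] := chart_top ch.
have [v0 vD vM v1 vP] := affine_prime affV Vw.
pose I := [set r | exists s t, [/\ r = phi s + phi t * y, ~ unit_at s w & ~ unit_at t w]].
pose S := [set r | exists2 g, unit_at g w & r = phi g].
have [||||p [pp Ip pS]] := @prime_ideal_avoiding _ I S.
- split.
  + by exists 0, 0; split=> //; rewrite rmorph0 mul0r addr0.
  + move=> r r' [s [t [-> s0 t0]]] [s' [t' [-> s0' t0']]]; exists (s + s'), (t + t').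
    by split; [rewrite !rmorphD; ring|exact: vD|exact: vD].
  + move=> r r' [s' [t' [-> s0' t0']]]; have [s [t ->]] := sur r.
    exists (s * s' + t * t' * F), (s * t' + t * s'); split.
    * by rewrite !rmorphD !rmorphM -(chart_sq ch); ring.
    * by apply: (vD); [exact: vM|rewrite mulrAC; exact: vM].
    * by apply: (vD); exact: vM.
- by exists 1; [exact: unit_at1|rewrite rmorph1].
- by move=> r r' [g ug ->] [g' ug' ->]; exists (g * g'); [apply/unit_atM|rewrite rmorphM].
- move=> r [s [t [-> s0 _]]] [g ug /eqP]; rewrite -subr_eq0 => /eqP E; apply: s0.
  have [|/eqP + _] := inj (s - g) t; first by rewrite -[RHS]E rmorphB; ring.
  by rewrite subr_eq0 => /eqP->.
have [x Vx vx] := affine_point affC pp; exists x => //.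
apply: (affine_point_inj affV) => //.
have eqv g : unit_at g (f x) <-> unit_at (phi g) x.
  by have /seteqP[s1 s2] := opre_basic_open f g; split=> [/s1|/s2].
have vxE r : ~ unit_at r x <-> p r by rewrite -vx.
apply/seteqP; split=> g; rewrite /vanishing /= => ng ug.
  by apply: (pS (phi g)); [apply/vxE; rewrite -eqv|exists g].
move/eqv: ug; apply/vxE; apply: Ip; exists g, 0; split=> //.
by rewrite rmorph0 mul0r addr0.
Qed.

(** [x'] corresponds to the image of the prime of [x] under the involution [y |-> - y], and may be
    equal to [x]. *)
Lemma conjugate_point x : oset (fi V) x -> exists2 x', oset (fi V) x' &
  forall s t, unit_at (phi s + phi t * y) x' <-> unit_at (phi s - phi t * y) x.
Proof.
move=> Vx; have [affV _ _] := chart_pid ch; have affC := fi_affine hf affV.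
have [sur inj] := chart_top ch.
have [v0 vD vM v1 vP] := affine_prime affC Vx.
pose p := [set r | exists s t, r = phi s + phi t * y /\ ~ unit_at (phi s - phi t * y) x].
have uniq s t s' t' : phi s + phi t * y = phi s' + phi t' * y -> s = s' /\ t = t'.
  move/eqP; rewrite -subr_eq0 => /eqP E.
  have [|/eqP + /eqP] := inj (s - s') (t - t'); first by rewrite -[RHS]E !rmorphB; ring.
  by rewrite !subr_eq0 => /eqP-> /eqP->.
have pE s t : p (phi s + phi t * y) <-> ~ unit_at (phi s - phi t * y) x.
  by split=> [[s' [t' [/uniq[-> ->]]]]|] //; exists s, t.
have mulE s t s' t' : (phi s + phi t * y) * (phi s' + phi t' * y) =
    phi (s * s' + t * t' * F) + phi (s * t' + t * s') * y.
  by rewrite !rmorphD !rmorphM -(chart_sq ch); ring.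
have mulE' s t s' t' : phi (s * s' + t * t' * F) - phi (s * t' + t * s') * y =
    (phi s - phi t * y) * (phi s' - phi t' * y).
  by rewrite !rmorphD !rmorphM -(chart_sq ch); ring.
have pp : prime_ideal p.
  split.
  - by exists 0, 0; split; rewrite !rmorph0 mul0r ?addr0 ?subr0.
  - move=> r r' [s [t [-> n1]]] [s' [t' [-> n2]]]; exists (s + s'), (t + t').
    split; first by rewrite !rmorphD; ring.
    by rewrite !rmorphD (_ : _ - _ = (phi s - phi t * y) + (phi s' - phi t' * y));
      [exact: vD|ring].
  - move=> r r' [s' [t' [-> n2]]]; have [s [t ->]] := sur r.
    by rewrite mulE; apply/pE; rewrite mulE'; exact: vM.
  - move=> [s [t [e n]]]; apply: n; have [<- <-] : 1 = s /\ 0 = t.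
      by apply: uniq; rewrite -e rmorph1 rmorph0 mul0r addr0.
    by rewrite rmorph1 rmorph0 mul0r subr0; exact: unit_at1.
  - move=> r r'; have [s [t ->]] := sur r; have [s' [t' ->]] := sur r'.
    by rewrite mulE !pE mulE'; exact: vP.
have [x' Vx' vx'] := affine_point affC pp; exists x' => // s t.
have := pE s t; rewrite -vx' /vanishing /= => -[E1 E2].
by split=> u; apply: contrapT => nu; [exact: (E2 nu)|exact: (E1 nu)].
Qed.

End Fibres.

(** [J] is the ideal of functions off whose zeros [n] generates [M]. A norm in [J] comes from [V],
    so that [n] generates over the preimage of a neighbourhood of [w] and not just near two points
    of [C]. *)
Lemma line_bundle_traceable (M : sheafOfModules C) : line_bundle M -> traceable f M.
Proof.
move=> lb; have qc := locally_free_quasi_coherent (@smodP C M) lb.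
apply/(traceableP hK hf); split=> // w.
have [V [y [F [ch Vw _]]]] := chart_exists hK hf (I : oset (Defs.openT P) w).
have [affV _ _] := chart_pid ch; have affC := fi_affine hf affV.
have [sur inj] := chart_top ch.
have [x Vx fx] := fibre_point ch Vw.
have [x' Vx' conj] := conjugate_point ch Vx.
have [n [gx gx']] := generates_at_pair affC lb Vx Vx'.
pose J := [set r : OC (fi V) | forall z, unit_at r z -> generates_at n z].
have Jex z : oset (fi V) z -> generates_at n z -> exists2 r, J r & unit_at r z.
  move=> Vz [W [k [Wz be]]]; have [r [ur rW]] := affine_base affC Vz Wz.
  by exists r => // z' /rW Wz'; exists W, k.
have JD r s : J r -> J s -> J (r + s).
  by move=> Jr Js z /(unit_atD affC)[/Jr|/Js].
have JM r s : J s -> J (r * s) by move=> Js z /unit_atM[_ /Js].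
(* Prime avoidance for [J]: if [r1] and [r2] are each a unit at only one of the two points, their
   sum is a unit at both. *)
have [r [Jr rx rx']] : exists r, [/\ J r, unit_at r x & unit_at r x'].
  have [v0 vD vM _ _] := affine_prime affC Vx.
  have [v0' vD' vM' _ _] := affine_prime affC Vx'.
  have [r1 J1 u1] := Jex x Vx gx; have [r2 J2 u2] := Jex x' Vx' gx'.
  case: (pselect (unit_at r1 x')) => [u1'|n1]; first by exists r1.
  case: (pselect (unit_at r2 x)) => [u2'|n2]; first by exists r2.
  exists (r1 + r2); split; first exact: JD.
    apply: contrapT => nu; have : ~ unit_at ((r1 + r2) + -1 * r2) x.
      by apply: (vD) => //; exact: vM.
    by apply; rewrite (_ : _ + _ = r1) //; ring.
  apply: contrapT => nu; have : ~ unit_at ((r1 + r2) + -1 * r1) x'.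
    by apply: (vD') => //; exact: vM'.
  by apply; rewrite (_ : _ + -1 * r1 = r2) //; ring.
(* The norm of r is a function on V that is nonzero at w because r does not vanish
   at x nor at its conjugate. *)
have [s [t er]] := sur r.
pose nu := s * s - t * t * F.
have nuE : fsh f V nu = (fsh f V s - fsh f V t * y) * r.
  by rewrite er /nu rmorphB !rmorphM -(chart_sq ch); ring.
have Jnu : J (fsh f V nu) by rewrite nuE; exact: JM.
have unw : unit_at nu w.
  have /seteqP[_ s2] := opre_basic_open f nu; rewrite -fx; apply: s2 => /=.
  by rewrite nuE; apply/unit_atM; split=> //; apply/conj; rewrite -er.
have h : basic_open nu `<=` V := @basic_openS P OP V nu.
have pD := pid_basic_open (chart_pid ch) unw.
have chD := chart_res h unw pD ch.
have [affD _ _] := pD; have affCD := fi_affine hf affD.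
have bn : is_basis (fun _ : 'I_1 => mres M (fiS h) n).
  apply: generates_everywhere => z Dz.
  have /seteqP[s1 _] := opre_basic_open f nu.
  have [W [k [Wz be]]] := Jnu z (s1 z Dz).
  have iW := @openIl _ W (fi (basic_open nu)); have iD := @openIr _ W (fi (basic_open nu)).
  exists (Defs.openI W (fi (basic_open nu))), iD; split=> //.
  have := is_basis_res iW be; congr (is_basis _); apply/funext => i.
  by rewrite (mres_comp _ _ (subset_trans iW k)) (mres_comp _ _ (subset_trans iW k)).
have [surn injn] := basis1_top (fun z => id) bn; rewrite mres_id in surn injn.
have [surD injD] := chart_top chD.
(* On the basis [n, y n] the section [y] acts as it does on [1, y]. *)
exists (basic_open nu), (rres OC (fiS h) y), (rres OP h F), (mres M (fiS h) n),
  (rres OC (fiS h) y *: mres M (fiS h) n), 0, 1, (rres OP h F); split=> //.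
split.
- apply: dbasis_affine => //; first exact: smodP.
  + exact: (quasi_coherentP M).1.
  + move=> m; have [q ->] := surn m; have [a [b ->]] := surD q; exists a, b.
    by rewrite scalerDl scalerA.
  + by move=> a b; rewrite scalerA -scalerDl => /injn/injD.
- by rewrite rmorph0 rmorph1 scale0r add0r scale1r.
- by rewrite rmorph0 scale0r subr0 scalerA (chart_sq chD).
Qed.

End LineBundles.

Theorem theorem6p1 (K : fieldType) (hK : 2%N \notin [pchar K]%R)
    (P : projectiveLine K) (C : scheme) (f : schemeMorphism C P)
    (hf : double_cover f) :
  [/\ smooth (over_P1 f) ->
        forall M : sheafOfModules C, traceable f M <-> line_bundle M,
      reduced C ->
        forall M : sheafOfModules C,
          traceable f M <-> [/\ coherent M, rank1 f M & torsion_free f M]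
    & ~ reduced C ->
        [/\ forall M : sheafOfModules C,
              coherent M -> rank1 f M -> torsion_free f M -> traceable f M,
            forall M : sheafOfModules C, traceable f M -> torsion_free f M
          & forall M : sheafOfModules C,
              traceable f M -> ~ rank1 f M -> killed_by_nilradical M]].
Proof.
have [eta etaP] := P1_generic_point P.
split=> [sm M|red M|_].
- by split; [exact: traceable_line_bundle|exact: line_bundle_traceable].
- split=> [tr|[coh r1 tf]]; last exact: coherent_traceable.
  split; [exact: traceable_coherent tr|exact: (traceable_rank1 hK hf etaP red tr)|].
  exact: (traceable_torsion_free hK hf tr).
- split=> M; first by move=> coh r1 tf; exact: coherent_traceable.
    by move=> tr; exact: (traceable_torsion_free hK hf tr).
  by move=> tr nr1; exact: (traceable_nilradical hK hf etaP tr nr1).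
Qed.
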